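(* Let $G$ be a graph on $[n]$ with edge ideal $I(G)$. Then $S/I(G)^{(2)}$ is generalized Cohen-Macaulay if and only if $G$ is unmixed and $G_i$ is special Cohen-Macaulay for all $i\in [n]$.
   Context: $k$ is a fixed field, $S=k[x_1,\dots,x_n]$, $\mathfrak m=(x_1,\dots,x_n)S$. Graphs are finite and simple (no loops, no multiple edges), $V(G)=[n]=\{1,\dots,n\}$. The edge ideal is $I(G)=(x_ix_j : ij\in E(G))\subseteq S$. $I(G)^{(2)}=\bigcap_F P_F^2$, where $F$ runs over the maximal independent sets of $G$ and $P_F=(x_j : j\notin F)S$. For $I$ a monomial ideal, $S/I$ is generalized Cohen-Macaulay if $H^i_{\mathfrak m}(S/I)$ has finite length for all $i<\dim(S/I)$. $G$ is unmixed if $I(G)$ is unmixed, i.e. $\dim(S/I(G))=\dim(S/P)$ for all $P\in\mathrm{Ass}(S/I(G))$; equivalently, all maximal independent sets of $G$ have the same cardinality. A graph is Cohen-Macaulay if the Stanley-Reisner ring over $k$ of its independence complex (the simplicial complex of independent sets of vertices; equivalently, this ring is the polynomial ring on the vertices modulo the edge ideal) is Cohen-Macaulay; the graph with no vertices is Cohen-Macaulay. $N(p)$ is the set of vertices adjacent to $p$. For $i\in[n]$, $G_i$ is the subgraph of $G$ induced on $V(G)\setminus(\{i\}\cup N(i))$. $\alpha(H)$ is the maximal cardinality of an independent set of a graph $H$ ($0$ for the graph with no vertices). For an edge $pq$ of a graph $H$, $H_{pq}$ is the subgraph of $H$ induced on $V(H)\setminus(N(p)\cup N(q))$ (neighbourhoods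 taken in $H$). A graph $H$ is special Cohen-Macaulay if $H$ is Cohen-Macaulay and for every edge $pq$ of $H$ the graph $H_{pq}$ is Cohen-Macaulay and $\alpha(H_{pq})=\alpha(H)-1$. *)

(* Defs.v *)
(* Plain Mathematical Components, with multinomials for polynomial rings. *)
From HB Require Import structures.
From mathcomp Require Import all_boot all_order all_algebra.
From mathcomp Require Import fraction mpoly.

Set Implicit Arguments.
Unset Strict Implicit.
Unset Printing Implicit Defensive.

Import GRing.Theory.
Local Open Scope ring_scope.

(* Subsets of a ring or module are Prop-valued predicates, so that ideals,
   primes and submodules range over all subsets, not only decidable ones. *)

Definition psub (T : Type) (A B : T -> Prop) : Prop := forall x, A x -> B x.

Definition pstrict (T : Type) (A B : T -> Prop) : Prop :=
  psub A B /\ exists2 x, B x & ~ A x.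

Section Ideals.
Variable R : comNzRingType.
Implicit Types (I J P : R -> Prop) (s : seq R).

Definition is_ideal I : Prop :=
  [/\ I 0, forall f g, I f -> I g -> I (f + g) & forall a f, I f -> I (a * f)].

Definition is_prime P : Prop :=
  [/\ is_ideal P, ~ P 1 & forall f g, P (f * g) -> P f \/ P g].

Definition ideal_gen (A : R -> Prop) : R -> Prop :=
  fun f => forall J, is_ideal J -> psub A J -> J f.

Definition ideal_mul I J : R -> Prop :=
  ideal_gen (fun h => exists f g, [/\ I f, J g & h = f * g]).

(* P is an associated prime of the module R / I: the annihilator of the class
   of some f. *)
Definition is_ass I P : Prop :=
  is_prime P /\ exists f, forall g, P g <-> I (g * f).

Definition has_prime_chain I (d : nat) : Prop :=
  exists P : nat -> R -> Prop,
    [/\ forall j, (j <= d)%N -> is_prime (P j),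
        forall j, (j < d)%N -> pstrict (P j) (P j.+1)
      & psub I (P 0%N)].

(* The Krull dimension of R / I is d. *)
Definition krull_dim I (d : nat) : Prop :=
  has_prime_chain I d /\ forall e, has_prime_chain I e -> (e <= d)%N.

(* s is a regular sequence on R / I. *)
Fixpoint regular_seq I s : Prop :=
  match s with
  | [::] => ~ I 1
  | f :: s' => (forall g, I (f * g) -> I g) /\
               regular_seq (ideal_gen (fun h => I h \/ h = f)) s'
  end.

(* The maximal length of a regular sequence on R / I inside m is d. *)
Definition depth m I (d : nat) : Prop :=
  (exists s, [/\ size s = d, forall f, f \in s -> m f & regular_seq I s]) /\
  (forall s, (forall f, f \in s -> m f) -> regular_seq I s -> (size s <= d)%N).

Definition unmixed_ideal I : Prop :=
  exists2 d, krull_dim I d & forall P, is_ass I P -> krull_dim P d.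

End Ideals.

Section PolynomialRing.
Variables (k : fieldType) (n : nat).
Local Notation S := {mpoly k[n]}.
Local Notation K := {fraction S}.
Implicit Types (I : S -> Prop) (s t : {set 'I_n}).

Definition max_ideal : S -> Prop := ideal_gen (fun f => exists i : 'I_n, f = 'X_i).

(* Cohen-Macaulayness of the k-algebra S / I, for I homogeneous, in the graded
   sense: depth with respect to the irrelevant ideal equals dimension. *)
Definition cohen_macaulay I : Prop :=
  exists2 d, krull_dim I d & depth max_ideal I d.

(* Local cohomology with support in (x_1, ..., x_n) is the cohomology of the
   Cech complex on x_1, ..., x_n.  All localisations S_(x_s), where x_s is the
   product of the x_i for i in s, are viewed inside the fraction field of S, so
   that the localisation maps of the Cech complex of S are inclusions; the Cech
   complex of S / I is the quotient of that of S by its I-multiple, because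
   (S / I)_(x_s) = S_(x_s) / I S_(x_s). *)

(* I S_(x_s), for an ideal I; the case I = S gives S_(x_s). *)
Definition loc I s (u : K) : Prop :=
  exists f (e : nat), I f /\ u = tofrac f / tofrac (\prod_(i in s) 'X_i) ^+ e.

Definition cochain := {ffun {set 'I_n} -> K}.

(* I C^i, where C^i is the direct sum of the S_(x_s) over the s of size i.  The
   degree is an integer because coboundaries in degree 0 come from degree -1. *)
Definition cech I (i : int) (c : cochain) : Prop :=
  forall s, if #|s|%:Z == i then loc I s (c s) else c s = 0.

Definition unit_ideal : S -> Prop := fun=> True.

Definition cech_diff (c : cochain) : cochain :=
  [ffun t : {set 'I_n} => \sum_(j in t)
     (-1) ^+ #|[set l in t | (l < j)%N]| * c (t :\ j)].

Definition cocycle I (i : int) (c : cochain) : Prop :=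
  cech unit_ideal i c /\ cech I (i + 1) (cech_diff c).

Definition coboundary I (i : int) (c : cochain) : Prop :=
  cech unit_ideal i c /\
  exists2 b, cech unit_ideal (i - 1) b & cech I i (c - cech_diff b).

Definition cochain_scale (f : S) (c : cochain) : cochain :=
  [ffun s => tofrac f * c s].

Definition is_submodule (N : cochain -> Prop) : Prop :=
  [/\ N 0, forall b c, N b -> N c -> N (b + c)
    & forall f c, N c -> N (cochain_scale f c)].

(* The S-module Z / B has finite length: the lengths of the chains of
   submodules between B and Z are bounded. *)
Definition finite_length_quot (Z B : cochain -> Prop) : Prop :=
  exists m : nat, forall (l : nat) (N : nat -> cochain -> Prop),
    (forall j, (j <= l)%N -> [/\ is_submodule (N j), psub B (N j) & psub (N j) Z]) ->
    (forall j, (j < l)%N -> pstrict (N j) (N j.+1)) ->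
    (l <= m)%N.

Definition local_cohomology_finite_length I (i : nat) : Prop :=
  finite_length_quot (cocycle I i%:Z) (coboundary I i%:Z).

Definition generalized_cohen_macaulay I : Prop :=
  exists2 d, krull_dim I d &
    forall i, (i < d)%N -> local_cohomology_finite_length I i.

End PolynomialRing.

(* A graph on n vertices is an adjacency relation e : rel 'I_n (symmetric and
   irreflexive in the theorem); its induced subgraphs are given by their vertex
   sets W : {set 'I_n}. *)

Section Graphs.
Variables (n : nat) (e : rel 'I_n).
Implicit Types (F W : {set 'I_n}) (p q : 'I_n).

Definition independent F : bool :=
  [forall i in F, forall j in F, ~~ e i j].

Definition nbhd W p : {set 'I_n} := [set v in W | e p v].

Definition alpha W : nat :=
  \max_(F : {set 'I_n} | (F \subset W) && independent F) #|F|.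

(* The vertex set of G_i. *)
Definition link_vertices (i : 'I_n) : {set 'I_n} :=
  ~: (i |: nbhd [set: 'I_n] i).

(* The vertex set of H_pq, for H induced on W. *)
Definition edge_vertices W p q : {set 'I_n} := W :\: (nbhd W p :|: nbhd W q).

(* The subgraph induced on W, with its vertices renumbered. *)
Definition induced W : rel 'I_#|W| :=
  fun i j => e (enum_val i) (enum_val j).

End Graphs.

Section GraphIdeals.
Variable k : fieldType.

Definition edge_ideal n (e : rel 'I_n) : {mpoly k[n]} -> Prop :=
  ideal_gen (fun f => exists i j, e i j /\ f = 'X_i * 'X_j).

Definition unmixed n (e : rel 'I_n) : Prop := unmixed_ideal (edge_ideal e).

(* P_F = (x_j : j not in F) *)
Definition coface_ideal n (F : {set 'I_n}) : {mpoly k[n]} -> Prop :=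
  ideal_gen (fun f => exists2 j, j \notin F & f = 'X_j).

(* I(G)^(2) *)
Definition symbolic_square n (e : rel 'I_n) : {mpoly k[n]} -> Prop :=
  fun f => forall F : {set 'I_n}, maxset (independent e) F ->
    ideal_mul (coface_ideal F) (coface_ideal F) f.

Definition stanley_reisner_ideal n (face : pred {set 'I_n}) : {mpoly k[n]} -> Prop :=
  ideal_gen (fun f => exists2 A, ~~ face A & f = \prod_(i in A) 'X_i).

(* The subgraph of e induced on W is Cohen-Macaulay over k. *)
Definition cm_graph n (e : rel 'I_n) (W : {set 'I_n}) : Prop :=
  cohen_macaulay (stanley_reisner_ideal (independent (@induced n e W))).

Definition special_cm_graph n (e : rel 'I_n) (W : {set 'I_n}) : Prop :=
  cm_graph e W /\
  forall p q, p \in W -> q \in W -> e p q ->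
    cm_graph e (edge_vertices e W p q) /\
    alpha e (edge_vertices e W p q) = (alpha e W - 1)%N.

End GraphIdeals.

(* Main.v *)
Require Import Defs.
From HB Require Import structures.
From mathcomp Require Import all_boot all_order all_algebra.
From mathcomp Require Import fraction mpoly zify ring.
From Stdlib Require Import FunctionalExtensionality PropExtensionality Classical.

Set Implicit Arguments.
Unset Strict Implicit.
Unset Printing Implicit Defensive.
Import GRing.Theory.
Local Open Scope ring_scope.

(** Everything is read off from the grading by Laurent monomials.  For a complex
    [D] let [symb D r] be the intersection, over the facets of [D], of the [r]-th
    powers of the primes generated by the variables outside the facet.  For the
    independence complex this is the edge ideal when [r] is 1 and its second
    symbolic power when [r] is 2.  In a given degree the Cech complex of the
    quotient is the cochain complex of a family of vertex sets ([live]): the sets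
    that contain the positions of the negative exponents and lie in a facet
    outside which the exponents add up to less than [r].  Acyclicity of such a
    family ([exact]) is a question about the complex alone, treated with cones,
    Mayer-Vietoris and passage to links.

    Cohen-Macaulay graphs ([r] is 1).  The families are cones, or consist of the
    faces that contain a given face; so local cohomology vanishes below the
    dimension exactly when Reisner's condition holds.  Depth is compared with
    local cohomology as follows.  Multiplication by the first element of a
    regular sequence is injective on the first nonzero local cohomology module,
    which is torsion ([regular_vanish]).  Conversely an explicit regular sequence
    is given by the sums of the face monomials of each size ([theta_nzd]); they
    work over every field, also over a finite one.  This gives Reisner's
    criterion ([cohen_macaulay_reisner]).

    Generalized Cohen-Macaulayness ([r] is 2).  A graded piece does not change
    when a negative exponent is lowered, so finite length forces it to vanish in
    every degree with a negative exponent ([exact_of_finite_length]).  If an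
    exponent is at least 2 the family is a cone, and only finitely many degrees
    have all exponents 0 or 1, so the converse holds too
    ([finite_length_of_exact]).  There remain the families given by a nonempty
    set [t] of negative positions and a set [A] of positions with exponent 1.
    An independence complex is flag, and this makes such a family a cone, or a
    union of two cones meeting in a cone, unless [A] has at most one element or
    is an edge ([exact_nearly]).  In the first case the family is the set of the
    faces containing [t], and acyclicity below the dimension for all nonempty [t]
    means that the facets have equal size and that every [G_i] is
    Cohen-Macaulay.  In the second case, for an edge [pq] of [G_i], the family is
    the union of the stars of [p] and [q]; Mayer-Vietoris moves its cohomology to
    the common part of the links, which is the independence complex of the
    subgraph of [G_i] attached to [pq] ([exact_two_stars]).  Acyclicity then says
    that this subgraph is Cohen-Macaulay of the dimension required.

    Krull dimensions come from an elementary argument: elements chosen along a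
    chain of primes are algebraically independent modulo the bottom of the chain
    ([chain_free]), and counting monomials bounds the number of such elements
    ([facet_dependent]). *)

(** * Signed coboundaries on families of finite sets *)

Section Coboundary.
Variables (R : pzRingType) (n : nat).
Implicit Types (s t : {set 'I_n}) (v j l : 'I_n) (c : {set 'I_n} -> R).

Definition pos v t : nat := #|[set l in t | (l < v)%N]|.

Definition sd c t : R := \sum_(j in t) (-1) ^+ pos j t * c (t :\ j).

Lemma posD1 j l t : l \in t -> pos j t = (pos j (t :\ l) + (l < j))%N.
Proof.
move=> lt; rewrite /pos; case: ltnP => lj.
- rewrite (cardsD1 l) inE lt lj addnC; congr (_ + _)%N.
  by apply: eq_card => x; rewrite !inE andbA.
- rewrite addn0; apply: eq_card => x; rewrite !inE.
  by case: eqP => [->|//]; rewrite ltnNge lj andbF.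
Qed.

Lemma posU1 j l t : l \notin t -> pos j (l |: t) = (pos j t + (l < j))%N.
Proof. by move=> lt; rewrite (@posD1 j l) ?setU11 // setU1K. Qed.

Lemma sd_sd c t : sd (sd c) t = 0.
Proof.
rewrite /sd; under eq_bigr => j jt do rewrite big_distrr /=.
pose F j l := (-1) ^+ pos j t * ((-1) ^+ pos l (t :\ j) * c (t :\ j :\ l)).
have -> : \sum_(j in t) \sum_(l in t :\ j) F j l =
  \sum_(j in t) \sum_(l in t | (l < j)%N) F j l +
  \sum_(j in t) \sum_(l in t | (j < l)%N) F j l.
  rewrite -big_split /=; apply: eq_bigr => j jt.
  rewrite (bigID (fun l : 'I_n => (l < j)%N)) /=; congr (_ + _);
    apply: eq_bigl => l; rewrite !inE -val_eqE /=; case: (l \in t) => //=;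
    rewrite ?andbT ?andbF //; case: ltngtP => //.
rewrite [X in _ + X](exchange_big_dep (mem t)) /=; last by move=> j l _ /andP[].
rewrite -big_split /= big1 // => j jt.
under [X in _ + X]eq_bigl => l do rewrite jt /=.
rewrite -big_split big1 // => l /andP[lt lj] /=.
rewrite /F setDDl setUC -setDDl !mulrA -!exprD.
rewrite (posD1 j lt) lj (posD1 l jt) [(j < l)%N]ltnNge (ltnW lj) /= addn0.
by rewrite addn1 addSn exprS mulN1r addnC mulNr addNr.
Qed.

(** Joining the vertex [v] is a contracting homotopy for [sd]. *)
Definition hm v c s : R := if v \in s then 0 else (-1) ^+ pos v s * c (v |: s).

Lemma sd_hm v c t : sd (hm v c) t + hm v (sd c) t = c t.
Proof.
rewrite {2}/hm; case: ifP => [vt|/negbT vt].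
  rewrite addr0 /sd (bigD1 v) //= big1 => [|j /andP[jt jv]]; last first.
    by rewrite /hm !inE eq_sym jv vt mulr0.
  rewrite addr0 /hm !inE eqxx /= setD1K // mulrA -exprD.
  by rewrite (posD1 v vt) ltnn addn0 -signr_odd oddD addbb expr0 mul1r.
rewrite /sd big_setU1 //= setU1K // mulrDr mulrA -exprD.
rewrite (posU1 v vt) ltnn addn0 -signr_odd oddD addbb expr0 mul1r.
rewrite addrC -addrA big_distrr -big_split big1 ?addr0 //= => j jt.
have jv : j != v by apply: contraNneq vt => <-.
have -> : (v |: t) :\ j = v |: (t :\ j).
  by apply/setP => x; rewrite !inE; case: (eqVneq x v) => [->|]; rewrite // eq_sym jv.
rewrite /hm !inE (negbTE vt) andbF !mulrA -!exprD (posD1 v jt) (posU1 j vt).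
rewrite -mulrDl.
suff -> : (-1 : R) ^+ (pos v (t :\ j) + (j < v) + (pos j t + (v < j))) =
   - (-1) ^+ (pos j t + pos v (t :\ j)) by rewrite addNr mul0r.
have : (j < v)%N (+) (v < j)%N.
  by move: jv; rewrite -val_eqE /=; case: ltngtP.
move=> sgn; have S p q : odd p = ~~ odd q -> (-1 : R) ^+ p = - (-1) ^+ q.
  by move=> E; rewrite -(signr_odd _ p) E signrN signr_odd.
apply: S; move: sgn; rewrite !oddD !oddb.
by case: (odd (pos v _)); case: (odd (pos j _)); case: (v < j)%N; case: (j < v)%N.
Qed.

Lemma eq_sd c c' t : (forall j, j \in t -> c (t :\ j) = c' (t :\ j)) ->
  sd c t = sd c' t.
Proof. by move=> E; apply: eq_bigr => j jt; rewrite E. Qed.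

Lemma sdB c c' t : sd (fun s => c s - c' s) t = sd c t - sd c' t.
Proof.
by rewrite /sd -sumrB; apply: eq_bigr => j _; rewrite mulrBr.
Qed.

End Coboundary.

Lemma raddf_sd (R R' : pzRingType) n (f : {additive R -> R'})
    (c : {set 'I_n} -> R) t :
  f (sd c t) = sd (fun s => f (c s)) t.
Proof.
by rewrite /sd raddf_sum; apply: eq_bigr => j _; rewrite raddfMsign.
Qed.

(** * Acyclicity of convex families *)

Section Exact.
Variables (k : pzRingType) (n : nat).
Implicit Types (s t u : {set 'I_n}) (v : 'I_n) (c : {set 'I_n} -> k).
Implicit Types (L A B : pred {set 'I_n}).

Definition cut L c s : k := if L s then c s else 0.

(** Vanishing of the cohomology, on sets of size [i], of the relative cochain
    complex of a family [L] of sets: the cochains are the functions on [L].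
    For [L] the faces containing a fixed face, this is reduced simplicial
    cohomology of the link of that face, shifted in degree. *)
Definition exact L (i : nat) : Prop :=
  forall a : {set 'I_n} -> k,
    (forall t, L t -> #|t| = i.+1 -> sd (cut L a) t = 0) ->
    exists b, forall s, L s -> #|s| = i -> a s = sd (cut L b) s.

Definition convex L : Prop :=
  forall s t u, s \subset t -> t \subset u -> L s -> L u -> L t.

Lemma eq_exact L A i : L =1 A -> exact L i -> exact A i.
Proof.
have E (K K' : pred {set 'I_n}) : K =1 K' -> forall c t, sd (cut K c) t = sd (cut K' c) t.
  by move=> LA c t; apply: eq_sd => j _; rewrite /cut LA.
move=> LA ex a ha; have [|b hb] := ex a.
  by move=> t Lt st; rewrite (E _ _ LA) ha // -LA.
by exists b => s As ss; rewrite hb ?LA //; apply: E.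
Qed.

Lemma exact0 L i : L =1 xpred0 -> exact L i.
Proof. by move=> L0 a _; exists a => s; rewrite L0. Qed.

(** Convexity makes the relative coboundary square to zero: a set between two
    members is a member, so cutting down to [L] loses no term. *)
Lemma cut_sd_sd L b t : convex L -> L t -> sd (cut L (sd (cut L b))) t = 0.
Proof.
move=> cL Lt; rewrite -(sd_sd (cut L b) t); apply: eq_sd => j jt.
rewrite {1}/cut; case: ifP => // /negbT nL; rewrite /sd big1 // => l _.
rewrite /cut; case: ifP => [L2|]; rewrite ?mulr0 //.
by case/negP: nL; apply: cL L2 Lt; rewrite subsetDl.
Qed.

(** The contracting homotopy at [v] respects a family that is stable under adding
    and removing [v]. *)
Lemma exact_cone L v i : (forall s, v \notin s -> L (v |: s) = L s) -> exact L i.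
Proof.
move=> Lv a ha; exists (hm v a) => s Ls si.
have -> : sd (cut L (hm v a)) s = sd (hm v (cut L a)) s.
  apply: eq_sd => j _; rewrite /cut /hm; case: ifP => L1; case: ifP => // /negbT v1.
    by rewrite Lv // L1.
  by rewrite Lv // L1 mulr0.
have := sd_hm v (cut L a) s; rewrite {2}/hm; case: ifP => [_|/negbT vs].
  by rewrite addr0 => ->; rewrite /cut Ls.
rewrite ha ?mulr0 ?addr0 => [->||]; rewrite /cut ?Ls ?Lv //.
by rewrite cardsU1 vs si.
Qed.

(** The only cochain on a one-element family is never a coboundary. *)
Lemma exact_single L u : (1 : k) != 0 -> L =1 pred1 u -> exact L #|u| -> False.
Proof.
move=> nz Lu ex; have [t|b] := ex (fun=> 1); first by rewrite Lu => /eqP-> /n_Sn.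
move/(_ u); rewrite Lu /= eqxx => /(_ isT erefl) /eqP.
rewrite /sd big1 ?(negbTE nz) // => j ju; rewrite /cut Lu /=.
case: eqP => [E|_]; last by rewrite mulr0.
by move: ju; rewrite -E !inE eqxx.
Qed.

Section MayerVietoris.
Variables A B : pred {set 'I_n}.
Let L s := A s || B s.
Let M s := A s && B s.
Hypothesis cL : convex L.
Hypothesis Adown : forall s t, s \subset t -> L s -> A t -> A s.
Hypothesis Bdown : forall s t, s \subset t -> L s -> B t -> B s.
Hypotheses (exA : forall i, exact A i) (exB : forall i, exact B i).

Let convex_sub (C : pred {set 'I_n}) : (forall s, C s -> L s) ->
  (forall s t, s \subset t -> L s -> C t -> C s) -> convex C.
Proof.
move=> CL Cd s t u st tu Cs Cu; apply: (Cd _ _ tu _ Cu).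
exact: cL st tu (CL _ Cs) (CL _ Cu).
Qed.

Let AL s : A s -> L s. Proof. by rewrite /L => ->. Qed.
Let BL s : B s -> L s. Proof. by rewrite /L => ->; rewrite orbT. Qed.
Let cA : convex A. Proof. exact: convex_sub AL Adown. Qed.

Let sd_sub (C D : pred {set 'I_n}) c t :
  (forall s, D s -> C s) -> (forall s, s \subset t -> C s -> D s) ->
  sd (cut C c) t = sd (cut D c) t.
Proof.
move=> DC CD; apply: eq_sd => j _; rewrite /cut; case: ifP => C1.
  by rewrite CD // subsetDl.
by case: ifP => // /DC; rewrite C1.
Qed.

Let sdLA c t : A t -> sd (cut L c) t = sd (cut A c) t.
Proof. by move=> At; apply: sd_sub => // s st Ls; apply: Adown At. Qed.
Let sdLB c t : B t -> sd (cut L c) t = sd (cut B c) t.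
Proof. by move=> Bt; apply: sd_sub => // s st Ls; apply: Bdown Bt. Qed.
Let sdAM c t : B t -> sd (cut A c) t = sd (cut M c) t.
Proof.
move=> Bt; apply: sd_sub => [s /andP[]//|s st As].
by apply/andP; split=> //; apply: Bdown Bt => //; apply: AL.
Qed.
Let sdBM c t : A t -> sd (cut B c) t = sd (cut M c) t.
Proof.
move=> At; apply: sd_sub => [s /andP[]//|s st Bs].
by apply/andP; split=> //; apply: Adown At => //; apply: BL.
Qed.

Let cutB (C : pred {set 'I_n}) c c' t :
  sd (cut C (fun s => c s - c' s)) t = sd (cut C c) t - sd (cut C c') t.
Proof.
by rewrite -sdB; apply: eq_sd => j _; rewrite /cut; case: ifP; rewrite ?subrr.
Qed.

Let cutcut c t : sd (cut M (cut M c)) t = sd (cut M c) t.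
Proof. by apply: eq_sd => j _; rewrite /cut; case: (M _). Qed.

(** Mayer-Vietoris: a cocycle is a coboundary on [A] and on [B] separately, and
    the difference of the two solutions is a cocycle on the intersection. *)
Lemma exact_union i : exact (fun s => A s && B s) i ->
  exact (fun s => A s || B s) i.+1.
Proof.
move=> exM a ha.
have [|b1 hb1] := exA (i := i.+1) (a := a).
  by move=> t At ti; rewrite -sdLA // ha //; exact: AL.
have [|b2 hb2] := exB (i := i.+1) (a := a).
  by move=> t Bt ti; rewrite -sdLB // ha //; exact: BL.
have [|c hc] := exM (fun s => b1 s - b2 s).
  move=> t /andP[At Bt] ti.
  by rewrite cutB -sdAM // -hb1 // -sdBM // -hb2 // subrr.
pose b s := if A s && (#|s| == i) then b1 s - sd (cut A (cut M c)) s else b2 s.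
have bA s : A s -> #|s| = i -> b s = b1 s - sd (cut A (cut M c)) s.
  by move=> As /eqP si; rewrite /b As si.
have bB s : B s -> #|s| = i -> b s = b2 s.
  move=> Bs si; rewrite /b; case: ifP => // /andP[As _].
  rewrite sdAM // cutcut.
  by rewrite -hc ?subKr //; apply/andP.
exists b => s /orP[As|Bs] si.
  rewrite sdLA // hb1 //.
  transitivity (sd (cut A (fun s => b1 s - sd (cut A (cut M c)) s)) s).
    by rewrite cutB cut_sd_sd // subr0.
  apply: eq_sd => j js; rewrite /cut; case: ifP => // A1; rewrite bA //.
  by move: si; rewrite (cardsD1 j) js => -[].
rewrite sdLB // hb2 //; apply: eq_sd => j js; rewrite /cut; case: ifP => // B1.
by rewrite bB //; move: si; rewrite (cardsD1 j) js => -[].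
Qed.

(** The connecting map: a cocycle of the intersection, extended by zero to [A],
    has a coboundary that vanishes on [B]. *)
Lemma exact_inter i : exact (fun s => A s || B s) i.+1 ->
  exact (fun s => A s && B s) i.
Proof.
move=> exL c hc.
pose a s := if A s then sd (cut A (cut M c)) s else 0.
have aB s : B s -> #|s| = i.+1 -> a s = 0.
  move=> Bs si; rewrite /a; case: ifP => // As.
  by rewrite sdAM // cutcut hc //; apply/andP.
have [t Lt ti|b hb] := exL a.
  case/orP: Lt => [At|Bt].
    rewrite sdLA // -[RHS](cut_sd_sd (cut M c) cA At).
    apply: eq_sd => j _; rewrite /cut /a; case EA: (A (t :\ j)); last by case: (L _).
    by [].
  rewrite sdLB //; transitivity (sd (cut B (fun=> 0 : k)) t).
    apply: eq_sd => j jt; rewrite /cut; case: ifP => // B1.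
    by rewrite aB //; move: ti; rewrite (cardsD1 j) jt => -[].
  by rewrite /sd big1 // => j _; rewrite /cut if_same mulr0.
have [|b2 hb2] := exB (i := i) (a := b).
  by move=> t Bt ti; rewrite -sdLB // -hb ?aB //; exact: BL.
have [|b1 hb1] := exA (i := i) (a := fun s => b s - cut M c s).
  move=> t At ti; rewrite cutB -sdLA // -hb //; last exact: AL.
  by rewrite /a At subrr.
exists (fun s => b2 s - b1 s) => s Ms si; have /andP[As Bs] := Ms.
rewrite cutB -sdBM // -sdAM // -hb2 // -hb1 // /cut.
rewrite [M s]Ms.
by rewrite opprB addrC addrNK.
Qed.

End MayerVietoris.
End Exact.

(** Joining all sets with [u0] changes the sign attached to a vertex [j] by the
    parity of [pos (phi j) u0]; rescaling cochains by [eps] absorbs this, so that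
    only the degree is shifted. *)
Section Reindex.
Variables (k : pzRingType) (m n : nat) (phi : 'I_m -> 'I_n) (u0 : {set 'I_n}).
Hypothesis phi_mono : forall i j, (phi i < phi j)%N = (i < j)%N.
Variables (L1 : pred {set 'I_m}) (L2 : pred {set 'I_n}).
Let ok (s : {set 'I_m}) := [forall i in s, phi i \notin u0].
Let h (s : {set 'I_m}) : {set 'I_n} := phi @: s :|: u0.
Hypothesis L1ok : forall s, L1 s -> [forall i in s, phi i \notin u0].
Hypothesis L12 : forall s : {set 'I_m}, [forall i in s, phi i \notin u0] ->
  L2 (phi @: s :|: u0) = L1 s.
Hypothesis L2h : forall t, L2 t ->
  exists2 s : {set 'I_m}, [forall i in s, phi i \notin u0] & t = phi @: s :|: u0.

Let phi_inj : injective phi.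
Proof.
move=> i j E; apply/val_inj/eqP; case: (ltngtP i j) => //;
  by rewrite -phi_mono E ltnn.
Qed.

Let okP s i : ok s -> i \in s -> (phi i \in u0) = false.
Proof. by move=> /forall_inP H /H/negbTE. Qed.

Let ok_sub (s s' : {set 'I_m}) : s \subset s' -> ok s' -> ok s.
Proof.
by move=> ss /forall_inP H; apply/forall_inP => i /(subsetP ss); apply: H.
Qed.

Let card_h s : ok s -> #|h s| = (#|s| + #|u0|)%N.
Proof.
move=> sok; rewrite cardsU (card_imset _ phi_inj).
suff -> : phi @: s :&: u0 = set0 by rewrite cards0 subn0.
apply/setP => x; rewrite !inE; apply/negbTE/andP => -[/imsetP[j js ->]].
by rewrite (okP sok).
Qed.

Let back (t : {set 'I_n}) : {set 'I_m} := phi @^-1: (t :\: u0).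

Let preh s : ok s -> back (h s) = s.
Proof.
move=> sok; apply/setP => x; rewrite !inE; case: (boolP (x \in s)) => xs.
  by rewrite (okP sok xs) imset_f.
case xu: (phi x \in u0) => //=; rewrite orbF.
by apply/imsetP => -[y ys /phi_inj E]; rewrite E ys in xs.
Qed.

Let eps (s : {set 'I_m}) : k := (-1) ^+ \sum_(j in s) pos (phi j) u0.

Let pos_h j s : ok s -> pos (phi j) (h s) = (pos j s + pos (phi j) u0)%N.
Proof.
move=> sok; rewrite /pos -(card_imset [set l in s | (l < j)%N] phi_inj) -cardsUI.
set X := _ @: _; rewrite (_ : X :&: _ = set0) ?cards0 ?addn0.
  apply: eq_card => x; rewrite !inE; case xu: (x \in u0) => /=.
    rewrite orbT /=; case: imsetP => // -[y + E].
    by rewrite inE => /andP[ys _]; move: (okP sok ys); rewrite -E xu.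
  rewrite !orbF; apply/andP/imsetP => [[/imsetP[y ys ->]]|[y]].
    by rewrite phi_mono => yj; exists y => //; rewrite inE ys.
  by rewrite inE => /andP[ys yj ->]; rewrite phi_mono imset_f.
apply/setP => x; rewrite !inE; apply/negbTE/negP => /andP[/imsetP[y + ->]].
by rewrite inE => /andP[ys _]; rewrite (okP sok ys).
Qed.

Let sd_h a2 s : L1 s ->
  sd (cut L1 (fun s => eps s * a2 (h s))) s = eps s * sd (cut L2 a2) (h s).
Proof.
move=> L1s; have sok := L1ok L1s; rewrite /sd.
have -> : \sum_(j in h s) (-1) ^+ pos j (h s) * cut L2 a2 (h s :\ j) =
          \sum_(j in phi @: s) (-1) ^+ pos j (h s) * cut L2 a2 (h s :\ j).
  rewrite (bigID (mem (phi @: s))) /= addrC big1 ?add0r => [|j /andP[jh /negP js]].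
    by apply: eq_bigl => j; rewrite inE andb_idl // => ->.
  rewrite /cut; case: ifP => [/L2h[s' _ E]|]; rewrite ?mulr0 //.
  have ju : j \in u0 by move: jh; rewrite inE => /orP[].
  have : j \in phi @: s' :|: u0 by rewrite inE ju orbT.
  by rewrite -E !inE eqxx.
rewrite big_imset /= => [|x y _ _ /phi_inj//]; rewrite big_distrr.
apply: eq_bigr => j js /=.
have -> : h s :\ phi j = h (s :\ j).
  apply/setP => x; rewrite !inE; case: (eqVneq x (phi j)) => [->|xj] /=.
    rewrite (okP sok js) orbF; apply/esym/negbTE/negP.
    by move=> /imsetP[y]; rewrite !inE => /andP[/eqP yj _] /phi_inj/esym.
  congr (_ || _); apply/imsetP/imsetP => -[y ys E]; exists y => //.
    by rewrite !inE ys andbT; apply: contraNneq xj => <-; apply/eqP.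
  by move: ys; rewrite !inE => /andP[].
rewrite /cut L12; last exact: ok_sub (subsetDl _ _) sok.
case: ifP => _; rewrite ?mulr0 // !mulrA; congr (_ * _).
rewrite /eps -!exprD (big_setD1 _ js) /= pos_h //.
rewrite -signr_odd -[in RHS]signr_odd !oddD; congr ((-1) ^+ nat_of_bool _).
by do 3![case: (odd _)].
Qed.

Let epsK s : eps s * eps s = 1.
Proof. by rewrite /eps -exprD -signr_odd oddD addbb. Qed.

Lemma exact_reindex i : exact k L1 i <-> exact k L2 (i + #|u0|)%N.
Proof.
split=> [ex a2 ha2|ex a1 ha1].
  have [t L1t ti|b1 hb1] := ex (fun s => eps s * a2 (h s)).
    by rewrite sd_h // ha2 ?mulr0 ?L12 ?L1ok // card_h ?ti ?addSn //; exact: L1ok.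
  exists (fun t => eps (back t) * b1 (back t)) => t L2t ti.
  have [s sok E] := L2h L2t; rewrite E in L2t ti *; rewrite L12 // in L2t.
  have si : #|s| = i by move: ti; rewrite card_h // => /addIn.
  have /(congr1 ( *%R (eps s))) := hb1 s L2t si.
  rewrite !mulrA epsK mul1r => ->.
  rewrite -[RHS]mul1r -(epsK s) -mulrA -sd_h //; congr (_ * _).
  apply: eq_sd => j _; rewrite /cut; case: ifP => // L1j.
  by rewrite preh ?mulrA ?epsK ?mul1r //; apply: L1ok.
pose a2 t := eps (back t) * a1 (back t).
have E12 s : ok s -> eps s * a2 (h s) = a1 s by move=> sok; rewrite /a2 preh // mulrA epsK mul1r.
have [t L2t|b2 hb2] := ex a2.
  have [s sok E] := L2h L2t; rewrite E in L2t *; rewrite L12 // in L2t.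
  rewrite card_h // -addSn => /addIn si.
  rewrite -[LHS]mul1r -(epsK s) -mulrA -sd_h //.
  rewrite -[RHS](mulr0 (eps s)) -[in RHS](ha1 s L2t si); congr (_ * _).
  by apply: eq_sd => j _; rewrite /cut; case: ifP => // /L1ok/E12.
exists (fun s => eps s * b2 (h s)) => s L1s si; have sok := L1ok L1s.
by rewrite sd_h // -hb2 ?E12 ?L12 // card_h // si.
Qed.

End Reindex.

(** * Ideals and primes *)

Lemma predext (T : Type) (A B : T -> Prop) : (forall x, A x <-> B x) -> A = B.
Proof.
move=> AB; apply: functional_extensionality => x.
exact: propositional_extensionality.
Qed.

Section IdealTheory.
Variable R : comNzRingType.
Implicit Types (I J P A : R -> Prop) (f g : R).

Lemma ideal_gen_ideal A : is_ideal (ideal_gen A).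
Proof.
split=> [J [] //|f g If Ig J JI AJ|a f If J JI AJ]; have [_ D M] := JI.
  by apply: D; [apply: If|apply: Ig].
by apply: M; apply: If.
Qed.

Lemma ideal_gen_sub A : psub A (ideal_gen A).
Proof. by move=> x Ax J _; apply. Qed.

Lemma idealN I f : is_ideal I -> I f -> I (- f).
Proof. by case=> _ _ M If; rewrite -mulN1r; apply: M. Qed.

Lemma idealB I f g : is_ideal I -> I f -> I g -> I (f - g).
Proof. by move=> II If Ig; have [_ D _] := II; apply: D => //; apply: idealN. Qed.

Lemma ideal_sum I (X : Type) (s : seq X) (Q : pred X) (F : X -> R) :
  is_ideal I -> (forall x, Q x -> I (F x)) -> I (\sum_(x <- s | Q x) F x).
Proof. by case=> I0 D _ IF; apply: big_ind. Qed.

Definition adjoin I f : R -> Prop := ideal_gen (fun h => I h \/ h = f).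

Lemma adjoinE I f g : is_ideal I ->
  adjoin I f g <-> exists a h, I h /\ g = a * f + h.
Proof.
move=> II; have [I0 D M] := II; split=> [gen|[a [h [Ih ->]]]].
  apply: (gen (fun g => exists a h, I h /\ g = a * f + h)) => [|x [Ix|->]]; last first.
  - by exists 1, 0; rewrite mul1r addr0.
  - by exists 0, x; rewrite mul0r add0r.
  split=> [|x y [a [h [Ih ->]]] [b [h' [Ih' ->]]]|c x [a [h [Ih ->]]]].
  - by exists 0, 0; rewrite mul0r addr0.
  - by exists (a + b), (h + h'); split; [apply: D|rewrite mulrDl addrACA].
  - by exists (c * a), (c * h); split; [apply: M|rewrite mulrDr mulrA].
have [_ D' M'] := ideal_gen_ideal (fun h => I h \/ h = f).
apply: D'; first by apply: M'; apply: ideal_gen_sub; right.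
by apply: ideal_gen_sub; left.
Qed.

Lemma adjoin_ideal I f : is_ideal (adjoin I f). Proof. exact: ideal_gen_ideal. Qed.
Lemma adjoin_sub I f : psub I (adjoin I f).
Proof. by move=> x Ix; apply: ideal_gen_sub; left. Qed.
Lemma adjoin_mem I f : adjoin I f f.
Proof. by apply: ideal_gen_sub; right. Qed.

Lemma adjoin_least I J f : is_ideal J -> psub I J -> J f -> psub (adjoin I f) J.
Proof. by move=> JI IJ Jf x; apply=> // y [/IJ|->]. Qed.

Lemma adjoinC I f g : adjoin (adjoin I f) g = adjoin (adjoin I g) f.
Proof.
suff E a b : psub (adjoin (adjoin I a) b) (adjoin (adjoin I b) a).
  by apply: predext => x; split; apply: E.
apply: adjoin_least; first exact: adjoin_ideal.
  apply: adjoin_least; [exact: adjoin_ideal| |exact: adjoin_mem].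
  by move=> x Ix; do 2!apply: adjoin_sub.
by apply: adjoin_sub; apply: adjoin_mem.
Qed.

Lemma adjoin_congr I f g : is_ideal I -> I (f - g) -> adjoin I f = adjoin I g.
Proof.
move=> II; have E a b : I (a - b) -> psub (adjoin I a) (adjoin I b).
  move=> Iab; apply: adjoin_least; [exact: adjoin_ideal|exact: adjoin_sub|].
  have [_ D _] := adjoin_ideal I b; rewrite -(subrK b a).
  by apply: D; [apply: adjoin_sub|apply: adjoin_mem].
move=> Ifg; apply: predext => x; split; first exact: E.
by apply: E; rewrite -opprB; apply: idealN.
Qed.

Lemma prime_X P f e : is_prime P -> P (f ^+ e) -> P f.
Proof.
case=> _ P1 PM; elim: e => [|e IH]; first by rewrite expr0 => /P1.
by rewrite exprS => /PM[].
Qed.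

(** Otherwise the product of one element of each ideal outside the prime would
    be an element of the intersection outside the prime. *)
Lemma prime_inter (X : eqType) (s : seq X) (A : X -> R -> Prop) P :
  is_prime P -> (forall x, is_ideal (A x)) ->
  (forall f, (forall x, x \in s -> A x f) -> P f) ->
  exists2 x, x \in s & psub (A x) P.
Proof.
move=> [PI P1 PM] AI sub; apply: NNPP => no.
suff [f [Af Pf]] : exists f, (forall x, x \in s -> A x f) /\ ~ P f by apply: Pf (sub _ Af).
have {no} : forall x, x \in s -> exists g, A x g /\ ~ P g.
  move=> x xs; apply: NNPP => ng; apply: no; exists x => // g Ag.
  by apply: NNPP => nP; apply: ng; exists g.
elim: s {sub} => [_|x s IH ex]; first by exists 1.
have [y ys|f [Af Pf]] := IH _; first by apply: ex; rewrite inE ys orbT.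
have [g [Ag Pg]] := ex x (mem_head _ _).
exists (f * g); split=> [y|/PM[]//]; rewrite inE => /predU1P[->|ys].
  by have [_ _ M] := AI x; apply: M.
by have [_ _ M] := AI y; rewrite mulrC; apply: M; apply: Af.
Qed.

Lemma krull_dim_uniq I d e : krull_dim I d -> krull_dim I e -> d = e.
Proof.
by move=> [cd bd] [ce be]; apply/eqP; rewrite eqn_leq be // bd.
Qed.

End IdealTheory.

(** * Monomial ideals *)

Section Monomial.
Variables (k : fieldType) (n : nat).
Local Notation S := {mpoly k[n]}.
Implicit Types (m : 'X_{1..n}) (f g : S) (s F : {set 'I_n}).

Lemma mpolyX_neq0 m : 'X_[m] != 0 :> S.
Proof. by rewrite -msupp_eq0 msuppX. Qed.

Definition mono (M : 'X_{1..n} -> Prop) : S -> Prop :=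
  fun f => forall m, m \in msupp f -> M m.

Lemma mono_in (I : S -> Prop) f : is_ideal I ->
  (forall m, m \in msupp f -> I 'X_[m]) -> I f.
Proof.
move=> II If; rewrite [f]mpolyE big_seq; apply: ideal_sum => // m mf.
by rewrite -mul_mpolyC; have [_ _ M] := II; apply/M/If.
Qed.

Lemma monoX M m : mono M 'X_[m] <-> M m.
Proof. by split=> [|Mm m' /mem_msuppXP<-//]; apply; apply/mem_msuppXP. Qed.

Lemma mono_is_ideal M : (forall m m', M m -> M (m + m')%MM) -> is_ideal (mono M).
Proof.
move=> Mup; split=> [m|f g Mf Mg m|f g Mg m]; first by rewrite msupp0.
  by move/msuppD_le; rewrite mem_cat => /orP[/Mf|/Mg].
by move/msuppM_le/allpairsP=> [[m1 m2] /= [_ /Mg M2 ->]]; rewrite addmC; apply: Mup.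
Qed.

Lemma ideal_gen_mono (A : S -> Prop) (M : 'X_{1..n} -> Prop) :
  (forall m m', M m -> M (m + m')%MM) ->
  (forall f, A f -> mono M f) ->
  (forall m, M m -> exists2 m', A 'X_[m'] & (m' <= m)%MM) ->
  ideal_gen A = mono M.
Proof.
move=> Mup AM MA; apply: predext => f; split=> [gen|Mf].
  by apply: gen => //; apply: mono_is_ideal.
apply: (mono_in (ideal_gen_ideal A)) => m /Mf/MA[m' Am' le].
rewrite -(submK le) mpolyXD; have [_ _ D] := ideal_gen_ideal A.
by apply: D; apply: ideal_gen_sub.
Qed.

Definition deg_off F m : nat := (\sum_(j | j \notin F) m j)%N.

Lemma deg_offD F m m' : deg_off F (m + m')%MM = (deg_off F m + deg_off F m')%N.
Proof. by rewrite /deg_off -big_split; apply: eq_bigr => j _; rewrite mnmDE. Qed.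

Lemma deg_offU F j : j \notin F -> deg_off F U_(j)%MM = 1%N.
Proof.
move=> jF; rewrite /deg_off (bigD1 j) //= mnm1E eqxx big1 // => i /andP[_ ij].
by rewrite mnm1E eq_sym (negbTE ij).
Qed.

Lemma deg_off_gt0P F m : reflect (exists2 j, j \notin F & (0 < m j)%N) (0 < deg_off F m)%N.
Proof.
rewrite lt0n sum_nat_eq0; apply: (iffP forall_inPn) => -[j jF mj]; exists j => //.
  by rewrite lt0n.
by rewrite -lt0n.
Qed.

(** The [r]-th symbolic power of the Stanley-Reisner ideal of a complex [D]:
    its facets [F] give the minimal primes, and the monomials in the [r]-th
    power of such a prime have degree at least [r] outside [F]. *)
Definition symbM (D : pred {set 'I_n}) r m : bool :=
  [forall (F | maxset D F), (r <= deg_off F m)%N].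

Definition symb D r : S -> Prop := mono (symbM D r).

Lemma symbMD D r m m' : symbM D r m -> symbM D r (m + m')%MM.
Proof.
move=> /forall_inP H; apply/forall_inP => F mF.
by rewrite deg_offD; apply: leq_trans (H _ mF) (leq_addr _ _).
Qed.

Lemma symb_ideal D r : is_ideal (symb D r).
Proof. exact: mono_is_ideal (@symbMD D r). Qed.

Lemma symbX D r m : symb D r 'X_[m] <-> symbM D r m.
Proof. exact: monoX. Qed.

(** With this, cochains with coefficients in the ring are the case [r = 0] of
    cochains with coefficients in a symbolic power. *)
Lemma unit_idealE D : @unit_ideal k n = symb D 0.
Proof. by apply: predext => f; split=> // _ m _; apply/forall_inP. Qed.

Lemma maxset_subset F F' : maxset (fun s => s \subset F) F' <-> F' = F.
Proof.
split=> [/maxsetP[sub /(_ F (subxx _) sub)//]|->].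
by apply/maxsetP; split=> // B BF FB; apply/eqP; rewrite eqEsubset BF.
Qed.

Lemma symbM_subset F r m : symbM (fun s => s \subset F) r m = (r <= deg_off F m)%N.
Proof.
apply/forall_inP/idP => [|le F' /maxset_subset-> //].
by apply; apply/maxset_subset.
Qed.

(** The [r]-th power of the prime generated by the variables outside [F], as the
    symbolic power attached to the simplex on [F]. *)
Definition facet_ideal F r : S -> Prop := symb (fun s => s \subset F) r.

Lemma facet_idealP F r f :
  facet_ideal F r f <-> forall m, m \in msupp f -> (r <= deg_off F m)%N.
Proof. by split=> H m /H; rewrite symbM_subset. Qed.

Lemma symb_facet D r f :
  symb D r f <-> forall F, maxset D F -> facet_ideal F r f.
Proof.
split=> [H F mF|H m mf]; last first.
  by apply/forall_inP => F mF; move/facet_idealP: (H F mF); apply.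
by apply/facet_idealP => m /H/forall_inP; apply.
Qed.

Lemma coface_idealE F : @coface_ideal k n F = facet_ideal F 1.
Proof.
apply: ideal_gen_mono => [|f [j jF ->]|m]; first exact: symbMD.
  by apply/monoX; rewrite symbM_subset deg_offU.
rewrite symbM_subset => /deg_off_gt0P[j jF mj]; exists U_(j)%MM; first by exists j.
by rewrite lep1mP -lt0n.
Qed.

Lemma coface_mul F :
  ideal_mul (@coface_ideal k n F) (@coface_ideal k n F) = facet_ideal F 2.
Proof.
rewrite !coface_idealE; apply: ideal_gen_mono => [|f [g [h]]|m].
- exact: symbMD.
- case=> /facet_idealP Fg /facet_idealP Fh -> m.
  move=> /msuppM_le/allpairsP[[m1 m2] /= [/Fg w1 /Fh w2 ->]].
  by rewrite symbM_subset deg_offD; apply: (leq_add w1 w2).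
rewrite symbM_subset => w2; have /deg_off_gt0P[i iF mi] := ltnW w2.
have le1 : (U_(i) <= m)%MM by rewrite lep1mP -lt0n.
have : (0 < deg_off F (m - U_(i)))%N.
  by move: w2; rewrite -{1}(submK le1) deg_offD deg_offU // addn1.
case/deg_off_gt0P=> j jF mj; exists (U_(j) + U_(i))%MM.
  by exists 'X_j, 'X_i; rewrite mpolyXD; split=> //; apply/symbX; rewrite symbM_subset deg_offU.
rewrite -(submK le1); apply/mnm_lepP => x; rewrite !mnmDE leq_add2r.
by move: x; apply/mnm_lepP; rewrite lep1mP -lt0n.
Qed.

Lemma symbolic_squareE (e : rel 'I_n) :
  @symbolic_square k n e = symb (independent e) 2.
Proof.
apply: predext => f; split=> [H|H F].
  by apply/symb_facet => F mF; rewrite -coface_mul; apply: H.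
by rewrite coface_mul; move/symb_facet: H; apply.
Qed.

Definition supp m : {set 'I_n} := [set j | (0 < m j)%N].

Definition complex (D : pred {set 'I_n}) : Prop :=
  D set0 /\ forall s t : {set 'I_n}, s \subset t -> D t -> D s.

Lemma symbM1 D m : complex D -> symbM D 1 m = ~~ D (supp m).
Proof.
move=> [_ Dd]; apply/forall_inP/idP => [H|nD F mF].
  apply/negP => Ds; have [F mF sF] := maxset_exists Ds.
  have /deg_off_gt0P[j jF mj] := H F mF.
  by case/negP: jF; apply: (subsetP sF); rewrite inE.
have : ~~ (supp m \subset F).
  by apply: contra nD => sF; apply: Dd sF (maxsetp mF).
by case/subsetPn=> j; rewrite inE => mj jF; apply/deg_off_gt0P; exists j.
Qed.

Definition ind s e : 'X_{1..n} := [multinom (e * (i \in s))%N | i < n].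

Lemma indE s e i : ind s e i = (e * (i \in s))%N. Proof. exact: mnmE. Qed.

Lemma prodX_ind s : \prod_(i in s) 'X_i = 'X_[ind s 1] :> S.
Proof.
rewrite mprodXE; congr 'X_[_]; apply/mnmP => i; rewrite mnm_sumE indE mul1n.
under eq_bigr => j _ do rewrite mnm1E.
case: (boolP (i \in s)) => si.
  rewrite (bigD1 i) //= eqxx big1 // => j /andP[_ ji].
  by rewrite (negbTE ji).
by rewrite big1 // => j js; case: eqP => // E; rewrite -E js in si.
Qed.

Lemma supp_ind s : supp (ind s 1) = s.
Proof. by apply/setP => i; rewrite inE indE mul1n lt0b. Qed.

Lemma stanley_reisnerE D : complex D -> @stanley_reisner_ideal k n D = symb D 1.
Proof.
move=> cD; apply: ideal_gen_mono => [|f [A nA ->]|m]; first exact: symbMD.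
  by rewrite prodX_ind; apply/monoX; rewrite symbM1 // supp_ind.
rewrite symbM1 // => nD; exists (ind (supp m) 1).
  by exists (supp m); rewrite ?prodX_ind.
by apply/mnm_lepP => i; rewrite indE mul1n inE; case: ltnP.
Qed.

Lemma independentP (e : rel 'I_n) s :
  reflect (forall i j, i \in s -> j \in s -> ~~ e i j) (independent e s).
Proof.
apply: (iffP forall_inP) => [H i j si sj|H i si].
  by have /forall_inP := H i si; apply.
by apply/forall_inP => j; apply: H.
Qed.

Lemma independent_complex (e : rel 'I_n) : complex (independent e).
Proof.
split=> [|s t st /independentP it]; first by apply/independentP => i j; rewrite inE.
by apply/independentP => i j /(subsetP st) ti /(subsetP st); apply: it.
Qed.

Lemma edge_idealE (e : rel 'I_n) : irreflexive e ->
  @edge_ideal k n e = symb (independent e) 1.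
Proof.
move=> e_irr; have cI := independent_complex e.
apply: ideal_gen_mono => [|f [i [j [eij ->]]]|m]; first exact: symbMD.
  rewrite -mpolyXD; apply/monoX; rewrite symbM1 //.
  apply/negP => /independentP/(_ i j); rewrite !inE !mnmDE !mnm1E !eqxx eij.
  by case: (j == i) => H; have := H isT; case: (i == j) => /(_ isT).
rewrite symbM1 // => /forall_inPn[i mi /forall_inPn[j mj /negPn eij]].
exists (U_(i) + U_(j))%MM; first by exists i, j; rewrite mpolyXD.
have ij : i != j by apply: contraTneq eij => ->; rewrite e_irr.
move: mi mj; rewrite !inE => mi mj.
apply/mnm_lepP => x; rewrite mnmDE !mnm1E.
case: (eqVneq i x) => [<-|_]; first by rewrite eq_sym (negbTE ij).
by case: (eqVneq j x) => [<-|_].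
Qed.

End Monomial.

(** * Krull dimension *)

Section PrimeChains.
Variables (k : fieldType) (n : nat).
Local Notation S := {mpoly k[n]}.
Implicit Types (P : nat -> S -> Prop) (ys : seq S) (F : {set 'I_n}).

(** Exponents are lists, so that an induction can peel off the first of the
    elements whose powers are multiplied. *)
Fixpoint words N e : seq (seq nat) :=
  if e is e'.+1 then [seq a :: w | a <- iota 0 N, w <- words N e'] else [:: [::]].

Fixpoint mon ys (w : seq nat) : S :=
  match ys, w with
  | y :: ys', a :: w' => y ^+ a * mon ys' w'
  | _, _ => 1
  end.

Lemma size_words N e : size (words N e) = (N ^ e)%N.
Proof. by elim: e => //= e IH; rewrite size_allpairs size_iota IH expnS. Qed.

Lemma uniq_words N e : uniq (words N e).
Proof.
elim: e => //= e IH; apply: allpairs_uniq => //; first exact: iota_uniq.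
by move=> [a w] [b w'] _ _ [-> ->].
Qed.

(** Algebraic independence modulo [P_0] of elements [y_j] chosen along a chain of
    primes: in a relation, the part free of [y_0] lies in [P_1], hence vanishes by
    induction; the rest is divisible by [y_0], which can be cancelled modulo
    [P_0]. *)
Lemma chain_free P ys N (v : seq nat -> k) :
  (forall j, (j <= size ys)%N -> is_prime (P j)) ->
  (forall j, (j < size ys)%N ->
     [/\ psub (P j) (P j.+1), P j.+1 (nth 0 ys j) & ~ P j (nth 0 ys j)]) ->
  P 0%N (\sum_(w <- words N (size ys)) v w *: mon ys w) ->
  forall w, w \in words N (size ys) -> v w = 0.
Proof.
elim: ys P v => [|y ys IH] P v Pp Py.
  rewrite /= big_seq1 => Pv w; rewrite inE => /eqP->; apply/eqP; apply: contraT => nz.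
  have [[_ _ M] P1 _] := Pp 0%N isT; case: P1.
  rewrite -(scale1r 1) -(mulVf nz) -scalerA -mul_mpolyC; exact: M.
have IH' u := IH (fun j => P j.+1) u (fun j => Pp j.+1) (fun j => Py j.+1).
have [[P0I _ P0M] [P1I _ _]] := (Pp 0%N isT, Pp 1%N isT).
have [P01 P1y P0y] := Py 0%N isT; rewrite /= in P1y P0y.
pose T u := \sum_(w <- words N (size ys)) u w *: mon ys w.
have slices N' (u : nat -> seq nat -> k) : P 0%N (\sum_(a < N') y ^+ a * T (u a)) ->
    forall a w, (a < N')%N -> w \in words N (size ys) -> u a w = 0.
  elim: N' u => [u _ a w //|N' IHN u].
  rewrite big_ord_recl expr0 mul1r.
  under eq_bigr => a _ do rewrite exprS -mulrA.
  rewrite -big_distrr /= => P0s.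
  have u0 w : w \in words N (size ys) -> u 0%N w = 0.
    apply: IH' => //; have [_ _ M] := P1I.
    rewrite -/(T (u 0%N)) -[T _](addrK (y * (\sum_(i < N') y ^+ i * T (u (bump 0 i))))).
    by apply: idealB => //; [apply: P01|rewrite mulrC; apply: M].
  have T0 : T (u 0%N) = 0.
    by rewrite /T big_seq big1 // => w wW; rewrite u0 // scale0r.
  move: P0s; rewrite T0 add0r => /P0M[/P0y//|P0s] [|a] w aN wW; first exact: u0.
  exact: (IHN (fun a => u a.+1)).
move=> P0s w /= /allpairsPdep[a [w' [aN wW ->]]].
move: aN; rewrite mem_iota /= add0n => aN.
apply: (slices N (fun a w => v (a :: w))) => //.
move: P0s; rewrite /= big_allpairs_dep.
have -> : iota 0 N = index_iota 0 N by rewrite /index_iota subn0.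
rewrite big_mkord.
congr (P 0%N _); apply: eq_bigr => b _; rewrite big_distrr /=.
by apply: eq_bigr => u _; rewrite scalerAr.
Qed.

Lemma mdeg_mon ys D N w : {in ys, forall y, {in msupp y, forall m, mdeg m <= D}%N} ->
  w \in words N (size ys) ->
  {in msupp (mon ys w), forall m, mdeg m <= size ys * (N * D)}%N.
Proof.
have exp (y : S) a : {in msupp y, forall m, mdeg m <= D}%N ->
    {in msupp (y ^+ a), forall m, mdeg m <= a * D}%N.
  move=> yD; elim: a => [|a IH] m.
    by rewrite expr0 msupp1 inE => /eqP->; rewrite mdeg0.
  rewrite exprS => /msuppM_le/allpairsP[[m1 m2] /= [/yD d1 /IH d2 ->]].
  by rewrite mdegD mulSn leq_add.
elim: ys w => [|y ys IH] w yD /=.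
  by move=> _ m; rewrite msupp1 inE => /eqP->; rewrite mdeg0.
case/allpairsPdep=> [a [w' [aN wW ->]]] m /msuppM_le/allpairsP[[m1 m2] /= [d1 d2 ->]].
rewrite mdegD mulSn leq_add //.
  apply: leq_trans (exp _ _ _ _ d1) _; first by apply: yD; rewrite mem_head.
  by move: aN; rewrite mem_iota leq_mul2r => /andP[_ /ltnW->]; rewrite orbT.
by apply: IH wW _ d2 => z zs; apply: yD; rewrite inE zs orbT.
Qed.

(** Counting monomials: modulo the variables outside [F], the [N ^ e] products
    of powers below [N] of [e] fixed polynomials lie in a space of dimension
    [O(N ^ #|F|)]; for [e > #|F|] and [N] large they are linearly dependent. *)
Lemma facet_dependent F ys : (#|F| < size ys)%N ->
  exists N v, (exists2 w, w \in words N (size ys) & v w != 0) /\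
    facet_ideal F 1 (\sum_(w <- words N (size ys)) v w *: mon ys w).
Proof.
move=> Fy; set e := size ys.
have [D yD] : exists D, {in ys, forall y, {in msupp y, forall m, mdeg m <= D}%N}.
  exists (\max_(y <- ys) msize y) => y ys_y m my.
  apply: leq_trans (ltnW (msize_mdeg_lt my)) _.
  by apply: (@leq_bigmax_seq _ _ xpredT (fun y : S => msize y)) ys_y _.
(* [B <= C * N], hence [B ^ f <= C ^ f * N ^ f < N ^ f.+1 <= N ^ e], where [f] is [#|F|] *)
pose C := (e * D).+1; pose N := (C ^ #|F|).+1; pose B := (e * (N * D)).+1.
have BN : (B ^ #|F| < N ^ e)%N.
  have le : (B ^ #|F| <= C ^ #|F| * N ^ #|F|)%N.
    rewrite -expnMn; have [->//|F0] := posnP #|F|.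
    by rewrite leq_exp2r // /B /C /N; nia.
  apply: leq_ltn_trans le _; apply: (@leq_trans (N ^ #|F|.+1)).
    by rewrite expnS ltn_pmul2r ?expn_gt0.
  exact: leq_pexp2l.
pose T := {ffun {x | x \in F} -> 'I_B}.
pose mc (c : T) : 'X_{1..n} := [multinom (if insub j is Some x then val (c x) else 0%N) | j < n].
set ws := words N e.
pose A : 'M[k]_(size ws, #|T|) := \matrix_(i, c) (mon ys (nth [::] ws i))@_(mc (enum_val c)).
have : kermx A != 0.
  rewrite -mxrank_eq0 mxrank_ker subn_eq0 -ltnNge.
  apply: leq_ltn_trans (rank_leq_col A) _.
  by rewrite card_ffun card_ord card_sig size_words.
case/rowV0Pn=> u /sub_kermxP uA /rV0Pn[i0 ui0].
pose v (w : seq nat) :=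
  if (insub (index w ws) : option (ordinal (size ws))) is Some i then u 0 i else 0.
have vE (i : 'I_(size ws)) : v (nth [::] ws i) = u 0 i.
  by rewrite /v index_uniq ?uniq_words // valK.
exists N, v; split; first by exists (nth [::] ws i0); rewrite ?mem_nth // vE.
apply/facet_idealP => m; rewrite lt0n; apply: contraTneq => wm.
rewrite -mcoeff_eq0 raddf_sum /=; apply/eqP.
have [mB|/forallPn[j mB]] := boolP [forall j, m j < B]%N; last first.
  rewrite big_seq big1 // => w wW; rewrite mcoeffZ.
  rewrite memN_msupp_eq0 ?mulr0 //; apply: contra mB => mw.
  rewrite ltnS; apply: leq_trans (mdeg_mon yD wW mw).
  by rewrite mdegE (bigD1 j) ?leq_addr.
pose c : T := [ffun x => inord (m (val x))].
have mcE : mc c = m.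
  apply/mnmP => j; rewrite mnmE; case: insubP => [x _ <-|jF].
    by rewrite ffunE /= inordK //; apply: (forallP mB).
  by move/eqP: wm; rewrite sum_nat_eq0 => /forall_inP/(_ j jF)/eqP.
rewrite (big_nth [::]) big_mkord.
have /matrixP/(_ 0 (enum_rank c)) := uA; rewrite !mxE => uA0; rewrite -[RHS]uA0.
by apply: eq_bigr => i _; rewrite mcoeffZ vE mxE enum_rankK mcE.
Qed.

Lemma finite_choice (Q : nat -> S -> Prop) e :
  (forall j, (j < e)%N -> exists y, Q j y) ->
  exists2 ys : seq S, size ys = e & forall j, (j < e)%N -> Q j (nth 0 ys j).
Proof.
elim: e => [|e IH] ex; first by exists [::].
have [j je|ys sz ysQ] := IH; first by apply: ex; apply: ltnW.
have [y Qy] := ex e (ltnSn e); exists (rcons ys y); first by rewrite size_rcons sz.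
move=> j; rewrite ltnS leq_eqVlt nth_rcons sz => /predU1P[->|je].
  by rewrite ltnn eqxx.
by rewrite je; apply: ysQ.
Qed.

Lemma chain_bound F P e :
  (forall j, (j <= e)%N -> is_prime (P j)) ->
  (forall j, (j < e)%N -> pstrict (P j) (P j.+1)) ->
  psub (facet_ideal F 1) (P 0%N) -> (e <= #|F|)%N.
Proof.
move=> Pp Ps FP; rewrite leqNgt; apply/negP => Fe.
have [j je|ys sz ysQ] := @finite_choice (fun j y => P j.+1 y /\ ~ P j y) e.
  by have [_ [y]] := Ps j je; exists y.
subst e.
have [N [v [[w wW /eqP vw] dep]]] := facet_dependent Fe; case: vw.
apply: (@chain_free P ys N v Pp _ _ w wW); last exact: FP dep.
by move=> j je; have [? _] := Ps j je; have [? ?] := ysQ j je.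
Qed.

(** Setting the variables outside [F] to zero is a ring morphism to a domain,
    with this kernel. *)
Lemma facet_prime F : is_prime (@facet_ideal k n F 1).
Proof.
pose t : n.-tuple S := [tuple if i \in F then 'X_i else 0 | i < n].
have tX (m : 'X_{1..n}) : \prod_(i < n) tnth t i ^+ m i = if deg_off F m == 0%N then 'X_[m] else 0.
  have [/eqP wm|] := boolP (deg_off F m == 0%N).
    rewrite mpolyXE_id; apply: eq_bigr => i _; rewrite tnth_mktuple.
    case: ifP => // iF; have -> : m i = 0%N; last by rewrite !expr0.
    by move/eqP: wm; rewrite sum_nat_eq0 => /forall_inP/(_ i); rewrite iF => /(_ isT)/eqP.
  rewrite -lt0n => /deg_off_gt0P[i iF mi]; rewrite (bigD1 i) //= tnth_mktuple.
  by rewrite (negbTE iF) expr0n gtn_eqF // mul0r.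
have ker f : facet_ideal F 1 f <-> f \mPo t = 0.
  split=> [/facet_idealP Ff|f0].
    rewrite comp_mpolyE big_seq big1 // => m /Ff; rewrite lt0n => wm.
    by rewrite tX (negbTE wm) scaler0.
  apply/facet_idealP => m; rewrite lt0n; apply: contraTN => wm.
  rewrite -mcoeff_eq0; suff <- : (f \mPo t)@_m = f@_m by rewrite f0 mcoeff0.
  rewrite comp_mpolyE [in RHS](mpolyE f) !raddf_sum; apply: eq_bigr => m' _ /=.
  rewrite !mcoeffZ tX; case: ifP => // wm'.
  rewrite mcoeffX; case: eqP => [E|_]; last by rewrite mcoeff0.
  by rewrite E wm in wm'.
split=> [||f g]; first exact: symb_ideal.
  by move/ker; rewrite comp_mpoly1 => /eqP; rewrite oner_eq0.
move/ker; rewrite rmorphM => /eqP; rewrite mulf_eq0 => /orP[] /eqP fg; [left|right];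
  exact/ker.
Qed.

Lemma facet_chain F : has_prime_chain (@facet_ideal k n F 1) #|F|.
Proof.
pose G j := [set x in drop j (enum F)].
have GE j : (j < #|F|)%N -> exists2 x, x \notin G j.+1 & G j = x |: G j.+1.
  rewrite cardE => jF; have [x xE] : exists x, drop j (enum F) = x :: drop j.+1 (enum F).
    by case: F jF {G} => F jF; exists (tnth (in_tuple _) (Ordinal jF));
      rewrite (tnth_nth (tnth (in_tuple _) (Ordinal jF))) -drop_nth.
  exists x; last by apply/setP => y; rewrite !inE xE inE.
  by have := drop_uniq j (enum_uniq F); rewrite xE inE /= => /andP[].
have PG x F' : psub (@facet_ideal k n (x |: F') 1) (facet_ideal F' 1).
  move=> f /facet_idealP H; apply/facet_idealP => m /H.
  case/deg_off_gt0P=> j; rewrite !inE negb_or => /andP[_ jF] mj.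
  by apply/deg_off_gt0P; exists j.
exists (fun j => facet_ideal (G j) 1); split=> [j _|j /GE[x xG ->]|].
- exact: facet_prime.
- split; first exact: PG.
  exists 'X_x; first by apply/symbX; rewrite symbM_subset deg_offU.
  move/symbX; rewrite symbM_subset => /deg_off_gt0P[i]; rewrite !inE mnm1E eq_sym.
  by case: (x == i).
by have -> : G 0%N = F by apply/setP => x; rewrite inE drop0 mem_enum.
Qed.

Lemma facet_krull F : krull_dim (@facet_ideal k n F 1) #|F|.
Proof.
split; first exact: facet_chain.
by move=> e [P [Pp Ps FP]]; apply: chain_bound Pp Ps FP.
Qed.

End PrimeChains.

Section ComplexDim.
Variables (k : fieldType) (n : nat) (D : pred {set 'I_n}).
Hypothesis cD : complex D.
Implicit Types (s F : {set 'I_n}).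

Definition cdim : nat := \max_(s | D s) #|s|.

Lemma leq_cdim s : D s -> (#|s| <= cdim)%N.
Proof. exact: leq_bigmax_cond. Qed.

Lemma cdim_facet : exists2 F, maxset D F & #|F| = cdim.
Proof.
have [s Ds sE] : {s | D s & cdim = #|s|}.
  by apply: eq_bigmax_cond; apply/card_gt0P; exists set0; case: cD.
have [F mF sF] := maxset_exists Ds; exists F => //; apply/eqP.
by rewrite eqn_leq leq_cdim ?(maxsetp mF) // sE subset_leq_card.
Qed.

(** The prime contains the intersection of the powers of the facet primes, hence
    one of these powers, hence the variables that generate it. *)
Lemma symb_prime r (P : {mpoly k[n]} -> Prop) : is_prime P ->
  psub (symb D r) P -> exists2 F, maxset D F & psub (facet_ideal F 1) P.
Proof.
move=> Pp sub; have PI : is_ideal P by case: Pp.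
have [f Ff|F] := @prime_inter _ _ (enum (maxset D)) (fun F => facet_ideal F r) P Pp
    (fun F => symb_ideal k _ r).
  by apply/sub/symb_facet => F mF; apply: Ff; rewrite mem_enum.
rewrite mem_enum => mF FP; exists F => // f Ff; apply: (mono_in PI) => m /Ff.
rewrite symbM_subset => wm; apply: (@prime_X _ P _ r Pp); apply: FP.
rewrite mpolyXn; apply/symbX; rewrite symbM_subset.
by elim: r {sub Ff} => // r IH; rewrite mulmS deg_offD -add1n leq_add.
Qed.

Lemma symb_krull r : (0 < r)%N -> krull_dim (@symb k n D r) cdim.
Proof.
move=> r_gt0; split.
  have [F mF <-] := cdim_facet; have [P [Pp Ps FP]] := facet_chain k F.
  exists P; split=> // f /symb_facet/(_ F mF)/facet_idealP Ff; apply: FP.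
  by apply/facet_idealP => m /Ff; apply: leq_trans.
move=> e [P [Pp Ps sub]]; have [F mF FP] := symb_prime (Pp 0%N isT) sub.
exact: leq_trans (chain_bound Pp Ps FP) (leq_cdim (maxsetp mF)).
Qed.

(** The monomial of the face [F] lies in the primes of all the other facets but
    not in the prime of [F], which is therefore its annihilator. *)
Lemma facet_ass F : maxset D F -> is_ass (@symb k n D 1) (facet_ideal F 1).
Proof.
move=> mF; split; first exact: facet_prime.
exists 'X_[ind F 1] => g; split=> [/facet_idealP Fg|/symb_facet/(_ F mF)].
  apply/symb_facet => F' mF'; apply/facet_idealP => m.
  case/msuppM_le/allpairsP=> -[m1 m2] /= [/Fg/deg_off_gt0P[j jF mj]].
  move/mem_msuppXP<- => ->; rewrite deg_offD.
  case: (boolP (F \subset F')) => [FF'|/subsetPn[i iF iF']].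
    rewrite (maxsetsup mF (maxsetp mF') FF') addn_gt0.
    by apply/orP; left; apply/deg_off_gt0P; exists j.
  rewrite addn_gt0; apply/orP; right; apply/deg_off_gt0P; exists i => //.
  by rewrite indE iF.
have [_ _ FM] := facet_prime k F; case/FM => // /symbX.
rewrite symbM_subset => /deg_off_gt0P[j jF]; rewrite indE (negbTE jF) muln0 //.
Qed.

(** The annihilator of [f] is the intersection of the facet primes that do not
    contain [f]; being prime, it is one of them. *)
Lemma symb_unmixed :
  unmixed_ideal (@symb k n D 1) <-> (forall F, maxset D F -> #|F| = cdim).
Proof.
split=> [[d dd H] F mF|pure].
  rewrite -(krull_dim_uniq (H _ (facet_ass mF)) (facet_krull k F)).
  exact: krull_dim_uniq dd (symb_krull _).
exists cdim => [|P [Pp [f Pf]]]; first exact: symb_krull.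
have [PI P1 PM] := Pp.
have [|h hP|F] := @prime_inter _ _ (enum [pred F | maxset D F])
  (fun F h => facet_ideal F 1 (h * f)) P Pp _ _.
- move=> F; have [I0 ID IM] := symb_ideal k (fun s : {set 'I_n} => s \subset F) 1.
  split=> [|x y Ix Iy|a x Ix]; first by rewrite mul0r.
    by rewrite mulrDl; apply: ID.
  by rewrite -mulrA; apply: IM.
- by apply/Pf/symb_facet => F mF; apply: hP; rewrite mem_enum.
rewrite mem_enum inE => mF FP; rewrite -(pure F mF).
have nF : ~ facet_ideal F 1 f by move=> Ff; apply/P1/FP; rewrite mul1r.
suff -> : P = facet_ideal F 1 by apply: facet_krull.
have [[_ _ FI] _ FM] := facet_prime k F; apply: predext => h; split=> [/Pf|Fh].
  by move/symb_facet/(_ F mF)/FM => [].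
by apply: FP; rewrite mulrC; apply: FI.
Qed.

End ComplexDim.

(** * Local cohomology and regular sequences *)

Section Cech.
Variables (k : fieldType) (n : nat).
Local Notation S := {mpoly k[n]}.
Local Notation K := {fraction S}.
Local Notation unit_ideal := (@unit_ideal k n).
Local Notation cochain := (@cochain k n).
Implicit Types (I J : S -> Prop) (s t : {set 'I_n}) (j : 'I_n) (f g : S) (u v w : K).
Implicit Types (i : int) (b c : cochain).

(** The denominators of [loc], as monomials. *)
Definition xs s e : K := tofrac 'X_[ind s e].

Lemma xsE s e : tofrac (\prod_(i in s) 'X_i : S) ^+ e = xs s e.
Proof.
rewrite -tofracXn prodX_ind mpolyXn; congr (tofrac 'X_[_]).
by apply/mnmP => i; rewrite mulmnE !indE mul1n mulnC.
Qed.

Lemma xs_neq0 s e : xs s e != 0.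
Proof. by rewrite tofrac_eq0 mpolyX_neq0. Qed.

Lemma xsD s e e' : xs s (e + e') = xs s e * xs s e'.
Proof.
rewrite -tofracM -mpolyXD; congr (tofrac 'X_[_]); apply/mnmP => i.
by rewrite mnmDE !indE mulnDl.
Qed.

Lemma xsU s t e : [disjoint s & t] -> xs (s :|: t) e = xs s e * xs t e.
Proof.
move=> st; rewrite -tofracM -mpolyXD; congr (tofrac 'X_[_]); apply/mnmP => i.
rewrite mnmDE !indE inE -mulnDr; case: (boolP (i \in s)) => //= si.
by rewrite (disjointFr st si).
Qed.

Lemma xs1 j e : xs [set j] e = tofrac 'X_j ^+ e.
Proof. by rewrite -xsE big_set1. Qed.

Lemma xs0 e : xs set0 e = 1.
Proof. by rewrite -xsE big_set0 tofrac1 expr1n. Qed.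

Lemma locP I s u : loc I s u <-> exists f e, I f /\ u = tofrac f / xs s e.
Proof. by split=> -[f [e [If ->]]]; exists f, e; rewrite xsE. Qed.

Lemma loc_frac I s f e : I f -> loc I s (tofrac f / xs s e).
Proof. by move=> If; apply/locP; exists f, e. Qed.

Lemma loc_tofrac I s f : I f -> loc I s (tofrac f).
Proof.
move=> If; have := loc_frac s 0 If; suff -> : xs s 0 = 1 by rewrite divr1.
by rewrite -xsE expr0.
Qed.

Lemma loc_sub I J s u : psub I J -> loc I s u -> loc J s u.
Proof. by move=> IJ [f [e [If ->]]]; exists f, e; split=> //; apply: IJ. Qed.

Lemma loc_up I s t u : is_ideal I -> s \subset t -> loc I s u -> loc I t u.
Proof.
move=> [_ _ M] st /locP[f [e [If ->]]]; apply/locP.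
exists ('X_[ind (t :\: s) e] * f), e; split; first exact: M.
have -> : xs t e = xs (t :\: s) e * xs s e.
  have tE : t = (t :\: s) :|: s.
    by apply/setP => x; rewrite !inE; 
      case: (boolP (x \in s)) => [/(subsetP st)->|]; rewrite ?orbT ?orbF.
  rewrite {1}tE xsU // disjoints_subset.
  by apply/subsetP => x; rewrite !inE => /andP[].
by rewrite tofracM -mulf_div divff ?mul1r // xs_neq0.
Qed.

Lemma loc0 I s : is_ideal I -> loc I s 0.
Proof. by move=> [I0 _ _]; rewrite -tofrac0; apply: loc_tofrac. Qed.

Lemma locM I s v u : is_ideal I -> loc unit_ideal s v -> loc I s u -> loc I s (v * u).
Proof.
move=> [_ _ M] /locP[f [e [_ ->]]] /locP[g [e' [Ig ->]]].
by rewrite mulf_div -xsD -tofracM; apply: loc_frac; apply: M.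
Qed.

Lemma locMtofrac I s f u : is_ideal I -> loc I s u -> loc I s (tofrac f * u).
Proof. by move=> II; apply: locM => //; apply: loc_tofrac. Qed.

Lemma locD I s u v : is_ideal I -> loc I s u -> loc I s v -> loc I s (u + v).
Proof.
move=> [_ D M] /locP[f [e [If ->]]] /locP[g [e' [Ig ->]]].
rewrite addf_div ?xs_neq0 // -xsD -!tofracM -tofracD; apply: loc_frac.
by apply: D; rewrite mulrC; apply: M.
Qed.

Lemma loc_sign I s p u : is_ideal I -> loc I s u -> loc I s ((-1) ^+ p * u).
Proof. by move=> II lu; rewrite -tofrac1 -tofracN -tofracXn; apply: locMtofrac. Qed.

Lemma loc_clear I s j u : is_ideal I -> j \notin s -> loc I (j |: s) u ->
  exists N, forall N', (N <= N')%N -> loc I s (tofrac 'X_j ^+ N' * u).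
Proof.
move=> [_ _ M] js /locP[f [e [If ->]]]; exists e => N' eN.
rewrite xsU ?disjoints1 // xs1.
have -> : tofrac 'X_j ^+ N' = tofrac 'X_j ^+ e * tofrac 'X_j ^+ (N' - e) :> K.
  by rewrite -exprD subnKC.
set a := tofrac 'X_j ^+ e; set a' := tofrac 'X_j ^+ (N' - e).
have az : a != 0 by rewrite -[a]xs1 xs_neq0.
rewrite [a * a']mulrC -mulrA (mulrA a) -mulf_div divff // mul1r mulrA.
by rewrite /a' -tofracXn -tofracM; apply: loc_frac; apply: M.
Qed.

Lemma loc_adjoin J s f u : is_ideal J -> loc (adjoin J f) s u ->
  exists v w, [/\ loc unit_ideal s v, loc J s w & u = tofrac f * v + w].
Proof.
move=> JI /locP[g [e [/(adjoinE f g JI)[a [h [Jh ->]]] ->]]].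
exists (tofrac a / xs s e), (tofrac h / xs s e); split; try exact: loc_frac.
by rewrite tofracD tofracM mulrDl [tofrac a * _]mulrC mulrA.
Qed.

Definition nzd J f : Prop := forall g, J (f * g) -> J g.

Lemma loc_nzd J s f u : is_ideal J -> nzd J f -> loc unit_ideal s u ->
  loc J s (tofrac f * u) -> loc J s u.
Proof.
move=> [_ _ M] fr /locP[g [e [_ ->]]] /locP[h [e' [Jh /eqP]]].
rewrite mulrA -tofracM eqr_div ?xs_neq0 // -!tofracM tofrac_eq => /eqP E.
apply/locP; exists (g * 'X_[ind s e']), (e + e')%N; split.
  by apply: fr; rewrite mulrA E mulrC; apply: M.
by rewrite tofracM xsD -mulf_div divff ?mulr1 // xs_neq0.
Qed.

Lemma loc_set0 J g : loc J set0 (tofrac g) -> J g.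
Proof.
by move=> /locP[f [e [Jf]]]; rewrite xs0 divr1 => /eqP; rewrite tofrac_eq => /eqP->.
Qed.

Lemma unit_ideal_ideal : is_ideal unit_ideal. Proof. by []. Qed.
Hint Resolve unit_ideal_ideal : core.

Lemma cech_diffE c t : cech_diff c t = sd c t.
Proof. by rewrite ffunE. Qed.

Lemma cech_diff_diff c : cech_diff (cech_diff c) = 0.
Proof.
apply/ffunP => t; rewrite cech_diffE ffunE -[RHS](sd_sd c t).
by apply: eq_sd => j _; rewrite cech_diffE.
Qed.

Lemma cech_diffB b c : cech_diff (b - c) = cech_diff b - cech_diff c.
Proof.
apply/ffunP => t; rewrite !ffunE -!/(sd _ t) -sdB.
by apply: eq_sd => j _; rewrite !ffunE.
Qed.

Lemma cech_diff0 : cech_diff 0 = 0 :> cochain.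
Proof. by have := cech_diffB 0 0; rewrite !subrr. Qed.

Lemma cech_diffD b c : cech_diff (b + c) = cech_diff b + cech_diff c.
Proof. by rewrite -[in LHS](opprK c) cech_diffB -[- c]sub0r cech_diffB cech_diff0 sub0r opprK. Qed.

Lemma cech_diff_scale f c :
  cech_diff (cochain_scale f c) = cochain_scale f (cech_diff c).
Proof.
apply/ffunP => t; rewrite !ffunE big_distrr /=; apply: eq_bigr => j _.
by rewrite !ffunE mulrCA.
Qed.

Lemma scaleB f b c : cochain_scale f (b - c) = cochain_scale f b - cochain_scale f c.
Proof. by apply/ffunP => s; rewrite !ffunE mulrBr. Qed.

Lemma scaleM f g c : cochain_scale (f * g) c = cochain_scale f (cochain_scale g c).
Proof. by apply/ffunP => s; rewrite !ffunE tofracM mulrA. Qed.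

Lemma scale1 c : cochain_scale 1 c = c.
Proof. by apply/ffunP => s; rewrite !ffunE tofrac1 mul1r. Qed.

Lemma cech_sub I J i c : psub I J -> cech I i c -> cech J i c.
Proof. by move=> IJ Ic s; have := Ic s; case: ifP => // _; apply: loc_sub. Qed.

Lemma cech0 I i : is_ideal I -> cech I i 0.
Proof. by move=> II s; rewrite ffunE; case: ifP => // _; apply: loc0. Qed.

Lemma cechD I i b c : is_ideal I -> cech I i b -> cech I i c -> cech I i (b + c).
Proof.
move=> II Ib Ic s; have := Ib s; have := Ic s; rewrite !ffunE; case: ifP => _.
  by move=> lc lb; apply: locD.
by move=> -> ->; rewrite addr0.
Qed.

Lemma cech_scale I i f c : is_ideal I -> cech I i c -> cech I i (cochain_scale f c).
Proof.
move=> II Ic s; have := Ic s; rewrite !ffunE; case: ifP => _ => [|->].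
  exact: locMtofrac.
by rewrite mulr0.
Qed.

Lemma cechB I i b c : is_ideal I -> cech I i b -> cech I i c -> cech I i (b - c).
Proof.
move=> II Ib Ic; apply: cechD => //.
suff -> : - c = cochain_scale (- 1) c by apply: cech_scale.
by apply/ffunP => s; rewrite !ffunE tofracN tofrac1 mulN1r.
Qed.

Lemma cech_diff_cech I i c : is_ideal I -> cech I i c -> cech I (i + 1) (cech_diff c).
Proof.
move=> II Ic t; have card1 j : j \in t -> (#|t :\ j|%:Z == i) = (#|t|%:Z == i + 1).
  by move=> jt; rewrite (cardsD1 j t) jt PoszD addrC (inj_eq (addIr _)).
rewrite cech_diffE; case: ifP => ti; last first.
  by rewrite /sd big1 // => j jt; have := Ic (t :\ j); rewrite card1 // ti => ->; rewrite mulr0.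
rewrite /sd; apply: (big_ind (loc I t)) => [|u v|j jt]; first exact: loc0.
  exact: locD.
apply: loc_sign => //; apply: loc_up (subsetDl _ [set j]) _ => //.
by have := Ic (t :\ j); rewrite card1 // ti.
Qed.

Lemma cech_adjoin J i f c : is_ideal J -> cech (adjoin J f) i c ->
  exists b b', [/\ cech unit_ideal i b, cech J i b' & c = cochain_scale f b + b'].
Proof.
move=> JI Jc.
have [s|b Hb] := @fin_all_exists _ _ (fun s (p : K * K) =>
    if #|s|%:Z == i then [/\ loc unit_ideal s p.1, loc J s p.2
                          & c s = tofrac f * p.1 + p.2] else p = 0 /\ c s = 0).
  have := Jc s; case: ifP => _ => [|c0]; last by exists 0.
  by move/(loc_adjoin JI) => [v [w]]; exists (v, w).
exists [ffun s => (b s).1], [ffun s => (b s).2]; split=> [s|s|].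
- by have := Hb s; rewrite ffunE; case: ifP => _ [] // ->.
- by have := Hb s; rewrite ffunE; case: ifP => _ [] // ->.
apply/ffunP => s; rewrite !ffunE; have := Hb s; case: ifP => _ [] // -> ->.
by rewrite mulr0 addr0.
Qed.

Lemma cech_nzd J i f c : is_ideal J -> nzd J f -> cech unit_ideal i c ->
  cech J i (cochain_scale f c) -> cech J i c.
Proof.
move=> JI fr uc Jc s; have := uc s; have := Jc s; rewrite ffunE; case: ifP => _ //.
by move=> ? ?; apply: loc_nzd fr _ _.
Qed.

Lemma cech_scale_adjoin J i f c :
  cech unit_ideal i c -> cech (adjoin J f) i (cochain_scale f c).
Proof.
move=> uc s; have := uc s; rewrite ffunE; case: ifP => _ => [/locP[g [e [_ ->]]]|->].
  rewrite mulrA -tofracM; apply: loc_frac; rewrite mulrC.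
  by have [_ _ M] := adjoin_ideal J f; apply: M; apply: adjoin_mem.
by rewrite mulr0.
Qed.

Lemma coboundary_submodule I i : is_ideal I -> is_submodule (coboundary I i).
Proof.
move=> II; split=> [|c c' [uc [b ub Ib]] [uc' [b' ub' Ib']]|f c [uc [b ub Ib]]].
- split; first exact: cech0.
  by exists 0; rewrite ?cech_diff0 ?subr0; exact: cech0.
- split; first exact: cechD.
  exists (b + b'); first exact: cechD.
  by rewrite cech_diffD opprD addrACA; apply: cechD.
- split; first exact: cech_scale.
  exists (cochain_scale f b); first exact: cech_scale.
  by rewrite cech_diff_scale -scaleB; apply: cech_scale.
Qed.

Lemma cocycle_submodule I i : is_ideal I -> is_submodule (cocycle I i).
Proof.
move=> II; split=> [|c c' [uc dc] [uc' dc']|f c [uc dc]].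
- by split; rewrite ?cech_diff0; exact: cech0.
- by split; rewrite ?cech_diffD; exact: cechD.
- by split; rewrite ?cech_diff_scale; exact: cech_scale.
Qed.

Lemma coboundary_cocycle I i c : is_ideal I -> coboundary I i c -> cocycle I i c.
Proof.
move=> II [uc [b _ Ib]]; split=> //.
have -> : cech_diff c = cech_diff (c - cech_diff b).
  by rewrite cech_diffB cech_diff_diff subr0.
exact: cech_diff_cech.
Qed.

Lemma radical_ideal I : is_ideal I -> is_ideal (fun f => exists N, I (f ^+ N)).
Proof.
move=> II; have [I0 D M] := II; split=> [|f g [N IN] [N' IN']|f g [N IN]].
- by exists 1%N; rewrite expr1.
- exists (N + N')%N; rewrite exprDn; apply: ideal_sum => // i _.
  rewrite -mulr_natl; apply: (M); case: (leqP N' i) => iN.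
    by rewrite -(subnK iN) exprD mulrA; apply: M.
  rewrite mulrC; apply: (M).
  have -> : (N + N' - i = (N' - i) + N)%N by lia.
  by rewrite exprD; apply: M.
- by exists N; rewrite exprMn; apply: M.
Qed.

(** Joining [j] contracts the Cech complex up to the denominators in [x_j]. *)
Lemma variable_torsion I i c j : is_ideal I -> cocycle I i c ->
  exists N, coboundary I i (cochain_scale ('X_j ^+ N) c).
Proof.
move=> II cc; have [uc dc] := cc.
have card1 s : j \notin s -> (#|j |: s|%:Z == i + 1) = (#|s|%:Z == i).
  by move=> js; rewrite cardsU1 js PoszD addrC ?(inj_eq (addIr _)) // [RHS]eq_sym subr_eq eq_sym.
have card2 s : j \notin s -> (#|j |: s|%:Z == i) = (#|s|%:Z == i - 1).
  by move=> js; rewrite cardsU1 js PoszD addrC ?(inj_eq (addIr _)) // [RHS]eq_sym subr_eq eq_sym.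
have clear I' i' c' : is_ideal I' -> cech I' i' c' -> exists N : {set 'I_n} -> nat,
    forall s, j \notin s -> #|j |: s|%:Z == i' ->
    forall N', (N s <= N')%N -> loc I' s (tofrac 'X_j ^+ N' * c' (j |: s)).
  move=> II' Ic'; apply: (@fin_all_exists _ _ (fun s (N : nat) => j \notin s ->
    #|j |: s|%:Z == i' -> forall N', (N <= N')%N ->
    loc I' s (tofrac 'X_j ^+ N' * c' (j |: s)))) => s.
  case: (boolP (j \in s)) => js; first by exists 0%N.
  case: (boolP (#|j |: s|%:Z == i')) => si; last by exists 0%N.
  have := Ic' (j |: s); rewrite si => /(loc_clear II' js)[N HN].
  by exists N.
have [N1 HN1] := clear _ _ _ unit_ideal_ideal uc.
have [N2 HN2] := clear _ _ _ II dc.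
pose N := (\sum_s (N1 s + N2 s))%N.
have leN s : (N1 s <= N)%N /\ (N2 s <= N)%N.
  by rewrite /N (bigD1 s) //=; split; lia.
exists N; split; first exact: cech_scale.
exists [ffun s => tofrac 'X_j ^+ N * hm j c s] => s.
  rewrite ffunE /hm; case: (boolP (j \in s)) => js.
    by rewrite mulr0; case: ifP => // _; apply: loc0.
  rewrite -(card2 _ js); case: ifP => si.
    by rewrite mulrCA; apply: loc_sign => //; apply: HN1 => //; case: (leN s).
  by have := uc (j |: s); rewrite si => ->; rewrite !mulr0.
rewrite !ffunE; set d := \sum_(_ in _) _.
have -> : d = tofrac 'X_j ^+ N * (c s - hm j (sd c) s).
  rewrite -[c s](sd_hm j) addrK /d /sd big_distrr; apply: eq_bigr => l _ /=.
  by rewrite ffunE mulrCA.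
rewrite tofracXn mulrBr subKr /hm; case: (boolP (j \in s)) => js.
  by rewrite mulr0; case: ifP => // _; apply: loc0.
rewrite -cech_diffE -(card1 _ js); case: ifP => si.
  by rewrite mulrCA; apply: loc_sign => //; apply: HN2 => //; case: (leN s).
by have := dc (j |: s); rewrite si => ->; rewrite !mulr0.
Qed.

Lemma max_ideal_torsion I i c f : is_ideal I -> cocycle I i c -> max_ideal f ->
  exists N, coboundary I i (cochain_scale (f ^+ N) c).
Proof.
move=> II cc mf; have [B0 BD BM] := coboundary_submodule i II.
apply: (mf (fun g => exists N, coboundary I i (cochain_scale (g ^+ N) c)));
  last by move=> _ [j ->]; apply: variable_torsion.
apply: (@radical_ideal (fun f => coboundary I i (cochain_scale f c))).
split=> [|g h Bg Bh|g h Bh].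
- have -> : cochain_scale 0 c = 0 by apply/ffunP => s; rewrite !ffunE tofrac0 mul0r.
  exact: B0.
- have -> : cochain_scale (g + h) c = cochain_scale g c + cochain_scale h c.
    by apply/ffunP => s; rewrite !ffunE tofracD mulrDl.
  exact: BD.
- by rewrite scaleM; apply: BM.
Qed.

(** In terms of depth, the depth of [S / J] is at least [a]. *)
Definition vanish J (a : nat) : Prop :=
  forall i, (i < a%:Z)%R -> psub (cocycle J i) (coboundary J i).

Lemma neg_vanish I i : is_ideal I -> (i < 0)%R -> psub (cocycle I i) (coboundary I i).
Proof.
move=> II i0 c [uc _]; have -> : c = 0; last by have [] := coboundary_submodule i II.
apply/ffunP => s; have := uc s; rewrite ffunE; case: ifP => // /eqP E.
by move: i0; rewrite -E; lia.
Qed.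

(** The long exact sequence of multiplication by [f], spelled out: if the
    coboundary of [c] is [f u] modulo [J], then [u] is a cocycle modulo [J], and a
    primitive of [u] corrects [c] to a cocycle modulo [J]. *)
Lemma vanish_adjoin J f a : is_ideal J -> nzd J f -> vanish J a.+1 -> vanish (adjoin J f) a.
Proof.
move=> JI fr van i ia c [uc dc].
have [u [v [uu Jv dcE]]] := cech_adjoin JI dc.
have zu : cocycle J (i + 1) u.
  split=> //; apply: cech_nzd fr _ _ => //; first exact: cech_diff_cech.
  have -> : cochain_scale f (cech_diff u) = - cech_diff v.
    apply/eqP; rewrite -addr_eq0 -cech_diff_scale -cech_diffD -dcE.
    by rewrite cech_diff_diff.
  by rewrite -sub0r; apply: cechB => //; [apply: cech0|apply: cech_diff_cech].
have [|_ [w uw Jw]] := van (i + 1) _ u zu; first by lia.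
rewrite addrK in uw.
have [||_ [b ub Jb]] := van i _ (c - cochain_scale f w); first by lia.
  split; first by apply: cechB => //; apply: cech_scale.
  rewrite cech_diffB dcE cech_diff_scale addrAC -scaleB.
  by apply: cechD => //; apply: cech_scale.
split=> //; exists b => //.
rewrite -[c](subrK (cochain_scale f w)) addrAC; apply: cechD; first exact: adjoin_ideal.
  by apply: cech_sub Jb; apply: adjoin_sub.
exact: cech_scale_adjoin.
Qed.

(** Multiplication by the first element [f] is injective on [H^i] as soon as
    [H^(i-1)] of the quotient by [f] vanishes; but [H^i] is torsion. *)
Lemma regular_vanish I (fs : seq S) : is_ideal I -> (forall f, f \in fs -> max_ideal f) ->
  regular_seq I fs -> vanish I (size fs).
Proof.
elim: fs I => [|f fs IH] I II fm /=.
  by move=> _ i i0; apply: neg_vanish.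
move=> [fr reg] i ia.
have {}IH := IH _ (adjoin_ideal I f) (fun g gs => fm g (@mem_behead _ (f :: fs) g gs)) reg.
have step c : cocycle I i c -> coboundary I i (cochain_scale f c) -> coboundary I i c.
  move=> [uc dc] [_ [b ub Ib]].
  have [||_ [b' ub' Jb']] := IH (i - 1) _ b; first by lia.
    split=> //; rewrite subrK.
    have -> : cech_diff b = cochain_scale f c - (cochain_scale f c - cech_diff b).
      by rewrite subKr.
    apply: cechB; first exact: adjoin_ideal.
      exact: cech_scale_adjoin.
    by apply: cech_sub Ib; apply: adjoin_sub.
  have [b1 [b2 [ub1 Ib2 bE]]] := cech_adjoin II Jb'.
  have db1 : cech unit_ideal i (cech_diff b1).
    by rewrite -(subrK 1 i); apply: cech_diff_cech.
  split=> //; exists b1 => //; apply: (cech_nzd II fr); first exact: cechB.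
  have -> : cochain_scale f (c - cech_diff b1) =
      (cochain_scale f c - cech_diff b) + cech_diff b2.
    have -> : cech_diff b = cech_diff (b - cech_diff b').
      by rewrite cech_diffB cech_diff_diff subr0.
    by rewrite bE cech_diffD cech_diff_scale scaleB opprD addrA addrNK.
  by apply: cechD => //; rewrite -(subrK 1 i); apply: cech_diff_cech.
move=> c cc; have [N] := max_ideal_torsion II cc (fm f (mem_head _ _)).
elim: N => [|N IHN]; first by rewrite expr0 scale1.
rewrite exprS scaleM => H; apply/IHN/step => //.
by have [_ _ M] := cocycle_submodule i II; apply: M.
Qed.

(** A torsion element is a cocycle of degree zero, where there are no
    coboundaries. *)
Lemma vanish_torsion_free J g : is_ideal J -> vanish J 1 ->
  (forall j, exists N, J ('X_j ^+ N * g)) -> J g.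
Proof.
move=> JI van tor.
pose c : cochain := [ffun s => if s == set0 then tofrac g else 0].
have [||_ [b ub Jb]] := van 0 _ c; first by [].
  split=> s; rewrite ffunE.
    by rewrite eqz_nat cards_eq0; case: (s == set0); rewrite ?eqxx //; apply: loc_tofrac.
  rewrite add0r eqz_nat; case: ifP => [/cards1P[j ->]|s1].
    rewrite big_set1 setDv ffunE eqxx; apply: loc_sign => //.
    have [N JN] := tor j; have := loc_frac [set j] N JN.
    rewrite tofracM tofracXn -xs1 mulrAC divff ?mul1r //; exact: xs_neq0.
  rewrite big1 // => j js; rewrite ffunE; case: eqP => [E|_]; rewrite ?mulr0 //.
  by move: s1; rewrite (cardsD1 j) js E cards0.
apply: loc_set0; have := Jb set0; rewrite cards0 eqxx !ffunE eqxx big_set0 subr0 //.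
Qed.

End Cech.

(** * Graded pieces of local cohomology *)

Section Graded.
Variables (k : fieldType) (n : nat) (D : pred {set 'I_n}).
Local Notation S := {mpoly k[n]}.
Local Notation K := {fraction S}.
Local Notation cochain := (@cochain k n).
Implicit Types (s t F : {set 'I_n}) (j : 'I_n) (f : S) (u v : K) (r e : nat).
Implicit Types (m : 'X_{1..n}) (b c : cochain) (g h : {set 'I_n} -> S) (a : {set 'I_n} -> k).

Definition const_exp e : 'X_{1..n} := ind setT e.

Lemma const_expE e j : const_exp e j = e.
Proof. by rewrite indE inE muln1. Qed.

(** Laurent monomials are represented as [x ^ (m - const_exp e)].  In degree
    [m - const_exp e], the localisation of [symb D r] at [x_s] is nonzero exactly
    for these [s]. *)
Definition inloc r e m s : bool :=
  [forall (j | j \notin s), (e <= m j)%N] &&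
  [forall (F | maxset D F && (s \subset F)), (r <= deg_off F (m - const_exp e))%N].

(** The sets [s] whose localisation of the quotient is nonzero in this degree;
    its Cech complex in this degree is the cochain complex of this family. *)
Definition live r e m s : bool :=
  [forall (j | j \notin s), (e <= m j)%N] &&
  [exists (F | maxset D F && (s \subset F)), (deg_off F (m - const_exp e) < r)%N].

Lemma inloc0 e m s : inloc 0 e m s = [forall (j | j \notin s), (e <= m j)%N].
Proof. by rewrite /inloc andb_idr // => _; apply/forall_inP. Qed.

Lemma liveE r e m s : live r e m s = inloc 0 e m s && ~~ inloc r e m s.
Proof.
rewrite inloc0 /live /inloc negb_and; case: [forall (j | _), _] => //=.
rewrite negb_forall_in; apply: eq_existsb => F.
by rewrite -ltnNge.
Qed.

Lemma inloc_up r e m s t : s \subset t -> inloc r e m s -> inloc r e m t.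
Proof.
move=> st /andP[/forall_inP U /forall_inP H]; apply/andP; split.
  by apply/forall_inP => j jt; apply: U; apply: contra jt; apply: (subsetP st).
by apply/forall_inP => F /andP[mF tF]; apply: H; rewrite mF (subset_trans st).
Qed.

Lemma const_exp_shift e e' m : (m + const_exp e' - const_exp (e + e') = m - const_exp e)%MM.
Proof.
by apply/mnmP => j; rewrite !mnmBE mnmDE !const_expE subnDr.
Qed.

Lemma live_shift r e e' m s : live r (e + e') (m + const_exp e') s = live r e m s.
Proof.
rewrite /live const_exp_shift; congr (_ && _); apply: eq_forallb => j.
by rewrite mnmDE const_expE leq_add2r.
Qed.

(** Multiplying by a high power of [x_s] makes the exponents on [s] at least [r],
    which settles all the facets that do not contain [s]. *)
Lemma loc_symb r s u e f : u * xs k setT e = tofrac f ->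
  loc (symb D r) s u <-> (forall m, m \in msupp f -> inloc r e m s).
Proof.
move=> uf; split=> [/locP[h [e' [Ih uE]]] m mf|H].
  have E : h * 'X_[const_exp e] = f * 'X_[ind s e'].
    apply/eqP; rewrite -tofrac_eq !tofracM -uf uE -/(xs k s e') -/(xs k setT e).
    by rewrite [X in _ == X]mulrAC divfK // xs_neq0.
  have : (ind s e' + m)%MM \in msupp (h * 'X_[const_exp e]).
    by rewrite E (perm_mem (msuppMX _ _)); apply: map_f.
  rewrite (perm_mem (msuppMX _ _)) => /mapP[m' /Ih/forall_inP Sm' mE].
  have mj j : (m j + e' * (j \in s) = e + m' j)%N.
    by move/mnmP: mE => /(_ j); rewrite !mnmDE const_expE indE addnC.
  apply/andP; split; [apply/forall_inP => j js|apply/forall_inP => F /andP[mF sF]].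
    by have := mj j; rewrite (negbTE js) muln0 addn0 => ->; rewrite leq_addr.
  apply: leq_trans (Sm' F mF) _; apply: leq_sum => j jF.
  rewrite mnmBE const_expE; have := mj j.
  have -> : j \in s = false by apply: contraNF jF; apply: (subsetP sF).
  by rewrite muln0 addn0 => ->; rewrite addKn.
have Ule m : m \in msupp f -> (const_exp e <= m + ind s (e + r))%MM.
  move=> /H/andP[/forall_inP U _]; apply/mnm_lepP => j; rewrite const_expE mnmDE indE.
  case: (boolP (j \in s)) => [_|/U]; first by rewrite muln1; lia.
  by rewrite muln0 addn0.
apply/locP; exists (\sum_(m <- msupp f) f@_m *: 'X_[m + ind s (e + r) - const_exp e]), (e + r)%N.
split.
  rewrite big_seq; apply: ideal_sum => [|m mf]; first exact: symb_ideal.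
  rewrite -mul_mpolyC; have [_ _ M] := symb_ideal k D r; apply: M; apply/symbX.
  have /andP[/forall_inP U /forall_inP Q] := H m mf; apply/forall_inP => F mF.
  case: (boolP (s \subset F)) => [sF|/subsetPn[j js jF]].
    apply: leq_trans (Q F _) _; first by rewrite mF.
    by apply: leq_sum => j _; rewrite !mnmBE mnmDE const_expE; lia.
  rewrite /deg_off (bigD1 j) //= mnmBE mnmDE const_expE indE js muln1; lia.
apply/eqP; rewrite -(inj_eq (mulIf (xs_neq0 k setT e))) uf mulrAC.
rewrite -(inj_eq (mulIf (xs_neq0 k s (e + r)))) mulfVK ?xs_neq0 //.
rewrite -!tofracM; apply/eqP; congr tofrac.
rewrite big_distrl /= {1}[f]mpolyE big_distrl /= !big_seq; apply: eq_bigr => m mf.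
by rewrite -!scalerAl -!mpolyXD submK ?Ule.
Qed.

Lemma loc_numer s u : loc (@unit_ideal k n) s u ->
  exists e0, forall e, (e0 <= e)%N -> exists f, u * xs k setT e = tofrac f.
Proof.
move=> /locP[f [e0 [_ ->]]]; exists e0 => e le.
exists (f * 'X_[ind (~: s) e0] * 'X_[const_exp (e - e0)]).
rewrite -{1}(subnKC le) xsD -{1}(setUCr s) xsU; last by rewrite -setI_eq0 setICr.
by rewrite !mulrA mulfVK ?xs_neq0 // !tofracM.
Qed.

Definition numer e c g : Prop := forall s, c s * xs k setT e = tofrac (g s).

Lemma cochain_numer i c : cech (@unit_ideal k n) i c ->
  exists e0, forall e, (e0 <= e)%N -> exists g, numer e c g.
Proof.
move=> uc; have [s|E HE] := @fin_all_exists _ _ (fun s (e0 : nat) =>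
    forall e, (e0 <= e)%N -> exists f, c s * xs k setT e = tofrac f).
  have := uc s; case: ifP => _ => [/loc_numer//|->].
  by exists 0%N => e _; exists 0; rewrite mul0r tofrac0.
exists (\sum_s E s)%N => e le.
apply: (@fin_all_exists _ _ (fun s f => c s * xs k setT e = tofrac f)) => s.
by apply: HE; apply: leq_trans le; rewrite (bigD1 s) ?leq_addr.
Qed.

Lemma numer_shift e e' c g : numer e c g ->
  numer (e + e') c (fun s => g s * 'X_[const_exp e']).
Proof. by move=> H s; rewrite xsD mulrA H tofracM. Qed.

Lemma mcoeff_shift f m e : (f * 'X_[const_exp e])@_(m + const_exp e) = f@_m.
Proof. by rewrite addmC mcoeffMX. Qed.

Lemma numer_sd e c g : numer e c g -> numer e (cech_diff c) (sd g).
Proof.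
move=> H t; rewrite cech_diffE (raddf_sd (@tofrac S)) /sd big_distrl.
by apply: eq_bigr => j _ /=; rewrite -mulrA H.
Qed.

Lemma numerB e c c' g g' : numer e c g -> numer e c' g' ->
  numer e (c - c') (fun s => g s - g' s).
Proof. by move=> H H' s; rewrite !ffunE mulrBl H H' tofracB. Qed.

Lemma numer0 e c g s : numer e c g -> c s = 0 -> g s = 0.
Proof.
by move=> H c0; have /eqP := H s; rewrite c0 mul0r eq_sym tofrac_eq0 => /eqP.
Qed.

Lemma cech_symb r i e c g : numer e c g ->
  cech (symb D r) i c <-> (forall s m, (g s)@_m != 0 -> #|s|%:Z == i /\ inloc r e m s).
Proof.
move=> H; split=> [Ic s m|Hg s].
  have := Ic s; case: ifP => [_ /(loc_symb r s (H s)) Q|_ c0].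
    by rewrite -mcoeff_msupp => /Q.
  by rewrite (numer0 H c0) mcoeff0 eqxx.
case: ifP => si.
  by apply/(loc_symb r s (H s)) => m; rewrite mcoeff_msupp => /Hg[].
have g0 : g s = 0.
  apply/mpolyP => m; rewrite mcoeff0; apply/eqP; apply: contraT => /Hg[].
  by rewrite si.
by apply: (mulIf (xs_neq0 k setT e)); rewrite H g0 mul0r tofrac0.
Qed.

Lemma mcoeff_sd g t m : (sd g t)@_m = sd (fun s => (g s)@_m) t.
Proof. exact: (raddf_sd (mcoeff m)). Qed.

Lemma sd_neq0 a t : sd a t != 0 -> exists2 j, j \in t & a (t :\ j) != 0.
Proof.
move=> nz; apply/exists_inP; apply: contraNT nz => /exists_inPn H.
by apply/eqP; rewrite /sd big1 // => j /H/negPn/eqP->; rewrite mulr0.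
Qed.

(** Below a live set, a set that is not live carries the value zero: if its
    monomial lay in the localised ideal, so would that of the live set. *)
Lemma sd_cut_live r e m a t : (forall s, a s != 0 -> inloc 0 e m s) ->
  live r e m t -> sd (cut (live r e m) a) t = sd a t.
Proof.
move=> aU; rewrite liveE => /andP[_ Qt]; apply: eq_sd => j _; rewrite /cut liveE.
case: (eqVneq (a (t :\ j)) 0) => [->|/aU ->]; first by rewrite if_same.
by rewrite /= ifT //; apply: contra Qt; apply: inloc_up; rewrite subsetDl.
Qed.

Lemma cocycle_component r (i : nat) e c g m : cocycle (symb D r) i c -> numer e c g ->
  forall t, live r e m t -> #|t| = i.+1 ->
  sd (cut (live r e m) (fun s => (g s)@_m)) t = 0.
Proof.
move=> [uc dc] H t Lt ti; rewrite sd_cut_live // -?mcoeff_sd; last first.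
  by move=> s; move: uc; rewrite (unit_idealE k D) => /(cech_symb 0 i H)Hg /Hg[].
apply/eqP; apply: contraTT Lt => nz.
have [_ Q] := (cech_symb r _ (numer_sd H)).1 dc _ _ nz.
by rewrite liveE Q andbF.
Qed.

Definition mono_cochain e m a : cochain :=
  [ffun s => tofrac (a s *: 'X_[m] : S) / xs k setT e].

Lemma numer_mono e m a : numer e (mono_cochain e m a) (fun s => a s *: 'X_[m]).
Proof. by move=> s; rewrite ffunE mulfVK // xs_neq0. Qed.

Lemma mcoeff_mono (x : k) m m' : (x *: 'X_[m] : S)@_m' = if m == m' then x else 0.
Proof. by rewrite mcoeffZ mcoeffX; case: eqP => _; rewrite ?mulr1 ?mulr0. Qed.

Lemma mono_cocycle r (i : nat) e m a :
  (forall s, a s != 0 -> #|s| = i /\ inloc 0 e m s) ->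
  (forall t, live r e m t -> #|t| = i.+1 -> sd a t = 0) ->
  cocycle (symb D r) i (mono_cochain e m a).
Proof.
move=> aU da; have H := numer_mono e m a; split.
  rewrite (unit_idealE k D); apply/(cech_symb _ _ H) => s m'.
  by rewrite mcoeff_mono; case: (eqVneq m m') => [<- /aU[-> ?]|_]; rewrite eqxx.
apply/(cech_symb _ _ (numer_sd H)) => t m'; rewrite mcoeff_sd => nz.
have : m == m'.
  apply: contraNT nz => /negbTE ne; rewrite /sd big1 // => j _.
  by rewrite mcoeff_mono ne mulr0.
move/eqP=> E; subst m'.
have {}nz : sd a t != 0.
  by move: nz; congr (_ != 0); apply: eq_sd => j _; rewrite mcoeff_mono eqxx.
have [j jt /aU[tj Uj]] := sd_neq0 nz.
have ti : #|t| = i.+1 by rewrite (cardsD1 j) jt tj.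
split; first by rewrite ti -addn1 PoszD.
apply: contraNT nz => nQ; rewrite da // liveE nQ andbT.
by apply: inloc_up Uj; rewrite subsetDl.
Qed.

Lemma mono_coboundary r (i : nat) e m a :
  (forall s, a s != 0 -> #|s| = i /\ inloc 0 e m s) ->
  (forall t, live r e m t -> #|t| = i.+1 -> sd (cut (live r e m) a) t = 0) ->
  exact k (live r e m) i -> coboundary (symb D r) i (mono_cochain e m a).
Proof.
move=> aU da ex; have [b hb] := ex a da.
have [uc _] := mono_cocycle aU (fun t Lt ti =>
  etrans (esym (sd_cut_live (fun s nz => (aU s nz).2) Lt)) (da t Lt ti)).
pose b' s := if (#|s|.+1 == i) && live r e m s then b s else 0.
have b'U s : b' s != 0 -> #|s|.+1 = i /\ inloc 0 e m s.
  rewrite /b'; case: ifP => [/andP[/eqP si]|_]; last by rewrite eqxx.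
  by rewrite liveE => /andP[].
have Hb := numer_mono e m b'.
split=> //; exists (mono_cochain e m b').
  rewrite (unit_idealE k D); apply/(cech_symb _ _ Hb) => s m'.
  rewrite mcoeff_mono; case: (eqVneq m m') => [<- /b'U[<- U]|_]; last by rewrite eqxx.
  by split=> //; rewrite -addn1 PoszD addrK.
apply/(cech_symb _ _ (numerB (numer_mono e m a) (numer_sd Hb))) => s m'.
rewrite mcoeffB mcoeff_sd mcoeff_mono => nz.
have : m == m'.
  apply: contraNT nz => /negbTE ne; rewrite ne sub0r oppr_eq0 /sd big1 // => j _.
  by rewrite mcoeff_mono ne mulr0.
move/eqP=> E; subst m'; rewrite eqxx in nz.
have {}nz : a s - sd b' s != 0.
  move: nz; congr (_ - _ != 0); apply: eq_sd => j _; by rewrite mcoeff_mono eqxx.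
have [si U] : #|s| = i /\ inloc 0 e m s.
  case: (eqVneq (a s) 0) => [a0|/aU//].
  move: nz; rewrite a0 sub0r oppr_eq0 => /sd_neq0[j js /b'U[<- U]].
  split; first by rewrite (cardsD1 j) js.
  by apply: inloc_up U; rewrite subsetDl.
split; first by rewrite si.
apply: contraNT nz => nQ; have Ls : live r e m s by rewrite liveE U nQ.
rewrite subr_eq0 hb //; apply/eqP/eq_sd => j js; rewrite /cut /b'.
by rewrite -si (cardsD1 j s) js eqxx.
Qed.

Lemma coboundary_component r (i : nat) e c g m :
  coboundary (symb D r) i c -> numer e c g ->
  exists a : {set _} -> k, forall s, live r e m s -> #|s| = i ->
    (g s)@_m = sd (cut (live r e m) a) s.
Proof.
move=> [_ [b ub Ib]] H; have [e0 He0] := cochain_numer ub.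
have [h Hh] := He0 (e + e0)%N (leq_addl _ _).
exists (fun s => (h s)@_(m + const_exp e0)) => s Ls si.
pose L := live r (e + e0) (m + const_exp e0).
have -> : sd (cut (live r e m) (fun s => (h s)@_(m + const_exp e0))) s =
          sd (cut L (fun s => (h s)@_(m + const_exp e0))) s.
  by apply: eq_sd => j _; rewrite /cut /L live_shift.
rewrite sd_cut_live /L ?live_shift //; last first.
  move=> t; move: ub; rewrite (unit_idealE k D) => /(cech_symb _ _ Hh) Q nz.
  by have [] := Q _ _ nz.
rewrite -mcoeff_sd -(mcoeff_shift (g s) m e0); apply/eqP; rewrite -subr_eq0 -mcoeffB.
apply: contraTT Ls => nz; rewrite -(live_shift r e e0) liveE.
have [_ ->] := (cech_symb _ _ (numerB (numer_shift e0 H) (numer_sd Hh))).1 Ib s _ nz.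
by rewrite andbF.
Qed.

Lemma cohomology_exact r (i : nat) e m :
  psub (cocycle (@symb k n D r) i) (coboundary (symb D r) i) -> exact k (live r e m) i.
Proof.
move=> van a da; pose a' s := if (#|s| == i) && live r e m s then a s else 0.
have a'U s : a' s != 0 -> #|s| = i /\ inloc 0 e m s.
  rewrite /a'; case: ifP => [/andP[/eqP si]|_]; last by rewrite eqxx.
  by rewrite liveE => /andP[].
have cc : cocycle (symb D r) i (mono_cochain e m a').
  apply: mono_cocycle => // t Lt ti.
  rewrite -(da t Lt ti); apply: eq_sd => j jt; rewrite /a' /cut.
  have -> : #|t :\ j| = i by move: ti; rewrite (cardsD1 j t) jt => -[].
  by rewrite eqxx.
have [b hb] := coboundary_component m (van _ cc) (numer_mono e m a').
exists b => s Ls si; rewrite -hb // mcoeff_mono eqxx /a' Ls si eqxx //.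
Qed.

(** Over a common denominator the cocycle splits into its monomial components, and
    each component of good degree is a coboundary by itself. *)
Lemma cocycle_decomposition r (i : nat) e c g (good : pred 'X_{1..n}) :
  cocycle (symb D r) i c -> numer e c g ->
  (forall m, good m -> exact k (live r e m) i) ->
  exists ms : seq 'X_{1..n}, coboundary (symb D r) i
    (c - \sum_(m <- ms | ~~ good m) mono_cochain e m (fun s => (g s)@_m)).
Proof.
move=> cc H ex; have [B0 BD _] := coboundary_submodule i (symb_ideal k D r).
pose ms := undup (flatten [seq msupp (g s) | s <- enum {: {set 'I_n}}]).
have cE : c = \sum_(m <- ms) mono_cochain e m (fun s => (g s)@_m).
  apply/ffunP => s; apply: (mulIf (xs_neq0 k setT e)); rewrite H sum_ffunE big_distrl /=.
  under eq_bigr => m _ do rewrite numer_mono.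
  rewrite -(raddf_sum (@tofrac S)) {1}[g s]mpolyE; congr tofrac.
  rewrite [RHS](bigID (mem (msupp (g s)))) /= [X in _ + X]big1 ?addr0; last first.
    by move=> m /memN_msupp_eq0->; rewrite scale0r.
  rewrite -[RHS]big_filter; apply: perm_big; apply: uniq_perm.
  - exact: msupp_uniq.
  - by rewrite filter_uniq ?undup_uniq.
  move=> m; rewrite mem_filter mem_undup andb_idr // => ms_m.
  by apply/flattenP; exists (msupp (g s)) => //; apply: map_f; rewrite mem_enum.
exists ms; rewrite {1}cE (bigID (fun m => good m)) /= addrK.
apply: big_ind => // m gm; have aU s : (g s)@_m != 0 -> #|s| = i /\ inloc 0 e m s.
  have [+ _] := cc; rewrite (unit_idealE k D) => /(cech_symb _ _ H) Q /Q[/eqP[]].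
  by [].
apply: mono_coboundary => //; last exact: ex.
exact: cocycle_component cc H.
Qed.

Lemma exact_cohomology r (i : nat) : (forall e m, exact k (live r e m) i) ->
  psub (cocycle (@symb k n D r) i) (coboundary (symb D r) i).
Proof.
move=> ex c cc; have [uc _] := cc; have [e He] := cochain_numer uc.
have [g H] := He e (leqnn e).
have [ms] := cocycle_decomposition (good := predT) cc H (fun m _ => ex e m).
by rewrite big_pred0 // subr0.
Qed.

End Graded.

(** * Finite length *)

Section FiniteLength.
Variables (k : fieldType) (n : nat) (D : pred {set 'I_n}).
Local Notation S := {mpoly k[n]}.
Local Notation cochain := (@cochain k n).
Implicit Types (s t F : {set 'I_n}) (f : S) (r e i j : nat).
Implicit Types (m : 'X_{1..n}) (b c : cochain) (a : {set 'I_n} -> k).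
Implicit Types (N : nat -> cochain -> Prop).

Lemma submoduleB (M : cochain -> Prop) b c : is_submodule M -> M b -> M c -> M (b - c).
Proof.
move=> [_ MD MS] Mb Mc; apply: MD => //; have := MS (-1) _ Mc; congr M.
by apply/ffunP => s; rewrite !ffunE tofracN tofrac1 mulN1r.
Qed.

Lemma submodule_sum (M : cochain -> Prop) (X : Type) (q : seq X) (Q : pred X) (G : X -> cochain) :
  is_submodule M -> (forall x, Q x -> M (G x)) -> M (\sum_(x <- q | Q x) G x).
Proof. by case=> M0 MD _ MG; apply: big_ind. Qed.

(** More than [p] jumps would give a linear relation between their witnesses, and
    the last witness with a nonzero coefficient would lie in the submodule
    containing the earlier ones. *)
Lemma chain_dim p (phi : {additive 'rV[k]_p -> cochain}) N l :
  (forall x u, phi (x *: u) = cochain_scale x%:MP (phi u)) ->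
  (forall j, (j <= l)%N -> is_submodule (N j)) ->
  (forall j, (j < l)%N -> psub (N j) (N j.+1)) ->
  (forall j, (j < l)%N -> exists x, N j.+1 (phi x) /\ ~ N j (phi x)) -> (l <= p)%N.
Proof.
move=> phiZ Nsub Nup Nx; rewrite leqNgt; apply/negP => pl.
have Nle i j : (i <= j)%N -> (j <= l)%N -> psub (N i) (N j).
  elim: j => [|j IH]; first by rewrite leqn0 => /eqP-> _ c.
  rewrite leq_eqVlt ltnS => /predU1P[->|ij] jl c Nc //.
  by apply: Nup => //; apply: IH => //; apply: ltnW.
have [i|X HX] := @fin_all_exists _ _ (fun (i : 'I_l) x => N i.+1 (phi x) /\ ~ N i (phi x)).
  exact: Nx.
pose W : 'M[k]_(l, p) := \matrix_i X i.
have : kermx W != 0.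
  rewrite -mxrank_eq0 mxrank_ker subn_eq0 -ltnNge.
  exact: leq_ltn_trans (rank_leq_col W) pl.
case/rowV0Pn=> u /sub_kermxP uW /rV0Pn[i1 ui1].
have [i0 ui0 i0max] := @arg_maxnP _ i1 (fun i : 'I_l => u 0 i != 0) val ui1.
have /(congr1 phi) := uW; rewrite mulmx_sum_row raddf0 raddf_sum (bigD1 i0) //=.
rewrite rowK phiZ => /eqP; rewrite addr_eq0 => /eqP E.
have [_ nN] := HX i0; apply: nN.
have sub := Nsub i0 (ltnW (ltn_ord i0)); have [N0 ND NS] := sub.
have -> : phi (X i0) = cochain_scale ((u 0 i0)^-1)%:MP (cochain_scale (u 0 i0)%:MP (phi (X i0))).
  by rewrite -!phiZ scalerA mulVf // scale1r.
apply: (NS); rewrite E -sub0r; apply: (@submoduleB (N i0)) => //.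
apply: (@submodule_sum (N i0)) => // i ii0; rewrite rowK phiZ.
case: (ltngtP i i0) => [lt|gt|/val_inj E']; last by rewrite E' eqxx in ii0.
  by apply: NS; apply: Nle lt _ _ (HX i).1; apply: ltnW.
have -> : u 0 i = 0.
  by apply/eqP; apply: contraLR gt => /i0max; rewrite -leqNgt.
by have := N0; congr (N i0 _); apply/ffunP => s; rewrite !ffunE mpolyC0 tofrac0 mul0r.
Qed.

(** The cochains with all exponents 0 or 1, parametrised by their coefficients. *)
Definition bounded_cochain (x : 'rV[k]_#|{: {set 'I_n} * {set 'I_n}}|) : cochain :=
  [ffun s => tofrac (\sum_(A : {set 'I_n}) x 0 (enum_rank (s, A)) *: 'X_[ind A 1] : S)].

Lemma bounded_cochain_additive : additive bounded_cochain.
Proof.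
move=> x y; apply/ffunP => s; rewrite !ffunE -tofracB -sumrB; congr tofrac.
by apply: eq_bigr => A _; rewrite !mxE scalerBl.
Qed.

HB.instance Definition _ := GRing.isZmodMorphism.Build _ _ bounded_cochain bounded_cochain_additive.

Lemma bounded_cochainZ x u :
  bounded_cochain (x *: u) = cochain_scale x%:MP (bounded_cochain u).
Proof.
apply/ffunP => s; rewrite !ffunE -tofracM; congr tofrac.
rewrite big_distrr; apply: eq_bigr => A _ /=.
by rewrite mxE mul_mpolyC scalerA.
Qed.

Definition bounded_degree e m : bool := [forall j, (e <= m j <= e.+1)%N].

Lemma bounded_mono e m a : bounded_degree e m ->
  exists x, mono_cochain e m a = bounded_cochain x.
Proof.
move=> /forallP bm; pose A0 := [set j | m j == e.+1].
have mE : m = (ind A0 1 + const_exp n e)%MM.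
  apply/mnmP => j; rewrite mnmDE indE const_expE inE mul1n; have := bm j.
  by case: eqP => [->|] //=; rewrite add0n; lia.
exists (\row_i if (enum_val i).2 == A0 then a (enum_val i).1 else 0).
apply/ffunP => s; rewrite !ffunE (bigD1 A0) //= big1 => [|A AA0]; last first.
  by rewrite mxE enum_rankK /= (negbTE AA0) scale0r.
rewrite addr0 mxE enum_rankK /= eqxx mE mpolyXD scalerAl tofracM mulfK //.
exact: xs_neq0.
Qed.

(** The degrees with all exponents 0 or 1 are finite in number, so cohomology is
    spanned by a finite-dimensional space, which bounds the chains. *)
Lemma finite_length_of_exact r i :
  (forall e m, ~~ bounded_degree e m -> exact k (live D r e m) i) ->
  local_cohomology_finite_length (@symb k n D r) i.
Proof.
move=> ex; exists #|{: {set 'I_n} * {set 'I_n}}| => l N HN Ns.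
have [B0 BD BM] := coboundary_submodule i (symb_ideal k D r).
have span c : cocycle (symb D r) i c -> exists x, coboundary (symb D r) i (c - bounded_cochain x).
  move=> cc; have [uc _] := cc; have [e He] := cochain_numer uc.
  have [g H] := He e (leqnn e).
  have [ms] := cocycle_decomposition (good := fun m => ~~ bounded_degree e m) cc H (ex e).
  set w := \sum_(m <- _ | _) _; suff [x ->] : exists x, w = bounded_cochain x by exists x.
  apply: (big_ind (fun w => exists x, w = bounded_cochain x)) => [|_ _ [x ->] [y ->]|m].
  - by exists 0; rewrite raddf0.
  - by exists (x + y); rewrite raddfD.
  - by move/negPn => bm; apply: bounded_mono.
apply: (chain_dim (phi := bounded_cochain) (N := N)).
- exact: bounded_cochainZ.
- by move=> j /HN[].
- by move=> j /Ns[].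
move=> j jl; have [_ [c Nc nNc]] := Ns j jl.
have [sub1 BN1 NZ1] := HN j.+1 jl; have [sub0 BN0 _] := HN j (ltnW jl).
have [x Bx] := span c (NZ1 c Nc); exists x; split.
  by rewrite /= -(subKr c (bounded_cochain x)); apply: submoduleB => //; apply: BN1.
move=> Nx; apply: nNc; rewrite -(subrK (bounded_cochain x) c).
by have [_ ND _] := sub0; apply: ND => //; apply: BN0.
Qed.

Lemma numer_scale e c g f : numer e c g ->
  numer e (cochain_scale f c) (fun s => f * g s).
Proof. by move=> H s; rewrite ffunE -mulrA H tofracM. Qed.

(** The degree [m - const_exp e] is negative at [j], and the family of live sets
    does not change when [m j] decreases.  So a nonzero class, divided by the
    powers of [x_j], would generate arbitrarily long strict chains. *)
Lemma exact_of_finite_length r i e m (j : 'I_n) :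
  local_cohomology_finite_length (@symb k n D r) i -> (m j < e)%N ->
  exact k (live D r e m) i.
Proof.
move=> [M HM] mj a da; apply: NNPP => no.
have [B0 BD BM] := coboundary_submodule i (symb_ideal k D r).
have [Z0 ZD ZM] := cocycle_submodule i (symb_ideal k D r).
pose l := M.+1; pose mq q := (m + const_exp n l - U_(j) *+ q)%MM.
have mqE q x : mq q x = (m x + l - (j == x) * q)%N.
  by rewrite mnmBE mnmDE const_expE mulmnE mnm1E.
have mqS q : (q < l)%N -> mq q = (mq q.+1 + U_(j))%MM.
  move=> ql; apply/mnmP => x; rewrite mnmDE mnm1E !mqE.
  by case: (j == x) => /=; lia.
have Uq q s : (q <= l)%N -> inloc D 0 (e + l) (mq q) s = inloc D 0 e m s.
  move=> ql; rewrite !inloc0; apply: eq_forallb => x; rewrite mqE.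
  by case: eqP => [<-|_] /=; [rewrite mul1n|rewrite mul0n subn0 leq_add2r]; congr (_ ==> _); lia.
have Lq q s : (q <= l)%N -> live D r (e + l) (mq q) s = live D r e m s.
  move=> ql; rewrite /live -!(inloc0 D) Uq //; case: (boolP (inloc D 0 e m s)) => //= U.
  have js : j \in s.
    apply: contraTT U; rewrite inloc0 => js; apply/forall_inPn; exists j => //.
    by rewrite -ltnNge.
  apply: eq_existsb => F; apply: andb_id2l => /andP[_ sF].
  congr (_ < r)%N; apply: eq_bigr => x xF; rewrite ![(_ - const_exp _ _)%MM _]mnmBE !const_expE mqE.
  have -> : (j == x) = false by apply: contraNF xF => /eqP<-; apply: (subsetP sF).
  by rewrite mul0n; lia.
pose a' s := if (#|s| == i) && live D r e m s then a s else 0.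
pose z q := mono_cochain (e + l) (mq q) a'.
have zc q : (q <= l)%N -> cocycle (symb D r) i (z q).
  move=> ql; apply: mono_cocycle => [s|t].
    rewrite /a' Uq //; case: ifP => [/andP[/eqP si]|_]; last by rewrite eqxx.
    by rewrite liveE => /andP[].
  rewrite Lq // => Lt ti; rewrite -(da t Lt ti); apply: eq_sd => x xt; rewrite /a' /cut.
  have -> : #|t :\ x| = i by move: ti; rewrite (cardsD1 x t) xt => -[].
  by rewrite eqxx.
pose N q c := exists f, coboundary (symb D r) i (c - cochain_scale f (z q)).
have Nsub q : is_submodule (N q).
  split=> [|b c [f Bb] [f' Bc]|f c [f' Bc]].
  - by exists 0; rewrite (_ : _ - _ = 0) //; apply/ffunP => s; rewrite !ffunE tofrac0 mul0r subr0.
  - exists (f + f').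
    rewrite (_ : _ - _ = (b - cochain_scale f (z q)) + (c - cochain_scale f' (z q))).
      exact: BD.
    by apply/ffunP => s; rewrite !ffunE tofracD mulrDl opprD addrACA.
  - exists (f * f'); rewrite scaleM -scaleB; exact: BM.
have zS q : (q < l)%N -> z q = cochain_scale 'X_j (z q.+1).
  move=> ql; apply/ffunP => s; rewrite !ffunE mulrA -tofracM mqS // mpolyXD.
  by rewrite [_ * 'X_j]mulrC -scalerAr.
suff : (l <= M)%N by rewrite ltnn.
apply: (HM l N) => q ql.
- split=> // [c Bc|c [f Bc]].
    exists 0; rewrite (_ : cochain_scale _ _ = 0) ?subr0 //.
    by apply/ffunP => s; rewrite !ffunE tofrac0 mul0r.
  rewrite -(subrK (cochain_scale f (z q)) c); apply: ZD.
    by apply: coboundary_cocycle => //; apply: symb_ideal.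
  by apply/ZM/zc.
split=> [c [f Bc]|].
  by exists (f * 'X_j); rewrite scaleM -zS.
exists (z q.+1).
  by exists 1; rewrite scale1 subrr.
move=> [f Bz]; apply: no.
have H := numerB (numer_mono (e + l) (mq q.+1) a') (numer_scale f (numer_mono (e + l) (mq q) a')).
have [b hb] := coboundary_component (mq q.+1) Bz H.
exists b => s Ls si; rewrite -(Lq q.+1) // in Ls.
rewrite (_ : sd _ s = sd (cut (live D r (e + l) (mq q.+1)) b) s).
  rewrite -hb // mcoeffB mcoeff_mono eqxx /a' -(Lq q.+1) // Ls si eqxx /=.
  rewrite -scalerAr mcoeffZ memN_msupp_eq0 ?mulr0 ?subr0 //.
  rewrite (perm_mem (msuppMX _ _)); apply/negP => /mapP[m' _ E].
  move/mnmP: E => /(_ j); rewrite (mqS q) // !mnmDE mnm1E eqxx /=; lia.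
by apply: eq_sd => x _; rewrite /cut Lq.
Qed.

End FiniteLength.

(** * Regular sequences modulo homogeneous ideals *)

Section Adds.
Variables (k : fieldType) (n : nat).
Local Notation S := {mpoly k[n]}.
Implicit Types (I J : S -> Prop) (f g x : S) (fs : seq S) (d e r : nat).

Definition adjoins J fs : S -> Prop := foldl (@adjoin S) J fs.

Lemma adjoins_ideal J fs : is_ideal J -> is_ideal (adjoins J fs).
Proof. by rewrite /adjoins; elim: fs J => [|f fs IH] J //= JI; apply/IH/adjoin_ideal. Qed.

Lemma adjoins_sub J fs : psub J (adjoins J fs).
Proof.
rewrite /adjoins; elim: fs J => [|f fs IH] J g //= Jg.
by apply: (IH (adjoin J f)); apply: adjoin_sub.
Qed.

Lemma adjoins_rcons J fs f : adjoins J (rcons fs f) = adjoin (adjoins J fs) f.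
Proof. by rewrite /adjoins -cats1 foldl_cat. Qed.

Lemma adjoins_mem J fs f : f \in fs -> adjoins J fs f.
Proof.
elim: fs J => [|g fs IH] J //; rewrite inE => /predU1P[->|/IH fs_f]; last exact: fs_f.
exact: (@adjoins_sub (adjoin J g) fs g (@adjoin_mem _ J g)).
Qed.

Lemma adjoins_congr J (f f' : nat -> S) (s : seq nat) : is_ideal J ->
  (forall i, i \in s -> J (f i - f' i)) ->
  adjoins J [seq f i | i <- s] = adjoins J [seq f' i | i <- s].
Proof.
rewrite /adjoins; elim: s J => [|i s IH] J //= JI H; rewrite (adjoin_congr JI (H i (mem_head _ _))).
apply: IH => [|j js]; first exact: adjoin_ideal.
apply: adjoin_sub; apply: H; by rewrite in_cons js orbT.
Qed.

Lemma adjoins_mul J J' x fs : is_ideal J -> is_ideal J' ->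
  (forall f, J f -> J' (x * f)) -> forall f, adjoins J fs f -> adjoins J' fs (x * f).
Proof.
elim: fs J J' => [|g fs IH] J J' JI JI' H f; first exact: H.
apply: (IH (adjoin J g)) => [||h]; try exact: adjoin_ideal.
move=> /(adjoinE _ _ JI)[a [h' [Jh' ->]]]; apply/(adjoinE _ _ JI').
by exists (x * a), (x * h'); split; [apply: H|rewrite mulrDr mulrA].
Qed.

Lemma nzd_congr J f g : is_ideal J -> J (f - g) -> nzd J f -> nzd J g.
Proof.
move=> JI Jfg fr h Jgh; apply: fr; rewrite -(subrK g f) mulrDl.
by have [_ JD JM] := JI; apply: JD => //; rewrite mulrC; apply: JM.
Qed.

Lemma regular_seq_nzd J fs : ~ adjoins J fs 1 ->
  (forall r, (r < size fs)%N -> nzd (adjoins J (take r fs)) (nth 0 fs r)) ->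
  regular_seq J fs.
Proof.
elim: fs J => [|f fs IH] J //= n1 H; split; first exact: (H 0%N isT).
by apply: IH n1 _ => r rs; apply: (H r.+1 rs).
Qed.

Definition homogeneous J : Prop := forall d f, J f -> J (pihomog mdeg d f).

Lemma pihomogM d e f g : f \is e.-homog ->
  pihomog mdeg d (f * g) = if (e <= d)%N then f * pihomog mdeg (d - e) g else 0.
Proof.
move=> fe; pose p := msize g; rewrite [in LHS](pihomog_partitionE (leqnn p)).
rewrite big_distrr raddf_sum /=.
have hom i : f * pihomog mdeg i g \is (e + i).-homog by rewrite dhomogM ?pihomogP.
case: leqP => ed; last first.
  by rewrite big1 // => i _; apply: pihomog_ne0 (hom i); lia.
case: (ltnP (d - e) p) => dp; last first.
  rewrite big1 => [|i _]; last by apply: pihomog_ne0 (hom i); have := ltn_ord i; lia.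
  rewrite pihomogE big_seq_cond big1 ?mulr0 // => m /andP[/msize_mdeg_lt mg /eqP E].
  by move: mg; rewrite E ltnNge dp.
rewrite (bigD1 (Ordinal dp)) //= big1 ?addr0 => [|i ine].
  by rewrite pihomog_dE // -{2}(subnKC ed) hom.
by apply: pihomog_ne0 (hom i); move: ine; rewrite -val_eqE /=; lia.
Qed.

Lemma homogeneous_adjoin J f e : is_ideal J -> homogeneous J -> f \is e.-homog ->
  homogeneous (adjoin J f).
Proof.
move=> JI hJ fe d g /(adjoinE _ _ JI)[a [h [Jh ->]]]; apply/(adjoinE _ _ JI).
rewrite pihomogD mulrC (pihomogM d a fe); case: leqP => _.
  by exists (pihomog mdeg (d - e) a), (pihomog mdeg d h); split; [apply: hJ|rewrite mulrC].
by exists 0, (pihomog mdeg d h); split; [apply: hJ|rewrite mul0r].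
Qed.

Lemma homogeneous_mono (M : 'X_{1..n} -> Prop) : homogeneous (mono M).
Proof.
move=> d f Mf m; rewrite -[m \in _]negbK -mcoeff_eq0 pihomogE => nz; apply: Mf.
apply: contraR nz => mf; rewrite raddf_sum big1_seq // => m' /andP[_ m'f] /=.
rewrite mcoeffZ mcoeffX; case: eqP => [E|_]; rewrite ?mulr0 //.
by rewrite -E m'f in mf.
Qed.

Lemma homogeneous_in J f : is_ideal J -> (forall d, J (pihomog mdeg d f)) -> J f.
Proof.
move=> JI H; rewrite (pihomog_partitionE (leqnn (msize f))).
exact: ideal_sum.
Qed.

(** If [f g] is in [J], then [g] is [x g'] modulo [J], with [f g'] in [J] and [g']
    of smaller degree.  This is the first half of the fact that homogeneous
    regular sequences can be permuted; [nzd_swap_adjoin] is the other. *)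
Lemma nzd_swap J f x e : is_ideal J -> homogeneous J -> f \is e.-homog ->
  x \is 1.-homog -> nzd J x -> nzd (adjoin J x) f -> nzd J f.
Proof.
move=> JI hJ fe x1 xr fr g Jfg; apply: homogeneous_in => // d.
have {Jfg} : J (f * pihomog mdeg d g).
  by have := hJ (e + d)%N _ Jfg; rewrite (pihomogM _ _ fe) leq_addr addKn.
have := pihomogP mdeg d g; move: (pihomog _ d g) => {}g gd Jfg.
have [J0 JD JM] := JI.
elim: d g gd Jfg => [|d IH] g gd Jfg;
  have /(adjoinE _ _ JI)[a [h [Jh E]]] := fr g (adjoin_sub Jfg);
  rewrite -(pihomog_dE gd) E pihomogD [a * x]mulrC (pihomogM _ a x1).
  by rewrite add0r; apply: hJ.
rewrite /= subSS subn0; apply: (JD); last exact: hJ.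
apply: (JM); apply: IH; first exact: pihomogP.
apply: xr; rewrite mulrCA.
have -> : x * pihomog mdeg d a = g - pihomog mdeg d.+1 h.
  by rewrite -(pihomog_dE gd) E pihomogD [a * x]mulrC (pihomogM _ a x1) subSS subn0 addrK.
by rewrite mulrBr; apply: idealB => //; apply/JM/hJ.
Qed.

Lemma nzd_swap_adjoin J f x : is_ideal J -> nzd J x -> nzd (adjoin J x) f -> nzd (adjoin J f) x.
Proof.
move=> JI xr fr g /(adjoinE _ _ JI)[a [h [Jh E]]]; apply/(adjoinE _ _ JI).
have /(adjoinE _ _ JI)[b [h' [Jh' aE]]] : adjoin J x a.
  apply: fr; apply/(adjoinE _ _ JI); exists g, (- h); split; first exact: idealN.
  by rewrite mulrC -[a * f](addrK h) -E mulrC.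
exists b, (g - b * f); split; last by rewrite subrKC.
apply: xr; rewrite mulrBr E aE mulrDl [b * x]mulrC -!mulrA addrAC.
rewrite [x * _ + _]addrC addrK.
by have [_ JD JM] := JI; apply: JD => //; rewrite mulrC; apply: JM.
Qed.

Lemma nzd_adds_swap J x fs : is_ideal J -> homogeneous J -> nzd J x ->
  x \is 1.-homog -> (forall f, f \in fs -> exists e, f \is e.-homog) ->
  (forall r, (r < size fs)%N -> nzd (adjoins (adjoin J x) (take r fs)) (nth 0 fs r)) ->
  forall r, (r < size fs)%N -> nzd (adjoins J (take r fs)) (nth 0 fs r).
Proof.
move=> + + + x1; elim: fs J => [|f fs IH] J //= JI hJ xr hom reg.
have [e fe] := hom f (mem_head _ _).
have f0 := reg 0%N isT.
case=> [_|r rs] /=; first exact: nzd_swap fe x1 xr f0.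
apply: IH rs => [||||r' rs].
- exact: adjoin_ideal.
- exact: homogeneous_adjoin fe.
- exact: nzd_swap_adjoin.
- by move=> g gs; apply: hom; rewrite inE gs orbT.
- by rewrite adjoinC; apply: (reg r'.+1).
Qed.

End Adds.

(** * Reisner's criterion *)

Section Reisner.
Variables (k : fieldType) (n : nat).
Local Notation S := {mpoly k[n]}.
Implicit Types (D : pred {set 'I_n}) (s t F : {set 'I_n}) (j : 'I_n) (f g : S).

(** Reisner's condition: in the complex and in the link of every face, reduced
    cohomology vanishes below the top dimension. *)
Definition reisner D : Prop := forall t i, D t -> (i < cdim D)%N ->
  exact k (fun s => D s && (t \subset s)) i.

Lemma reisner_pure D F : reisner D -> maxset D F -> #|F| = cdim D.
Proof.
move=> CM mF; have DF := maxsetp mF; apply/eqP.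
rewrite eqn_leq leq_cdim //= leqNgt; apply/negP => lt.
apply: (@exact_single k n _ F (oner_neq0 k)) (CM F _ DF lt) => s /=.
apply/andP/eqP => [[Ds Fs]|->]; last by [].
exact: maxsetsup mF Ds Fs.
Qed.

Definition star D j : pred {set 'I_n} := fun s => D (j |: s).
Definition link D j : pred {set 'I_n} := fun s => (j \notin s) && D (j |: s).

Lemma star_complex D j : complex D -> D [set j] -> complex (star D j).
Proof.
move=> [D0 Dd] Dj; split=> [|s t st]; rewrite /star ?setU0 //.
by apply: Dd; apply: setUS.
Qed.

Lemma link_complex D j : complex D -> D [set j] -> complex (link D j).
Proof.
move=> [D0 Dd] Dj; split=> [|s t st]; rewrite /link ?setU0 ?inE //.
case/andP=> jt Dt; rewrite (contra (subsetP st j)) //=.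
by apply: Dd Dt; apply: setUS.
Qed.

Lemma exact_link D j t i : j \notin t ->
  exact k (fun s => link D j s && (t \subset s)) i <->
  exact k (fun s => D s && (j |: t \subset s)) i.+1.
Proof.
move=> jt; rewrite -addn1 -(cards1 j).
have idI (s : {set 'I_n}) : [set id x | x in s] = s by rewrite imset_id.
apply: (@exact_reindex k n n id [set j]) => // [s|s /forall_inP sj|s].
- case/andP=> /andP[js _] _; apply/forall_inP => x xs; rewrite inE.
  by apply: contraNneq js => <-.
- have js : j \notin s by apply/negP => /sj; rewrite inE eqxx.
  rewrite idI setUC /link js; congr (_ && _).
  rewrite subUset subsetUl /=; apply/idP/idP => /subsetP H; apply/subsetP => x xt.
    by have := H x xt; rewrite !inE => /predU1P[E|//]; rewrite -E xt in jt.
  by rewrite inE H ?orbT.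
- case/andP=> Ds; rewrite subUset sub1set => /andP[js ts].
  exists (s :\ j); first by apply/forall_inP => x; rewrite !inE => /andP[].
  by rewrite idI setUC setD1K.
Qed.

Lemma cdim_link D j : complex D -> (forall F, maxset D F -> #|F| = cdim D) ->
  D [set j] -> (cdim (link D j)).+1 = cdim D.
Proof.
move=> [D0 Dd] pure Dj; apply/eqP; rewrite eqn_leq; apply/andP; split.
  have cL := link_complex (conj D0 Dd) Dj.
  have [F mF <-] := cdim_facet cL; have /andP[jF DF] := maxsetp mF.
  by have := leq_cdim DF; rewrite cardsU1 jF.
have [F mF jF] := maxset_exists Dj; rewrite sub1set in jF.
rewrite -(pure F mF) (cardsD1 j) jF ltnS; apply: leq_cdim.
by rewrite /link !inE eqxx setD1K // (maxsetp mF).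
Qed.

Lemma reisner_link D j : complex D -> reisner D -> D [set j] -> reisner (link D j).
Proof.
move=> cD CM Dj t i /andP[jt Dt] il; apply/(exact_link D i jt).
by apply: (CM) => //; rewrite -(cdim_link cD _ Dj) // => F; apply: reisner_pure.
Qed.

Lemma live1E D e m s : complex D -> live D 1 e m s =
  ([set j | (m j < e)%N] \subset s) && D (s :|: [set j | (e < m j)%N]).
Proof.
move=> [D0 Dd]; congr (_ && _).
  apply/forall_inP/subsetP => H x; first by rewrite inE ltnNge; apply: contraR => /H.
  by apply: contraR; rewrite -ltnNge => xe; apply: H; rewrite inE.
apply/exists_inP/idP => [[F /andP[mF sF]]|Ds].
  rewrite ltnS leqn0 sum_nat_eq0 => /forall_inP F0; apply: Dd (maxsetp mF).
  rewrite subUset sF; apply/subsetP => x; rewrite inE; apply: contraTT => /F0.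
  by rewrite mnmBE const_expE subn_eq0 -leqNgt.
have [F mF] := maxset_exists Ds; rewrite subUset => /andP[sF eF].
exists F; rewrite ?mF // ltnS leqn0 sum_nat_eq0; apply/forall_inP => x xF.
rewrite mnmBE const_expE subn_eq0 leqNgt; apply: contra xF => xe.
by apply: (subsetP eF); rewrite inE.
Qed.

(** A position with positive exponent is a cone point; without any, the family
    consists of the faces that contain the negative positions. *)
Lemma reisner_live D e m i : complex D -> reisner D -> (i < cdim D)%N ->
  exact k (live D 1 e m) i.
Proof.
move=> cD CM id; set N := [set j | (m j < e)%N]; set P := [set j | (e < m j)%N].
have lE s : live D 1 e m s = (N \subset s) && D (s :|: P) by apply: live1E.
have [P0|[v vP]] := set_0Vmem P.
  have {}lE s : live D 1 e m s = D s && (N \subset s) by rewrite lE P0 setU0 andbC.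
  case: (boolP (D N)) => DN; first by apply: eq_exact (CM N i DN id) => s; rewrite lE.
  apply: exact0 => s; rewrite lE; apply/negP => /andP[Ds Ns].
  by case/negP: DN; case: cD => _; apply; eauto.
apply: (@exact_cone _ _ _ v) => s vs; rewrite !lE -setUA [v |: (_ :|: _)](_ : _ = s :|: P).
  congr (_ && _); apply/subsetP/subsetP => H x xN; last by rewrite inE H ?orbT.
  have := H x xN; rewrite !inE => /predU1P[E|//].
  by move: xN vP; rewrite E !inE; lia.
by apply/setP => x; rewrite !inE; case: eqP => // ->; move: vP; rewrite inE => ->; rewrite orbT.
Qed.

Lemma vanish_reisner D : complex D -> reisner D -> vanish (@symb k n D 1) (cdim D).
Proof.
move=> cD CM [i|i] id; last by apply: neg_vanish; [exact: symb_ideal|lia].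
by apply: exact_cohomology => e m; apply: reisner_live.
Qed.

(** These play the role of the elementary symmetric polynomials and form a
    homogeneous system of parameters over any field. *)
Definition theta D r : S := \sum_(s | D s && (#|s| == r)) 'X_[ind s 1].

Lemma mdeg_ind s : mdeg (ind s 1) = #|s|.
Proof.
by rewrite mdegE -sum1_card [RHS]big_mkcond; apply: eq_bigr => i _; rewrite indE mul1n; case: ifP.
Qed.

Lemma theta_homog D r : theta D r \is r.-homog.
Proof. by apply: rpred_sum => s /andP[_ /eqP<-]; rewrite dhomogX /= mdeg_ind. Qed.

Lemma X_homog j : ('X_j : S) \is 1.-homog.
Proof. by rewrite dhomogX /= mdeg1. Qed.

Lemma symb1_sub D D' : complex D -> complex D' -> (forall s, D' s -> D s) ->
  psub (@symb k n D 1) (symb D' 1).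
Proof.
move=> cD cD' DD f H m /H; rewrite !symbM1 //; apply: contra; exact: DD.
Qed.

Lemma supp1D m j : supp (m + U_(j)) = j |: supp m.
Proof.
apply/setP => x; rewrite !inE mnmDE mnm1E addn_gt0 orbC lt0b eq_sym.
by [].
Qed.

Section Vertex.
Variables (D : pred {set 'I_n}) (j : 'I_n).
Hypotheses (cD : complex D) (Dj : D [set j]).
Let cS := star_complex cD Dj.
Let cL := link_complex cD Dj.
Let I' := @symb k n (star D j) 1.

Lemma nzd_star : nzd I' 'X_j.
Proof.
move=> g H m mg; have : (m + U_(j))%MM \in msupp ('X_j * g).
  by rewrite mulrC (perm_mem (msuppMX _ _)) addmC; apply: map_f.
by move/H; rewrite !symbM1 // supp1D /star setUA setUid.
Qed.

Lemma star_mul f : I' f -> symb D 1 ('X_j * f).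
Proof.
move=> H m; rewrite mulrC (perm_mem (msuppMX _ _)) => /mapP[m' /H + ->].
by rewrite !symbM1 // addmC supp1D.
Qed.

Lemma symb_star : psub (@symb k n D 1) I'.
Proof.
by apply: symb1_sub => // s; case: cD => _ Dd; apply: Dd; apply: subsetUr.
Qed.

Lemma symb_link : symb (link D j) 1 = adjoin I' 'X_j.
Proof.
have II := symb_ideal k (star D j) 1.
apply: predext => f; split=> [H|].
  apply: mono_in => [|m /H]; first exact: adjoin_ideal.
  rewrite symbM1 // /link negb_and negbK => /orP[|nD].
    rewrite inE lt0n -lep1mP => le; rewrite -(submK le) mpolyXD.
    by have [_ _ M] := adjoin_ideal I' 'X_j; apply: M; exact: adjoin_mem.
  by apply: adjoin_sub; apply/symbX; rewrite symbM1.
apply: adjoin_least; first exact: symb_ideal.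
  by apply: symb1_sub => // s /andP[].
apply/symbX; rewrite symbM1 // /link negb_and negbK inE mnm1E eqxx //.
Qed.

Lemma ind_setU1 s : j \notin s -> 'X_[ind (j |: s) 1] = 'X_j * 'X_[ind s 1] :> S.
Proof.
move=> js; rewrite -mpolyXD; congr 'X_[_]; apply/mnmP => x.
rewrite mnmDE mnm1E !indE !mul1n !inE eq_sym; case: eqP => [<-|] //=.
by rewrite (negbTE js).
Qed.

(** Modulo the ideal of the star of [j], the faces that survive are those of the
    link and their joins with [j]. *)
Lemma theta_star r : I' (theta D r.+1 - (theta (link D j) r.+1 + 'X_j * theta (link D j) r)).
Proof.
have II := symb_ideal k (star D j) 1.
rewrite /theta (bigID (fun s : {set 'I_n} => j \in s)) /=.
have -> : \sum_(s | D s && (#|s| == r.+1) && (j \in s)) 'X_[ind s 1] =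
    'X_j * \sum_(s | link D j s && (#|s| == r)) 'X_[ind s 1] :> S.
  rewrite big_distrr /= (reindex_onto (fun s => j |: s) (fun s => s :\ j)) /=; last first.
    by move=> s /andP[_ js]; rewrite setD1K.
  apply: eq_big => [s|s].
    rewrite setU11 andbT /link; case: (boolP (j \in s)) => js /=.
      apply/negbTE; rewrite negb_and; apply/orP; right; apply/eqP => E.
      by move: js; rewrite -E !inE eqxx.
    by rewrite setU1K // eqxx andbT cardsU1 js.
  case/andP=> _ /eqP E; apply: ind_setU1; rewrite -E !inE eqxx //.
rewrite addrC opprD addrACA subrr addr0.
rewrite (bigID (fun s => D (j |: s))) /= addrAC.
have -> : \sum_(s | D s && (#|s| == r.+1) && (j \notin s) && D (j |: s)) 'X_[ind s 1] =
    \sum_(s | link D j s && (#|s| == r.+1)) 'X_[ind s 1] :> S.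
  apply: eq_bigl => s; rewrite /link; case Ds: (D (j |: s)); rewrite ?andbF // !andbT.
  have -> : D s by case: cD => _ Dd; apply: Dd Ds; apply: subsetUr.
  by rewrite andbC.
rewrite subrr add0r; apply: ideal_sum => // s /andP[_ nD].
by apply/symbX; rewrite symbM1 // supp_ind.
Qed.

End Vertex.

Definition thetas D r : seq S := [seq theta D i.+1 | i <- iota 0 r].

Lemma size_thetas D r : size (thetas D r) = r.
Proof. by rewrite size_map size_iota. Qed.

Lemma take_thetas D r d : (r <= d)%N -> take r (thetas D d) = thetas D r.
Proof. by move=> rd; rewrite -map_take take_iota (minn_idPl rd). Qed.

Lemma nth_thetas D r d : (r < d)%N -> nth 0 (thetas D d) r = theta D r.+1.
Proof. by move=> rd; rewrite (nth_map 0%N) ?size_iota // nth_iota. Qed.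

Lemma thetasS D r : thetas D r.+1 = rcons (thetas D r) (theta D r.+1).
Proof. by rewrite /thetas -[X in iota _ X]addn1 iotaD map_cat cats1. Qed.

Lemma theta_big D r : (cdim D < r)%N -> theta D r = 0.
Proof.
move=> lt; rewrite /theta big_pred0 // => s; apply/negP => /andP[Ds /eqP E].
by have := leq_cdim Ds; rewrite E leqNgt lt.
Qed.

Lemma theta0 D : complex D -> theta D 0 = 1.
Proof.
move=> [D0 _]; rewrite /theta (big_pred1 set0) => [|s].
  by rewrite -mpolyX0; congr 'X_[_]; apply/mnmP => i; rewrite indE inE mnm0E.
by rewrite cards_eq0 andb_idl // => /eqP->.
Qed.

(** Induction along links.  After inverting a vertex [x_j] the ring is that of
    the link of [j] over Laurent polynomials in [x_j]; there all [theta]s but the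
    last are regular by induction and permutation with [x_j], and modulo them the
    last one is a power of [x_j] up to sign.  So a zero divisor gives a torsion
    element, and torsion vanishes as long as there is depth left. *)
Lemma theta_nzd d D : complex D -> reisner D -> cdim D = d -> forall r, (r < d)%N ->
  nzd (adjoins (@symb k n D 1) (thetas D r)) (theta D r.+1).
Proof.
elim: d D => // d IH D cD CM Dd.
have II := symb_ideal k D 1.
have tor r g : (r <= d)%N -> adjoins (symb D 1) (thetas D r) (theta D r.+1 * g) ->
    forall j, exists N, adjoins (symb D 1) (thetas D r) ('X_j ^+ N * g).
  move=> rd H j; case: (boolP (D [set j])) => Dj; last first.
    exists 1%N; rewrite expr1 mulrC; have [_ _ M] := adjoins_ideal (thetas D r) II.
    apply/M/adjoins_sub/symbX; rewrite symbM1 //; apply: contra Dj.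
    by case: cD => _ Ddn; apply: Ddn; rewrite sub1set inE mnm1E eqxx.
  have cL := link_complex cD Dj; have Ld : cdim (link D j) = d.
    by apply: succn_inj; rewrite cdim_link // => F; apply: reisner_pure.
  set I' := @symb k n (star D j) 1; have II' : is_ideal I' by apply: symb_ideal.
  have {}IH := IH _ cL (reisner_link cD CM Dj) Ld.
  have LE : symb (link D j) 1 = adjoin I' 'X_j := symb_link cD Dj.
  have cong i : symb (link D j) 1 (theta (link D j) i.+1 - theta D i.+1).
    have -> : theta (link D j) i.+1 - theta D i.+1 =
        - (theta D i.+1 - (theta (link D j) i.+1 + 'X_j * theta (link D j) i))
        - theta (link D j) i * 'X_j.
      by rewrite opprB mulrC addrAC addrK.
    have AI := adjoin_ideal I' 'X_j; have [_ _ AM] := AI.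
    rewrite LE; apply: (@idealB _ (adjoin I' 'X_j)) => //;
      last by apply: (AM); apply: (@adjoin_mem _ I' 'X_j).
    by apply: (@idealN _ (adjoin I' 'X_j)) => //; apply: (@adjoin_sub _ I' 'X_j); apply: theta_star.
  have star_nzd r' : (r' < d)%N -> nzd (adjoins I' (thetas D r')) (theta D r'.+1).
    move=> r'd; have := @nzd_adds_swap k n I' 'X_j (thetas D d) II' _ (nzd_star cD Dj)
      (X_homog j) _ _ r'.
    rewrite size_thetas take_thetas ?(ltnW r'd) // nth_thetas //; apply=> //.
    - exact: homogeneous_mono.
    - by move=> f /mapP[i _ ->]; exists i.+1; apply: theta_homog.
    move=> q qd; rewrite take_thetas ?(ltnW qd) // nth_thetas // -LE.
    have LI := symb_ideal k (link D j) 1.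
    have -> : adjoins (symb (link D j) 1) (thetas D q) =
        adjoins (symb (link D j) 1) (thetas (link D j) q).
      apply: (@adjoins_congr k n _ (fun i => theta D i.+1)
        (fun i => theta (link D j) i.+1)) => // i _.
      by rewrite -opprB; apply: (@idealN _ (symb (link D j) 1)).
    by apply: nzd_congr (IH q qd); [exact: adjoins_ideal|apply: adjoins_sub].
  have toD f q : adjoins I' (thetas D q) f -> adjoins (symb D 1) (thetas D q) ('X_j * f).
    exact: adjoins_mul (star_mul cD Dj) f.
  have H' : adjoins I' (thetas D r) (theta D r.+1 * g).
    have := @adjoins_mul k n (symb D 1) I' 1 (thetas D r) II II' _ _ H; rewrite mul1r; apply=> f.
    by rewrite mul1r; apply: symb_star.
  move: rd; rewrite leq_eqVlt => /predU1P[rd|rd]; last first.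
    by exists 1%N; rewrite expr1; apply: toD; apply: star_nzd rd _ H'.
  subst r; exists d.+2.
  have AI := adjoins_ideal (thetas D d) II'; have [_ AD AM] := AI.
  have pow i : (i <= d)%N ->
      adjoins I' (thetas D d) (theta (link D j) i - (- 'X_j) ^+ i).
    elim: i => [_|i IHi id]; first by rewrite theta0 // expr0 subrr; case: AI.
    have -> : theta (link D j) i.+1 - (- 'X_j) ^+ i.+1 =
       theta D i.+1 - (theta D i.+1 - (theta (link D j) i.+1 + 'X_j * theta (link D j) i))
       + (- 'X_j) * (theta (link D j) i - (- 'X_j) ^+ i) :> S.
      by rewrite exprS; move: ((- 'X_j) ^+ i) => p; ring.
    apply: (AD); last by apply/AM/IHi/ltnW.
    apply: (@idealB _ (adjoins I' (thetas D d))) => //.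
      by apply: adjoins_mem; apply: (map_f (fun i => theta D i.+1)); rewrite mem_iota.
    exact/adjoins_sub/theta_star.
  have last : adjoins I' (thetas D d) (theta D d.+1 - 'X_j * (- 'X_j) ^+ d).
    have -> : theta D d.+1 - 'X_j * (- 'X_j) ^+ d =
       (theta D d.+1 - (theta (link D j) d.+1 + 'X_j * theta (link D j) d))
       + 'X_j * (theta (link D j) d - (- 'X_j) ^+ d) :> S.
      rewrite (theta_big (D := link D j)) ?Ld // add0r; move: ((- 'X_j) ^+ d) => p; ring.
    by apply: (AD); [apply/adjoins_sub/theta_star|apply/AM/pow].
  rewrite exprS -mulrA; apply: toD.
  have -> : 'X_j ^+ d.+1 * g = (-1) ^+ d * (theta D d.+1 * g -
       g * (theta D d.+1 - 'X_j * (- 'X_j) ^+ d)) :> S.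
    rewrite (exprNn 'X_j) exprS; have : ((-1) ^+ d : S) ^+ 2 = 1 by exact: sqrr_sign.
    move: ((-1) ^+ d : S) => q q2.
    transitivity (q ^+ 2 * 'X_j * 'X_j ^+ d * g); first by rewrite q2 mul1r.
    by move: ('X_j ^+ d) => p; ring.
  by apply: (AM); apply: (@idealB _ (adjoins I' (thetas D d))) => //; apply: AM.
have van r : (r <= d.+1)%N -> vanish (adjoins (@symb k n D 1) (thetas D r)) (d.+1 - r).
  elim: r => [_|r IHr rd]; first by rewrite subn0 -Dd; apply: vanish_reisner.
  rewrite thetasS adjoins_rcons; apply: vanish_adjoin; first exact: adjoins_ideal.
    move=> g H; apply: vanish_torsion_free (tor _ _ _ H) => //; first exact: adjoins_ideal.
    move=> i i1; apply: (IHr (ltnW rd)); apply: Order.POrderTheory.lt_le_trans i1 _; lia.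
  by rewrite -subSn // subSS; apply: IHr; apply: ltnW.
move=> r rd g H; apply: vanish_torsion_free (tor _ _ _ H) => //; first exact: adjoins_ideal.
move=> i i1; apply: (van r (ltnW rd)); apply: Order.POrderTheory.lt_le_trans i1 _; lia.
Qed.

Lemma symb_max_ideal D f : complex D -> symb D 1 f -> max_ideal f.
Proof.
move=> cD H; apply: (mono_in (ideal_gen_ideal _)) => m /H; rewrite symbM1 // => nD.
have [E|[i]] := set_0Vmem (supp m); first by rewrite E in nD; case: cD => D0; rewrite D0 in nD.
rewrite inE lt0n -lep1mP => le; rewrite -(submK le) mpolyXD.
have [_ _ M] := ideal_gen_ideal (fun f : S => exists i, f = 'X_i).
by apply: M; apply: ideal_gen_sub; exists i.
Qed.

Lemma max_ideal_proper : ~ @max_ideal k n 1.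
Proof.
have -> : @max_ideal k n = facet_ideal set0 1.
  rewrite -coface_idealE; congr ideal_gen; apply: predext => f.
  by split=> [[i ->]|[i _ ->]]; exists i => //; rewrite inE.
by have [] := facet_prime k (set0 : {set 'I_n}).
Qed.

Lemma theta_max D r : max_ideal (theta D r.+1).
Proof.
apply: ideal_sum => [|s /andP[_ /eqP sr]]; first exact: ideal_gen_ideal.
have /card_gt0P[i si] : (0 < #|s|)%N by rewrite sr.
have le : (U_(i) <= ind s 1)%MM by rewrite lep1mP indE si.
rewrite -(submK le) mpolyXD.
have [_ _ M] := ideal_gen_ideal (fun f : S => exists i, f = 'X_i).
by apply: M; apply: ideal_gen_sub; exists i.
Qed.

(** No regular sequence is longer than the dimension, because a facet of maximal
    size carries cohomology in that degree. *)
Theorem cohen_macaulay_reisner D : complex D ->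
  cohen_macaulay (@stanley_reisner_ideal k n D) <-> reisner D.
Proof.
move=> cD; rewrite stanley_reisnerE //; have dimD := symb_krull k cD (ltn0Sn 0).
have II := symb_ideal k D 1.
have ex fs : (forall f, f \in fs -> max_ideal f) -> regular_seq (symb D 1) fs ->
    forall t i, (i < size fs)%N -> exact k (fun s => D s && (t \subset s)) i.
  move=> fm reg t i ifs; have van := regular_vanish II fm reg.
  have lE s : live D 1 1 (ind (~: t) 1) s = D s && (t \subset s).
    rewrite live1E // andbC; set A := [set _ | _]; set B := [set _ | _].
    have -> : A = set0 by apply/setP => x; rewrite !inE indE mul1n ltnNge; case: (_ \in _).
    have -> : B = t by apply/setP => x; rewrite !inE indE mul1n inE; case: (_ \in _).
    by rewrite setU0.
  by apply: eq_exact lE _; apply: (@cohomology_exact k n D 1); apply: van.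
split=> [[d dD [[fs [sz fm reg]] _]] t i Dt|CM].
  by rewrite (krull_dim_uniq dimD dD) -sz; apply: ex.
exists (cdim D) => //; split.
  exists (thetas D (cdim D)); split; first exact: size_thetas.
    by move=> f /mapP[i _ ->]; apply: theta_max.
  apply: regular_seq_nzd => [|r]; last first.
    rewrite size_thetas => rd; rewrite take_thetas ?(ltnW rd) // nth_thetas //.
    exact: theta_nzd.
  have sub : forall fs (J : S -> Prop), psub J (@max_ideal k n) ->
      (forall f, f \in fs -> max_ideal f) -> psub (adjoins J fs) (@max_ideal k n).
    elim=> [//|f fs IH] J JM fm; apply: IH => [|g gs]; last by apply: fm; rewrite inE gs orbT.
    by apply: adjoin_least => //; [exact: ideal_gen_ideal|apply: fm; rewrite mem_head].
  move/sub => H; apply: max_ideal_proper; apply: H => [f|f /mapP[i _ ->]].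
    exact: symb_max_ideal.
  exact: theta_max.
move=> fs fm reg; rewrite leqNgt; apply/negP => lt.
have [F mF FE] := cdim_facet cD.
apply: (@exact_single k n _ F (oner_neq0 k)) (ex fs fm reg F _ _); last by rewrite FE.
move=> s /=; apply/andP/eqP => [[Ds Fs]|->]; first exact: maxsetsup mF Ds Fs.
by split=> //; apply: maxsetp mF.
Qed.

End Reisner.

(** * Generalized Cohen-Macaulayness in degrees *)

Section GCM.
Variables (k : fieldType) (n : nat) (D : pred {set 'I_n}).
Hypothesis cD : complex D.
Implicit Types (s t F A : {set 'I_n}) (j p q : 'I_n) (m : 'X_{1..n}).

(** A facet that avoids [j] has degree at least [r] outside it, so all relevant
    facets contain [j], which is then a cone point. *)
Lemma live_cone r e m j i : (e + r <= m j)%N -> exact k (live D r e m) i.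
Proof.
move=> mj; apply: (@exact_cone _ _ _ j) => s js; rewrite /live; congr (_ && _).
  apply/forall_inP/forall_inP => H x xs.
    case: (eqVneq x j) => [->|xj]; first by apply: leq_trans mj; apply: leq_addr.
    by apply: H; rewrite !inE negb_or xj.
  by apply: H; apply: contra xs => xs; rewrite inE xs orbT.
apply: eq_existsb => F; rewrite subUset sub1set.
case: (boolP (j \in F)) => //= jF; rewrite andbF; apply/esym/negbTE.
rewrite negb_and -leqNgt; apply/orP; right.
by rewrite /deg_off (bigD1 j) //= mnmBE const_expE; lia.
Qed.

Lemma gcm_live :
  generalized_cohen_macaulay (@symb k n D 2) <->
  (forall i e m, (i < cdim D)%N -> (exists j, m j < e)%N -> exact k (live D 2 e m) i).
Proof.
have dD : krull_dim (@symb k n D 2) (cdim D) by apply: symb_krull.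
split=> [[d dd H] i e m id [j mj]|H].
  apply: exact_of_finite_length mj; apply: H.
  by rewrite (krull_dim_uniq dd dD).
exists (cdim D) => // i id; apply: finite_length_of_exact => e m /forallPn[j].
rewrite negb_and -!ltnNge => /orP[mj|mj]; first by apply: H => //; exists j.
by apply: (@live_cone _ _ _ j); rewrite addn2.
Qed.

(** The shape of [live] for [r = 2] when [A] is the set of positions with
    exponent 1: the exponents outside a facet add up to less than 2, so the facet
    may miss one element of [A]. *)
Definition nearly A s : bool := D (s :|: A) || [exists a in A, D (s :|: (A :\ a))].

Lemma live2E e m s : (forall j, m j <= e.+1)%N -> live D 2 e m s =
  ([set j | (m j < e)%N] \subset s) && nearly [set j | m j == e.+1] s.
Proof.
move=> me; set A := [set j | m j == _]; congr (_ && _).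
  apply/forall_inP/subsetP => H x; first by rewrite inE ltnNge; apply: contraR => /H.
  by apply: contraR; rewrite -ltnNge => xe; apply: H; rewrite inE.
have wtE F : deg_off F (m - const_exp n e) = #|A :\: F|.
  rewrite -sum1_card [RHS]big_mkcond [LHS]big_mkcond; apply: eq_bigr => x _.
  rewrite !inE; case: (x \in F) => //=; have := me x.
  by rewrite mnmBE const_expE; case: eqP => [->|]; lia.
have ext t : D t -> exists2 F, maxset D F & t \subset F.
  by move=> Dt; have [F mF tF] := maxset_exists Dt; exists F.
have [_ Dd] := cD.
apply/exists_inP/orP => [[F /andP[mF sF]]|[|/exists_inP[a aA]] /ext[F mF]].
- rewrite wtE; case: (set_0Vmem (A :\: F)) => [/eqP|[a]].
    rewrite setD_eq0 => AF _; left; apply: Dd (maxsetp mF).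
    by rewrite subUset sF.
  move=> aAF; rewrite (cardsD1 a) aAF ltnS ltnS leqn0 cards_eq0 => /eqP E.
  right; apply/exists_inP; exists a; first by move: aAF; rewrite inE => /andP[].
  apply: Dd (maxsetp mF); rewrite subUset sF; apply/subsetP => x.
  rewrite !inE => /andP[xa mx]; apply: contraT => xF.
  by move/setP: E => /(_ x); rewrite !inE xa xF mx.
- rewrite subUset => /andP[sF AF]; exists F; first by rewrite mF.
  by rewrite wtE (eqP (_ : A :\: F == set0)) ?cards0 // setD_eq0.
- rewrite subUset => /andP[sF AF]; exists F; first by rewrite mF.
  rewrite wtE ltnS; apply: leq_trans (subset_leq_card (_ : _ \subset [set a])) _.
    apply/subsetP => x; rewrite !inE => /andP[xF mx]; apply: contraR xF => xa.
    by apply: (subsetP AF); rewrite !inE xa.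
  by rewrite cards1.
Qed.

End GCM.

Lemma subset_setU1 (T : finType) (v : T) (t s : {set T}) : v \notin t ->
  (t \subset v |: s) = (t \subset s).
Proof.
move=> vt; apply/subsetP/subsetP => H x xt; last by rewrite inE H ?orbT.
by have := H x xt; rewrite !inE => /predU1P[E|//]; rewrite -E xt in vt.
Qed.

Lemma exact0_at (k : pzRingType) n (L : pred {set 'I_n}) :
  (L set0 -> exists v, L [set v]) -> exact k L 0.
Proof.
move=> H a ha; exists a => s Ls /eqP; rewrite cards_eq0 => /eqP E; rewrite {s}E in Ls *.
have [v Lv] := H Ls; have := ha _ Lv (cards1 v).
rewrite /sd big_set1 big_set0 setDv /cut Ls.
by move/(congr1 ( *%R ((-1) ^+ pos v [set v]))); rewrite signrMK mulr0.
Qed.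

(** * Graphs *)

Section Graphs.
Variables (k : fieldType) (n : nat) (e : rel 'I_n).
Hypotheses (e_sym : ssrbool.symmetric e) (e_irr : irreflexive e).
Implicit Types (s t F A W : {set 'I_n}) (i p q : 'I_n).
Local Notation D := (independent e).
Let cD : complex D := independent_complex e.

Lemma independentU1 i s : D (i |: s) = D s && [forall x in s, ~~ e i x].
Proof.
apply/independentP/andP => [H|[/independentP Hs /forall_inP Hi] x y].
  split; first by apply/independentP => x y xs ys; apply: H; rewrite inE ?xs ?ys orbT.
  by apply/forall_inP => x xs; apply: H; rewrite !inE ?eqxx ?xs ?orbT.
rewrite !inE => /predU1P[->|xs] /predU1P[->|ys]; last exact: Hs.
- by rewrite e_irr.
- exact: Hi.
- by rewrite e_sym; apply: Hi.
Qed.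

Lemma independent1 i : D [set i].
Proof. by apply/independentP => x y; rewrite !inE => /eqP-> /eqP->; rewrite e_irr. Qed.

Definition subgraph W : pred {set 'I_n} := fun s => (s \subset W) && D s.

Lemma subgraph_complex W : complex (subgraph W).
Proof.
have [D0 Dd] := cD; split=> [|s t st]; rewrite /subgraph ?sub0set //.
by case/andP=> tW Dt; rewrite (subset_trans st) // (Dd s t).
Qed.

Lemma alphaE W : alpha e W = cdim (subgraph W). Proof. by []. Qed.

Lemma subgraph_link i : subgraph (link_vertices e i) = link D i.
Proof.
apply: functional_extensionality => s; rewrite /subgraph /link independentU1.
apply/andP/andP => [[/subsetP sW Ds]|[js /andP[Ds /forall_inP H]]]; split=> //.
- by apply/negP => /sW; rewrite !inE eqxx.
- rewrite Ds; apply/forall_inP => x /sW; rewrite !inE negb_or.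
  by case/andP.
- apply/subsetP => x xs; rewrite !inE negb_or H // andbT.
  by apply: contraNneq js => <-.
Qed.

Lemma subgraph_edge W p q s : p \in W -> q \in W ->
  subgraph (edge_vertices e W p q) s = subgraph W (p |: s) && subgraph W (q |: s).
Proof.
move=> pW qW; rewrite /subgraph !independentU1 !subUset !sub1set pW qW /=.
apply/andP/andP => [[/subsetP sE Ds]|[]].
  have sW : s \subset W by apply/subsetP => x /sE; rewrite !inE => /andP[].
  rewrite sW Ds; split; apply/forall_inP => x xs; have := sE x xs;
    by rewrite !inE (subsetP sW) // negb_or => /andP[/andP[]].
case/and3P=> sW -> /forall_inP pH /and3P[_ _ /forall_inP qH]; split=> //.
apply/subsetP => x xs; rewrite !inE (subsetP sW) // negb_or pH ?qH //.
Qed.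

(** Renumbering the vertices of an induced subgraph keeps their order, hence the
    signs of the coboundary. *)
Lemma enum_val_mono W (x y : 'I_#|W|) : (enum_val x < enum_val y)%N = (x < y)%N.
Proof.
have homo (u v : 'I_#|W|) : (u < v)%N -> (enum_val u < enum_val v)%N.
  move=> uv; have x0 := enum_val u; rewrite !(enum_val_nth x0).
  have so : sorted (fun a b : 'I_n => (a < b)%N) (enum W).
    rewrite {1}/enum_mem; apply: sorted_filter; first by move=> a b c; apply: ltn_trans.
    have := iota_ltn_sorted 0 n; rewrite -val_enum_ord sorted_map enumT.
    by congr sorted.
  apply: (sorted_ltn_nth _ _ so) => //; rewrite ?inE -?cardE //.
  by move=> a b c; apply: ltn_trans.
case: (ltngtP x y) => [/homo//|/homo yx|/val_inj->]; last by rewrite ltnn.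
by apply/negbTE; rewrite -leqNgt ltnW.
Qed.

Lemma independent_induced W (s : {set 'I_#|W|}) :
  independent (@induced n e W) s = subgraph W (enum_val @: s).
Proof.
have -> : subgraph W (enum_val @: s) = D (enum_val @: s).
  rewrite /subgraph; case: (D _); rewrite ?andbF // andbT.
  by apply/subsetP => x /imsetP[y _ ->]; apply: enum_valP.
apply/independentP/independentP => [H x y /imsetP[u us ->] /imsetP[v vs ->]|H x y xs ys].
  exact: H.
by apply: H; apply: imset_f.
Qed.

Lemma subgraph_imset W t : subgraph W t -> exists s : {set 'I_#|W|}, t = enum_val @: s.
Proof.
case/andP=> tW _; exists (enum_val @^-1: t); apply/setP => x.
apply/idP/imsetP => [xt|[y + ->]]; last by rewrite inE.
have xW := subsetP tW x xt.
by exists (enum_rank_in xW x); rewrite ?inE enum_rankK_in.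
Qed.

Lemma cdim_induced W : cdim (independent (@induced n e W)) = cdim (subgraph W).
Proof.
have inj := @enum_val_inj _ (mem W).
apply/eqP; rewrite eqn_leq; apply/andP; split.
  have [F /maxsetp DF <-] := cdim_facet (independent_complex (@induced n e W)).
  rewrite -(card_imset (mem F) inj); apply: leq_cdim.
  by move: DF; rewrite independent_induced; congr (subgraph W _); apply/setP.
have [F /maxsetp DF <-] := cdim_facet (subgraph_complex W).
have [s E] := subgraph_imset DF; rewrite E (card_imset _ inj); apply: leq_cdim.
by rewrite independent_induced -E.
Qed.

Lemma cm_graphE W : cm_graph k e W <-> reisner k (subgraph W).
Proof.
rewrite /cm_graph cohen_macaulay_reisner; last exact: independent_complex.
have inj := @enum_val_inj _ (mem W).
have ok (s : {set 'I_#|W|}) : [forall i in s, enum_val i \notin (set0 : {set 'I_n})].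
  by apply/forall_inP => x _; rewrite inE.
have E (t : {set 'I_#|W|}) (i : nat) :
    exact k (fun s : {set 'I_#|W|} => independent (@induced n e W) s && (t \subset s)) i <->
    exact k (fun s => subgraph W s && (enum_val @: t \subset s)) i.
  rewrite -[in X in _ <-> X](addn0 i) -(cards0 'I_n).
  apply: exact_reindex => [x y|s _|s _|t' /andP[Dt' _]]; [exact: enum_val_mono|exact: ok| |].
    rewrite setU0 independent_induced; congr (_ && _).
    apply/subsetP/idP => [H|ts x]; last by apply: (subsetP (imsetS _ ts)).
    apply/subsetP => x xt; have /imsetP[y ys /inj->//] := H _ (imset_f _ xt).
  by have [s ->] := subgraph_imset Dt'; exists s; rewrite ?setU0.
split=> R t i Dt il.
  have [s ts] := subgraph_imset Dt; rewrite ts in Dt *; apply/E.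
  by apply: R; rewrite ?independent_induced ?cdim_induced.
by apply/E; apply: R; rewrite -?independent_induced -?cdim_induced.
Qed.

(** Within the link of [i], the stars of [p] and [q] are cones and meet in the
    common part of the links, so Mayer-Vietoris shifts the degree by one; passing
    to the link of [i] accounts for the other shift. *)
Lemma exact_two_stars i p q t j : i != p -> i != q -> p \notin t -> q \notin t -> i \notin t ->
  exact k (fun s => (link D i (p |: s) && link D i (q |: s)) && (t \subset s)) j <->
  exact k (fun s => (D (p |: s) || D (q |: s)) && (i |: t \subset s)) j.+2.
Proof.
move=> ip iq pt qt it.
rewrite -(exact_link k (fun s => D (p |: s) || D (q |: s)) j.+1 it).
pose A x s := link D i (x |: s) && (t \subset s).
have AE s : A p s || A q s =
    link (fun s => D (p |: s) || D (q |: s)) i s && (t \subset s).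
  rewrite /A /link -andb_orl !in_setU1 (negbTE ip) (negbTE iq) /= -andb_orr.
  by rewrite !(setUCA [set i]).
have BE s : A p s && A q s = (link D i (p |: s) && link D i (q |: s)) && (t \subset s).
  by rewrite /A andbACA andbb.
have lU x : i != x -> forall s s', s \subset s' -> link D i (x |: s') -> link D i (x |: s).
  move=> ix s s' ss; have [_] := link_complex cD (independent1 i).
  by apply; apply: setUS.
have Adown x : i != x -> forall s s', s \subset s' -> A p s || A q s -> A x s' -> A x s.
  move=> ix s s' ss L /andP[xs _]; rewrite /A (lU x ix s s' ss xs).
  by case/orP: L => /andP[_ ->].
have cone x : x \notin t -> forall j', exact k (A x) j'.
  move=> xt j'; apply: (@exact_cone _ _ _ x) => s xs.
  by rewrite /A setUA setUid subset_setU1.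
have conv : convex (fun s => A p s || A q s).
  move=> s1 s2 s3 s12 s23 L1 L3; have t2 : t \subset s2.
    by apply: subset_trans s12; case/orP: L1 => /andP[].
  by case/orP: L3 => /andP[H _]; apply/orP; [left|right]; rewrite /A t2 andbT; apply: lU s23 H.
split=> H.
  apply: eq_exact AE _; apply: exact_union => //; try exact: cone; try exact: Adown.
  by apply: eq_exact H => s; rewrite BE.
apply: eq_exact BE _; apply: exact_inter => //; try exact: cone; try exact: Adown.
by apply: eq_exact H => s; rewrite AE.
Qed.

(** An edge [pq] in [A] makes every other element of [A] a cone point, because a
    face must then miss [p] or [q].  If [A] is independent, then by flagness the
    sets missing a given [p] and the sets missing another element are two cones,
    which meet in the cone of the sets compatible with all of [A]. *)
Lemma exact_nearly (i : nat) t A : t != set0 -> [disjoint t & A] ->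
  exact k (fun s => D s && (t \subset s)) i ->
  (forall p q, e p q -> p \notin t -> q \notin t ->
     exact k (fun s => (D (p |: s) || D (q |: s)) && (t \subset s)) i) ->
  exact k (fun s => (t \subset s) && nearly D A s) i.
Proof.
move=> t0 tA exl exe; have [D0 Dd] := cD.
have At a : a \in A -> a \notin t by move=> aA; rewrite (disjointFl tA aA).
have nearlyE a s : a \in A -> nearly D A s = [exists a in A, D (s :|: (A :\ a))].
  move=> aA; apply/orP/idP => [[Ds|//]|]; last by right.
  by apply/exists_inP; exists a => //; apply: Dd Ds; apply: setUS; apply: subsetDl.
have absorb v (B s : {set 'I_n}) : v \in B -> (v |: s) :|: B = s :|: B.
  by move=> vB; apply/setP => x; rewrite !inE; case: eqP => // ->; rewrite vB !orbT.
case: (boolP [exists p in A, exists q in A, e p q])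
  => [/exists_inP[p pA /exists_inP[q qA epq]]|noedge].
  have pq : p != q by apply: contraTneq epq => ->; rewrite e_irr.
  have Dpq (B s : {set 'I_n}) : p \in B -> q \in B -> D (s :|: B) = false.
    move=> pB qB; apply/negP => /independentP/(_ p q); rewrite !inE pB qB !orbT.
    by rewrite epq => /(_ isT isT).
  have [E|[a aA]] := set_0Vmem (A :\ p :\ q).
    have AE : A = [set p; q].
      apply/setP => x; rewrite !inE; apply/idP/idP => [xA|/orP[]/eqP-> //].
      apply: contraT; rewrite negb_or => /andP[xp xq].
      by move/setP: E => /(_ x); rewrite !inE xp xq xA.
    apply: eq_exact (exe p q epq (At p pA) (At q qA)) => s; rewrite andbC; congr (_ && _).
    rewrite (nearlyE p) //; apply/orP/exists_inP => [[Ds|Ds]|[a]].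
    - by exists q => //; rewrite AE setUC [[set p; q]]setUC setU1K // inE eq_sym.
    - by exists p => //; rewrite AE setUC setU1K // inE.
    rewrite AE !inE => /orP[]/eqP->.
      by rewrite setU1K ?inE // setUC; right.
    by rewrite [[set p; q]]setUC setU1K ?inE 1?eq_sym // setUC; left.
  apply: (@exact_cone _ _ _ a) => s _; move: aA; rewrite !inE => /and3P[aq ap aA].
  rewrite subset_setU1 ?At // !(nearlyE p) //; congr (_ && _); apply: eq_existsb => b.
  case: (boolP (b \in A)) => //= bA; case: (eqVneq a b) => [E|ab].
    by rewrite -E !Dpq // !inE eq_sym ?ap ?aq ?pA //= eq_sym aq qA.
  by rewrite absorb // !inE ab.
have DA : D A.
  apply/independentP => x y xA yA; apply/negP => exy; case/negP: noedge.
  by apply/exists_inP; exists x => //; apply/exists_inP; exists y.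
have [A0|[p pA]] := set_0Vmem A.
  apply: eq_exact exl => s; rewrite andbC /nearly A0 setU0; congr (_ && _).
  apply/idP/orP => [->|[//|/exists_inP[a]]]; [by left|by rewrite inE].
have [A1|[q qA]] := set_0Vmem (A :\ p).
  apply: eq_exact exl => s; rewrite andbC (nearlyE p) //; congr (_ && _).
  have AE : A = [set p] by rewrite -(setD1K pA) A1 setU0.
  apply/idP/exists_inP => [Ds|[a aA]]; first by exists p; rewrite // A1 setU0.
  by apply: Dd; apply: subsetUl.
case: i exl exe => [_ _|i _ _].
  by apply: exact0_at => /andP[]; rewrite subset0 (negbTE t0).
pose X s := (t \subset s) && D (s :|: (A :\ p)).
pose Y s := (t \subset s) && [exists a in A :\ p, D (s :|: (A :\ a))].
have XY s : X s || Y s = (t \subset s) && nearly D A s.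
  rewrite /X /Y -andb_orr (nearlyE p) //; congr (_ && _).
  apply/orP/exists_inP => [[Ds|/exists_inP[a]]|[a aA Ds]].
  - by exists p.
  - by rewrite inE => /andP[_ aA] Ds; exists a.
  - case: (eqVneq a p) => [E|ap]; first by left; rewrite -E.
    by right; apply/exists_inP; exists a; rewrite // !inE ap.
have XYdown (a b : {set 'I_n}) B : a \subset b -> D (b :|: B) -> D (a :|: B).
  by move=> ab; apply: Dd; apply: setSU.
have Xt s : X s || Y s -> t \subset s by rewrite XY => /andP[].
have Xdown s s' : s \subset s' -> X s || Y s -> X s' -> X s.
  by move=> ss /Xt ts /andP[_ Ds]; rewrite /X ts (XYdown s s').
have Ydown s s' : s \subset s' -> X s || Y s -> Y s' -> Y s.
  move=> ss /Xt ts /andP[_ /exists_inP[a aA Ds]]; rewrite /Y ts; apply/exists_inP.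
  by exists a => //; apply: XYdown Ds.
apply: eq_exact XY _; apply: exact_union => //.
- move=> s1 s2 s3 s12 s23 /Xt t1 /orP[/andP[_ Ds]|/andP[_ /exists_inP[a aA Ds]]];
    have t2 := subset_trans t1 s12.
    by rewrite /X t2 (XYdown s2 s3).
  apply/orP; right; rewrite /Y t2; apply/exists_inP; exists a => //.
  exact: XYdown Ds.
- move=> i'; apply: (@exact_cone _ _ _ q) => s _; rewrite /X absorb // subset_setU1 //.
  by apply: At; move: qA; rewrite inE => /andP[].
- move=> i'; apply: (@exact_cone _ _ _ p) => s _; rewrite /Y subset_setU1 ?At //.
  congr (_ && _); apply: eq_existsb => a; rewrite !inE.
  by case: (eqVneq a p) => //= ap; rewrite absorb // !inE eq_sym ap.
have XYE s : (t \subset s) && D (s :|: A) = X s && Y s.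
  rewrite /X /Y andbACA andbb; congr (_ && _).
  apply/idP/andP => [Ds|[/independentP Ds /exists_inP[a]]].
    split; first by apply: Dd Ds; apply: setUS; apply: subsetDl.
    apply/exists_inP; exists q => //; by apply: Dd Ds; apply: setUS; apply: subsetDl.
  rewrite !inE => /andP[ap aA] /independentP Ds'.
  have pa : p \in A :\ a by rewrite !inE eq_sym ap.
  have p_free x : x \in s :|: A -> ~~ e p x.
    rewrite inE; case: (boolP (x \in s)) => [xs _|_ /= xA].
      by apply: Ds'; rewrite inE ?pa ?xs ?orbT.
    by move/independentP: DA; apply.
  apply/independentP => x y; rewrite !inE => xsA ysA.
  case: (eqVneq x p) => [->|xp]; first by apply: p_free; rewrite inE.
  case: (eqVneq y p) => [->|yp]; first by rewrite e_sym; apply: p_free; rewrite inE.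
  by apply: Ds; rewrite !inE ?xp ?yp.
apply: eq_exact XYE _; apply: (@exact_cone _ _ _ p) => s _.
by rewrite subset_setU1 ?At // absorb.
Qed.

Lemma gcm_graph :
  generalized_cohen_macaulay (@symbolic_square k n e) <->
  (forall (i : nat) t, t != set0 -> (i < cdim D)%N ->
     exact k (fun s => D s && (t \subset s)) i /\
     forall p q, e p q -> p \notin t -> q \notin t ->
       exact k (fun s => (D (p |: s) || D (q |: s)) && (t \subset s)) i).
Proof.
rewrite symbolic_squareE gcm_live //; split=> [H i t t0 id|H i f m id [j mj]].
  have [x xt] := set0Pn _ t0.
  have neg A : [disjoint t & A] ->
      exact k (fun s => (t \subset s) && nearly D A s) i.
    (* divided by the product of all variables, [m] has exponent -1 on [t], 1 on [A], 0 elsewhere *)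
    move=> tA; pose m := (ind (~: t) 1 + ind A 1)%MM.
    have mE y : m y = ((y \notin t) + (y \in A))%N by rewrite mnmDE !indE !mul1n inE.
    have tA' y : y \in A -> (y \in t) = false by move=> yA; rewrite (disjointFl tA yA).
    apply: eq_exact (H i 1%N m id _) => [s|]; last by exists x; rewrite mE xt (disjointFr tA xt).
    rewrite live2E //; last by move=> y; rewrite mE; do 2!case: (_ \in _).
    set t' := [set _ | _]; set A' := [set _ | _].
    have -> : t' = t.
      apply/setP => y; rewrite inE mE.
      by case: (boolP (y \in A)) => [/tA'->|_] //; case: (y \in t).
    have -> // : A' = A.
    apply/setP => y; rewrite inE mE.
    by case: (boolP (y \in A)) => [/tA'->|_] //; case: (y \in t).
  split=> [|p q epq pt qt].
    apply: eq_exact (neg set0 _) => [s|]; last by rewrite -setI_eq0 setI0.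
    rewrite andbC /nearly setU0; congr (_ && _).
    by apply/orP/idP => [[//|/exists_inP[a]]|]; [rewrite inE|left].
  have pq : p != q by apply: contraTneq epq => ->; rewrite e_irr.
  apply: eq_exact (neg [set p; q] _) => [s|]; last first.
    rewrite -setI_eq0; apply/eqP/setP => y; rewrite !inE; apply/negbTE/negP.
    by case/andP=> yt /orP[]/eqP E; rewrite E ?(negbTE pt) ?(negbTE qt) in yt.
  rewrite andbC /nearly; congr (_ && _).
  have Ep : [set p; q] :\ p = [set q] by rewrite setU1K // inE.
  have Eq : [set p; q] :\ q = [set p] by rewrite setUC setU1K // inE eq_sym.
  apply/orP/orP => [[Ds|/exists_inP[a]]|[Ds|Ds]].
  - left; case: cD => _ Dd; apply: Dd Ds; rewrite setUC; apply: setUS.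
    by rewrite sub1set !inE eqxx.
  - by rewrite !inE => /orP[]/eqP->; rewrite ?Ep ?Eq setUC; [right|left].
  - by right; apply/exists_inP; exists q; rewrite ?inE ?eqxx ?orbT // Eq setUC.
  - by right; apply/exists_inP; exists p; rewrite ?inE ?eqxx // Ep setUC.
case: (boolP [forall x, m x <= f.+1]%N) => [/forallP mf|/forallPn[x]]; last first.
  by rewrite -ltnNge => mx; apply: (@live_cone _ _ _ _ _ _ x); rewrite addn2.
set t := [set x | (m x < f)%N].
have t0 : t != set0 by apply/set0Pn; exists j; rewrite inE.
have [exl exe] := H i t t0 id.
apply: eq_exact (exact_nearly (A := [set x | m x == f.+1]) t0 _ exl exe) => [s|].
  by rewrite live2E.
rewrite -setI_eq0; apply/eqP/setP => y; rewrite !inE; apply/negbTE/negP.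
by move=> /andP[+ /eqP E]; rewrite E; lia.
Qed.

Lemma link_mem i p : (p \in link_vertices e i) = (p != i) && ~~ e i p.
Proof. by rewrite !inE negb_or. Qed.

Lemma adjacent_dependent i p s : i \in s -> e i p -> D (p |: s) = false.
Proof.
move=> si eip; rewrite independentU1; apply/negP => /andP[_ /forall_inP/(_ i si)].
by rewrite e_sym eip.
Qed.

Lemma exact_star q t (d : nat) : q \notin t ->
  exact k (fun s => D (q |: s) && (t \subset s)) d.
Proof.
move=> qt; apply: (@exact_cone _ _ _ q) => s _.
by rewrite setUA setUid subset_setU1.
Qed.

End Graphs.


Theorem corollary3p9 (k : fieldType) (n : nat) (e : rel 'I_n)
    (e_sym : ssrbool.symmetric e) (e_irr : irreflexive e) :
  generalized_cohen_macaulay (@symbolic_square k n e) <->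
  (unmixed k e /\
   forall i : 'I_n, special_cm_graph k e (link_vertices e i)).
Proof.
set D := independent e; have cD : complex D := independent_complex e.
have single i : D [set i] := independent1 e_irr i.
rewrite gcm_graph // /unmixed edge_idealE // symb_unmixed //.
have subL i := subgraph_link e_sym e_irr i.
have edgeE i p q s : p \in link_vertices e i -> q \in link_vertices e i ->
    subgraph e (edge_vertices e (link_vertices e i) p q) s =
    link D i (p |: s) && link D i (q |: s).
  by move=> pW qW; rewrite subgraph_edge // subL.
split=> [H|[pure special]].
- have pure F : maxset D F -> #|F| = cdim D.
    move=> mF; have DF := maxsetp mF; apply/eqP; rewrite eqn_leq leq_cdim //= leqNgt.
    apply/negP => lt; case: (eqVneq F set0) => [F0|F0].
      have [F' /maxsetp DF' E] := cdim_facet cD.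
      have F'0 : F' = F by apply: (maxsetsup mF DF'); rewrite F0 sub0set.
      by rewrite -E F'0 ltnn in lt.
    (* [F] is the only face containing [F], and one set alone is not acyclic *)
    apply: (@exact_single k n _ F (oner_neq0 k)) (H _ _ F0 lt).1 => s /=.
    apply/andP/eqP => [[Ds Fs]|->]; last by [].
    exact: maxsetsup mF Ds Fs.
  split=> // i; have dL := cdim_link cD pure (single i).
  have ne t : i |: t != set0 by apply/set0Pn; exists i; rewrite setU11.
  split=> [|p q pW qW epq].
    apply/cm_graphE => //; rewrite subL => t j /andP[it _] jL.
    by apply/(exact_link k D j it); apply: (H j.+1 _ (ne t) _).1; rewrite -dL.
  have pi : i != p by rewrite eq_sym; move: pW; rewrite link_mem => /andP[].
  have qi : i != q by rewrite eq_sym; move: qW; rewrite link_mem => /andP[].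
  set T := edge_vertices e _ p q; have cT := subgraph_complex e T.
  have TE s : subgraph e T s = link D i (p |: s) && link D i (q |: s) := edgeE i p q s pW qW.
  have notin t : subgraph e T t -> [/\ p \notin t, q \notin t & i \notin t].
    rewrite TE => /andP[/andP[+ Dp] /andP[_ Dq]]; rewrite !inE negb_or => /andP[_ it].
    split=> //; apply/negP => xt.
      by move/independentP: Dq => /(_ p q); rewrite !inE xt eqxx !orbT epq => /(_ isT isT).
    by move/independentP: Dp => /(_ p q); rewrite !inE xt eqxx !orbT epq => /(_ isT isT).
  have exT t j : subgraph e T t -> (j.+2 < cdim D)%N ->
      exact k (fun s => subgraph e T s && (t \subset s)) j.
    move=> Tt jd; have [pt qt it] := notin t Tt.
    have := (H j.+2 _ (ne t) jd).2 p q epq.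
    rewrite !in_setU1 eq_sym (negbTE pi) [q == i]eq_sym (negbTE qi) => /(_ pt qt).
    move/(exact_two_stars k e_irr j pi qi pt qt it).
    by apply: eq_exact => s; rewrite TE.
  have dT : (cdim (subgraph e T)).+2 = cdim D.
    have [F mF FE] := cdim_facet cT; have TF := maxsetp mF.
    have [pF qF iF] := notin F TF; apply/eqP; rewrite eqn_leq; apply/andP; split.
      move: TF; rewrite TE => /andP[/andP[ipF /leq_cdim]].
      by rewrite !cardsU1 ipF pF FE.
    rewrite leqNgt -FE; apply/negP => lt.
    apply: (@exact_single k n _ F (oner_neq0 k)) (exT F _ TF lt) => s /=.
    apply/andP/eqP => [[Ts Fs]|->]; last by [].
    exact: maxsetsup mF Ts Fs.
  split; first by apply/cm_graphE => // t j Tt jT; apply: exT; rewrite -?dT.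
  rewrite !alphaE subL -/T; move: dT; rewrite -dL => -[<-].
  by rewrite subn1.
move=> i t t0 id; have [x xt] := set0Pn _ t0.
have dL := cdim_link cD pure (single x); have [cmL spL] := special x.
have {}cmL : reisner k (link D x) by rewrite -subL; apply/cm_graphE.
have tE := setD1K xt; have xt' : x \notin t :\ x by rewrite !inE eqxx.
have [_ Dd] := cD.
split=> [|p q epq pt qt].
  case: (boolP (D t)) => Dt; last first.
    by apply: exact0 => s; apply/negP => /andP[Ds ts]; case/negP: Dt; apply: Dd Ds.
  case: i id => [_|i id]; first by apply: exact0_at => /andP[_]; rewrite subset0 (negbTE t0).
  rewrite -tE; apply/exact_link => //; apply: cmL; last by rewrite -ltnS dL.
  by rewrite /link xt' tE.
case: (boolP (e x p)) => exp.
  apply: eq_exact (@exact_star k n e q t i qt) => s.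
  case: (boolP (t \subset s)) => ts; last by rewrite !andbF.
  by rewrite (adjacent_dependent e_sym e_irr _ exp) // (subsetP ts).
case: (boolP (e x q)) => exq.
  apply: eq_exact (@exact_star k n e p t i pt) => s.
  case: (boolP (t \subset s)) => ts; last by rewrite !andbF.
  by rewrite (adjacent_dependent e_sym e_irr _ exq) ?orbF // (subsetP ts).
have xp : x != p by apply: contraNneq pt => <-.
have xq : x != q by apply: contraNneq qt => <-.
have pW : p \in link_vertices e x by rewrite link_mem eq_sym xp.
have qW : q \in link_vertices e x by rewrite link_mem eq_sym xq.
(* sets of size 0 and 1 are below the range of Mayer-Vietoris *)
case: i id => [|[|i]] id.
- by apply: exact0_at => /andP[_]; rewrite subset0 (negbTE t0).
- rewrite -tE; apply/(exact_link k (fun s => D (p |: s) || D (q |: s)) 0 xt').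
  apply: exact0_at => /andP[_ tx]; exists p; rewrite /link inE xp /=.
  rewrite (subset_trans tx) ?sub0set // andbT; apply/orP; left.
  rewrite setUCA setUid /D independentU1 // -/D single; apply/forall_inP => y.
  by rewrite inE => /eqP->.
have [cmT aT] := spL p q pW qW epq; rewrite !alphaE subL in aT.
have {}cmT : reisner k _ := (cm_graphE k e _).1 cmT.
rewrite -tE; apply/exact_two_stars => //; rewrite ?inE ?(negbTE pt) ?(negbTE qt) ?andbF //.
set T := edge_vertices e _ p q in cmT aT.
case: (boolP (subgraph e T (t :\ x))) => Tt.
  have iT : (i < cdim (subgraph e T))%N by rewrite aT ltn_subRL add1n -ltnS dL.
  by apply: eq_exact (cmT _ i Tt iT) => s; rewrite edgeE.
apply: exact0 => s; apply/negP => /andP[Ts ts]; case/negP: Tt.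
have [_ Td] := subgraph_complex e T; apply: Td ts _.
by rewrite edgeE.
Qed.
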